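(* Let $n$ be a positive multiple of $4$, let $c_e\ge 0$ and $0<c_l\le c_L$. Let $x^*\in\mathcal C^n$ and $f^*\in\mathcal{BL}[c_l,c_L,c_e]$, and suppose the observed random symmetric matrix $A\in\mathbb R^{n\times n}$ satisfies $A_{ii}=0$ and $A_{ij}=F_{ij}+E_{ij}$ for $1\le i<j\le n$, where $F$ is symmetric with $F_{ij}=f^*(x_i^*,x_j^* )$ for $i<j$, and the centered independent variables $(E_{ij})_{i<j}$ satisfy the subGaussian(1) condition. Let $\hat x\in\mathcal C^n$ be the output of the Localize-and-Refine procedure applied to $A$. Then there exists a constant $C'_{lLe}>0$ depending only on $c_e,c_l,c_L$ such that, with probability at least $1-5/n^2$, for any $(x,f)\in\mathcal R[F,c_l,c_L,c_e]$, $$\min_{Q\in\mathcal O}d_\infty(\hat x,Qx)\le C'_{lLe}\left(d_\infty(x,\Pi_n)+\sqrt{\frac{\log n}{n}}\right).$$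
   Context: Geometry. $\mathcal C$ is the unit circle in $\mathbb R^2$, identified with unit complex numbers; $x\in\mathcal C$ has argument $\underline x\in[0,2\pi)$; $d(x,y)=|\underline x-\underline y|\wedge(2\pi-|\underline x-\underline y|)$ is the geodesic distance. For tuples $x,y$ of points of $\mathcal C$ indexed by the same set, $d_\infty(x,y)=\max_i d(x_i,y_i)$. For $k\ge1$: $\mathcal C_k=\{e^{\iota 2\pi j/k}:0\le j\le k-1\}$, and $\Pi_k$ is the set of $k$-tuples $(e^{\iota2\pi\sigma(j)/k})_{1\le j\le k}$, $\sigma$ a permutation of $\{1,\dots,k\}$ (similarly for tuples indexed by a set of cardinality $k$). $d_\infty(x,\Pi_k)=\min_{y\in\Pi_k}d_\infty(x,y)$. $\mathcal O$ is the orthogonal group of $\mathbb R^2$, and $Qx=(Qx_1,\dots,Qx_n)$. Bi-Lipschitz class. $\mathcal{BL}[c_l,c_L,c_e]$ is the set of symmetric functions $f:\mathcal C\times\mathcal C\to[0,1]$ such that for all $x,y,y'\in\mathcal C$, with $\varepsilon_n=c_e\sqrt{\log(n)/n}$: $|f(x,y)-f(x,y')|\le c_Ld(y,y')+\varepsilon_n$; and $f(x,y')-f(x,y)\ge c_l(d(x,y)-d(x,y'))-\varepsilon_n$ whenever $d(x,y)\ge d(x,y')$. Representations. $\mathcal R[F,c_l,c_L,c_e]=\{(x,f)\in\mathcal C^n\times\mathcal{BL}[c_l,c_L,c_e]: f(x_i,x_j)=F_{ij}\ \forall i<j\}$. SubGaussian(1) condition: for every $B\in\mathbb R^{n\times n}$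 and $t\ge0$, $\mathbb P\big[\sum_{i<j}B_{ij}E_{ij}>t\sqrt{\sum_{i<j}B_{ij}^2}\big]\le e^{-t^2/2}$. Localize-and-Refine procedure. Let $n_0=n/4$. For index sets, $A_{SS'}=[A_{ij}]_{i\in S,j\in S'}$, $\bar S=\{1,\dots,n\}\setminus S$; $\langle\cdot,\cdot\rangle$ is the entrywise (Frobenius) scalar product; $D(x_S)=[d(x_i,x_j)]_{i,j\in S}$, $D(z,x_S)=[d(z,x_j)]_{j\in S}$. Ties in argmins are broken arbitrarily (measurably). (A) Draw $S\subset\{1,\dots,n\}$, $|S|=n_0$, uniformly at random (independently of $A$). Compute $\hat x^{(1)}_S\in\arg\min_{x_S\in\Pi_{n_0}}\langle A_{SS},D(x_S)\rangle$, and for each $i\in\bar S$, $\hat x^{(2)}_i\in\arg\min_{z\in\mathcal C_{n_0}}\langle A_{i,S},D(z,\hat x^{(1)}_S)\rangle$. (B) Draw $S'\subset\bar S$, $|S'|=n_0$, uniformly at random. Compute $\hat x^{(1')}_{S'}\in\arg\min_{x_{S'}\in\Pi_{n_0}}\langle A_{S'S'},D(x_{S'})\rangle$ and for $i\in\bar S'$, $\hat x^{(2')}_i\in\arg\min_{z\in\mathcal C_{n_0}}\langle A_{i,S'},D(z,\hat x^{(1')}_{S'})\rangle$. (C) Compute $\hat Q\in\arg\min_{Q\in\mathcal O}d_\infty(\hat x^{(2)}_{\bar S\cap\bar S'},Q\hat x^{(2')}_{\bar S\cap\bar S'})$. Output $\hat x$ with $\hat x_j=\hat x^{(2)}_j$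 for $j\in\bar S$ and $\hat x_j=\hat Q\hat x^{(2')}_j$ for $j\in S$. *)

(* Defs.v *)
From HB Require Import structures.
From mathcomp Require Import all_boot all_order all_algebra.
From mathcomp Require Import all_classical all_reals all_analysis.

Set Implicit Arguments.
Unset Strict Implicit.
Unset Printing Implicit Defensive.

Import Order.TTheory GRing.Theory Num.Theory.

Local Open Scope classical_set_scope.
Local Open Scope ring_scope.

(** * Geometry of the unit circle *)

Record circle (R : realType) := Circle {
  cpoint :> 'cV[R]_2;
  cpointP : cpoint^T *m cpoint == 1%:M }.

HB.instance Definition _ (R : realType) := [isSub for @cpoint R].
HB.instance Definition _ (R : realType) := [Choice of circle R by <:].

Record orthogonal (R : realType) := Orthogonal {
  omx :> 'M[R]_2;
  omxP : omx^T *m omx == 1%:M }.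

HB.instance Definition _ (R : realType) := [isSub for @omx R].
HB.instance Definition _ (R : realType) := [Choice of orthogonal R by <:].

Lemma cis_subproof (R : realType) (t : R) :
  let v : 'cV[R]_2 := \col_i (if i == 0 then cos t else sin t) in
  v^T *m v == 1%:M.
Proof.
apply/eqP/matrixP => i j; rewrite !ord1 !mxE big_ord_recl big_ord1 !mxE /=.
by rewrite -!expr2 cos2Dsin2.
Qed.

(* The point of argument t, identified with the complex number e^{it}. *)
Definition cis (R : realType) (t : R) : circle R := Circle (cis_subproof t).

Lemma oact_subproof (R : realType) (Q : orthogonal R) (x : circle R) :
  (Q *m x)^T *m (Q *m x) == 1%:M.
Proof.
rewrite trmx_mul mulmxA -(mulmxA (cpoint x)^T) (eqP (omxP Q)) mulmx1.
exact: cpointP.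
Qed.

Definition oact (R : realType) (Q : orthogonal R) (x : circle R) : circle R :=
  Circle (oact_subproof Q x).

Definition arg (R : realType) (x : circle R) : R :=
  xget 0 [set t : R | 0 <= t < 2 * pi /\ cis t = x].

Lemma argP (R : realType) (x : circle R) :
  0 <= arg x < 2 * pi /\ cis (arg x) = x.
Proof.
suff: [set t : R | 0 <= t < 2 * pi /\ cis t = x] (arg x) by [].
rewrite /arg; apply: xgetPex => /=.
have pi0 : (0 : R) < pi by exact: pi_gt0.
have Hs : cpoint x 0 0 ^+ 2 + cpoint x 1 0 ^+ 2 = 1.
  have /eqP/matrixP/(_ 0 0) := cpointP x.
  rewrite !mxE big_ord_recl big_ord1 !mxE /= !mulr1n -!expr2 => <-.
  by congr (_ + cpoint x _ _ ^+ 2); exact/val_inj.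
set a := cpoint x 0 0 in Hs; set b := cpoint x 1 0 in Hs.
have a1 : -1 <= a <= 1.
  rewrite -ler_norml -(@ler_pXn2r _ 2) ?nnegrE ?normr_ge0// expr1n real_normK ?num_real//.
  by rewrite -Hs lerDl sqr_ge0.
have sb : Num.sqrt (1 - a ^+ 2) = `|b|.
  by rewrite -Hs addrAC subrr add0r sqrtr_sqr.
have E t : cos t = a -> sin t = b -> cis t = x.
  move=> ct st; apply/val_inj/matrixP => i j; rewrite ord1 /= mxE.
  case: ifPn => [/eqP ->|]; first by rewrite ct.
  case: i => [[|[|//]] Hi] // _; rewrite st /b; congr (cpoint x _ _).
  exact/val_inj.
have [b0|b0] := leP 0 b.
  exists (acos a); split; last first.
    by apply: E; rewrite ?acosK ?in_itv//= sin_acos// sb ger0_norm.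
  rewrite acos_ge0//= (le_lt_trans (acos_lepi a1))//.
  by rewrite mulrDl mul1r ltrDl.
have b1 : a < 1.
  rewrite lt_neqAle (andP a1).2 andbT; apply/eqP => a_eq1.
  move: Hs; rewrite a_eq1 expr1n => /(canRL (addKr _)); rewrite addNr => /eqP.
  by rewrite sqrf_eq0 => /eqP b_eq0; rewrite b_eq0 ltxx in b0.
exists (pi *+ 2 - acos a); split.
  rewrite mulr_natl subr_ge0 ltrBlDr ltrDl acos_gt0 ?(andP a1).1 ?b1//= andbT.
  by rewrite (le_trans (acos_lepi a1))// mulr2n lerDl ltW.
apply: E.
  by rewrite addrC cosD2pi cosN acosK// in_itv.
by rewrite addrC sinD2pi sinN sin_acos// sb ltr0_norm// opprK.
Qed.

Definition gdist (R : realType) (x y : circle R) : R :=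
  Num.min `|arg x - arg y| (2 * pi - `|arg x - arg y|).

Definition dinf (R : realType) (I : finType) (x y : I -> circle R) : R :=
  \big[Num.max/0]_(i : I) gdist (x i) (y i).

Definition circle_root (R : realType) (k j : nat) : circle R :=
  cis (2 * pi * j%:R / k%:R).

Definition grid (R : realType) (k : nat) : set (circle R) :=
  [set circle_root R k j | j in [set j : nat | (j < k)%N]].

(* [Pi_k] for tuples indexed by [I]; it is empty unless [#|I| = k].  A bijection
   to ['I_k] shifted by one is a labelling by 1, ..., k. *)
Definition PiSet (R : realType) (k : nat) (I : finType) :
    set (I -> circle R) :=
  [set x | exists2 s : I -> 'I_k, bijective s &
             forall i, x i = circle_root R k (s i).+1].

(* The infima below are minima: the first is over a finite nonempty set, the
   second is attained because the orthogonal group is compact. *)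
Definition dist_PiSet (R : realType) (n : nat) (x : 'I_n -> circle R) : R :=
  inf [set dinf x y | y in @PiSet R n 'I_n].

Definition dist_mod_orth (R : realType) (n : nat)
    (x y : 'I_n -> circle R) : R :=
  inf [set dinf x (oact Q \o y) | Q in [set: orthogonal R]].

(** * Bi-Lipschitz functions and representations *)

Definition log_rate (R : realType) (n : nat) : R :=
  Num.sqrt (ln n%:R / n%:R).

Definition biLip (R : realType) (n : nat) (cl cL ce : R) :
    set (circle R -> circle R -> R) :=
  [set f | [/\ forall x y, f x y = f y x,
               forall x y, 0 <= f x y <= 1,
               forall x y y',
                 `|f x y - f x y'| <= cL * gdist y y' + ce * log_rate R n &
               forall x y y', gdist x y' <= gdist x y ->
                 cl * (gdist x y - gdist x y') - ce * log_rate R n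
                   <= f x y' - f x y] ].

Definition represents (R : realType) (n : nat) (F : 'M[R]_n)
    (x : 'I_n -> circle R) (f : circle R -> circle R -> R) : Prop :=
  forall i j : 'I_n, (i < j)%N -> F i j = f (x i) (x j).

Definition representations (R : realType) (n : nat) (F : 'M[R]_n)
    (cl cL ce : R) :
    set (('I_n -> circle R) * (circle R -> circle R -> R)) :=
  [set xf | biLip n cl cL ce xf.2 /\ represents F xf.1 xf.2].

(** * Probability *)

Definition gen_sigma (R : realType) (U K : Type) (X : K -> U -> R) :
    set (set U) :=
  <<s [set G | exists k, exists2 B : set R, measurable B & G = X k @^-1` B] >>.

Definition indep_systems (d : measure_display) (T : measurableType d)
    (R : realType) (P : probability T R) (G H : set (set T)) : Prop :=
  forall g h, G g -> H h -> P (g `&` h) = (P g * P h)%E.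

Definition mutually_indep (d : measure_display) (T : measurableType d)
    (R : realType) (P : probability T R) (I : finType) (D : pred I)
    (X : I -> T -> R) : Prop :=
  forall (J : {set I}) (B : I -> set R),
    (forall i, i \in J -> D i) -> (forall i, measurable (B i)) ->
    P (\bigcap_(i in [set` J]) (X i @^-1` B i))
      = (\prod_(i in J) P (X i @^-1` B i))%E.

Definition subGaussian1 (d : measure_display) (T : measurableType d)
    (R : realType) (P : probability T R) (n : nat)
    (E : 'I_n -> 'I_n -> T -> R) : Prop :=
  forall (B : 'M[R]_n) (t : R), 0 <= t ->
    (P [set w | (t * Num.sqrt (\sum_(i < n) \sum_(j < n | (i < j)%N) B i j ^+ 2)
              < \sum_(i < n) \sum_(j < n | (i < j)%N) B i j * E i j w)%R ]
      <= (expR (- (t ^+ 2) / 2))%:E)%E.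

Definition uniform_mass (R : realType) (W : finType) (D : pred W) (w : W) : R :=
  if D w then #|D|%:R^-1 else 0.

(* S is uniform among the n0-subsets of {1..n}; given S, the set S' is uniform
   among the n0-subsets of the complement of S. *)
Definition uniform_draws (d : measure_display) (T : measurableType d)
    (R : realType) (P : probability T R) (n n0 : nat)
    (S S' : T -> {set 'I_n}) : Prop :=
  [/\ forall s, measurable (S @^-1` [set s]) /\ measurable (S' @^-1` [set s]),
      forall s, P (S @^-1` [set s])
        = (uniform_mass R (fun s : {set 'I_n} => #|s| == n0) s)%:E &
      forall s s', P (S @^-1` [set s] `&` S' @^-1` [set s'])
        = (P (S @^-1` [set s]) *
            (uniform_mass R
               (fun u : {set 'I_n} => (u \subset ~: s)%SET && (#|u| == n0))
               s')%:E)%E].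

Definition indep_draws (d : measure_display) (T : measurableType d)
    (R : realType) (P : probability T R) (n : nat)
    (A : T -> 'M[R]_n) (S S' : T -> {set 'I_n}) : Prop :=
  indep_systems P
    (gen_sigma (fun (k : 'I_n * 'I_n) w => A w k.1 k.2))
    [set (fun w => (S w, S' w)) @^-1` B | B in [set: set ({set 'I_n} * {set 'I_n})]].

(** * The Localize-and-Refine procedure *)

Definition is_argmin (R : realType) (X : Type) (D : set X) (f : X -> R)
    (x : X) : Prop :=
  D x /\ forall y, D y -> f x <= f y.

Definition idx (n : nat) (S : {set 'I_n}) : finType := {i : 'I_n | i \in S}.

(* Tie-breaking in the localization and refinement steps, as measurable
   selections of the argmins.  A selection sees only the data of its own
   minimization problem: A_{SS} for the first one, A_{i,S} and the localized
   tuple for the second one.  The latter tuple ranges over a finite set, so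
   measurability is required for each of its values separately. *)
Record stage_rule (R : realType) (n n0 : nat) := StageRule {
  localize : forall S : {set 'I_n},
    (idx S -> idx S -> R) -> idx S -> circle R;
  refine_at : forall S : {set 'I_n}, 'I_n ->
    (idx S -> R) -> (idx S -> circle R) -> circle R;
  localize_argmin : forall S : {set 'I_n}, #|S| = n0 -> forall M,
    is_argmin (@PiSet R n0 (idx S))
      (fun x => \sum_i \sum_j M i j * gdist (x i) (x j)) (localize M);
  localize_measurable : forall S : {set 'I_n}, #|S| = n0 -> forall v,
    gen_sigma (fun (k : idx S * idx S) (M : idx S -> idx S -> R) => M k.1 k.2)
      (@localize S @^-1` [set v]);
  refine_argmin : forall S : {set 'I_n}, #|S| = n0 ->
    forall (i : 'I_n) a x, i \notin S -> @PiSet R n0 (idx S) x ->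
    is_argmin (@grid R n0)
      (fun z => \sum_j a j * gdist z (x j)) (refine_at i a x);
  refine_measurable : forall S : {set 'I_n}, #|S| = n0 ->
    forall (i : 'I_n) x z, i \notin S -> @PiSet R n0 (idx S) x ->
    gen_sigma (fun (k : idx S) (a : idx S -> R) => a k)
      [set a | refine_at i a x = z] }.

(* The tuples to be aligned take finitely many values (in the grid), so no
   measurability condition is needed here. *)
Record align_rule (R : realType) (n : nat) := AlignRule {
  align : forall U : {set 'I_n},
    (idx U -> circle R) -> (idx U -> circle R) -> orthogonal R;
  align_argmin : forall (U : {set 'I_n}) (x y : idx U -> circle R),
    is_argmin [set: orthogonal R] (fun Q => dinf x (oact Q \o y)) (align x y) }.

(* Meaningful only at the indices outside S. *)
Definition stage (R : realType) (n n0 : nat) (r : stage_rule R n n0)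
    (A : 'M[R]_n) (S : {set 'I_n}) : 'I_n -> circle R :=
  let x1 := localize r (fun i j : idx S => A (val i) (val j)) in
  fun i => refine_at r i (fun j : idx S => A i (val j)) x1.

Definition localize_and_refine (R : realType) (n n0 : nat)
    (rA rB : stage_rule R n n0) (rC : align_rule R n)
    (A : 'M[R]_n) (S S' : {set 'I_n}) : 'I_n -> circle R :=
  let x2 := stage rA A S in
  let x2' := stage rB A S' in
  let U := (~: S :&: ~: S')%SET in
  let Q := align rC (fun i : idx U => x2 (val i)) (fun i : idx U => x2' (val i)) in
  fun j => if j \in S then oact Q (x2' j) else x2 j.

(* Main.v *)
(* Fix one nearly optimal representation (x0, p0) of F, with p0 in Pi_n; the good
   event depends on it only.  Write -c_l d + g for the signal: g is antitone in
   the distance up to epsilon, and the distances from a grid point to the grid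
   points form a fixed multiset, so a rearrangement inequality shows that the
   objective <F, D(y)> exceeds its value at the truth by (c_l / 2) |D(y) - D(x)|^2.
   Comparing with the noise, of order sqrt(n log n) |D(y) - D(x)| by a union bound
   over all permutations, gives |D(y) - D(x)|_1 = O(n^2 eta).  The matrix
   (2/n) sum_k y_k x_k^T then nearly maps x to y and is nearly orthogonal, whence an
   l1 bound modulo an orthogonal map.  The same inequality for one row, with a noise
   independent of the localized tuple, turns it into a uniform bound for each
   refined point.  Since S and S' are themselves evenly spread, so is the complement
   of their union, on which the two alignments are compared.  Finally, the
   noiseless procedure shows that any two representations agree up to an orthogonal
   map, which passes from x0 to all of them. *)

Require Import Defs.
From mathcomp Require Import all_boot all_order all_algebra.
From mathcomp Require Import all_classical all_reals all_analysis.
From mathcomp Require Import ring lra zify.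

Set Implicit Arguments.
Unset Strict Implicit.
Unset Printing Implicit Defensive.

Import Order.TTheory GRing.Theory Num.Theory numFieldNormedType.Exports.
Local Open Scope classical_set_scope.
Local Open Scope ring_scope.

(** * Geometry of the circle *)

(** Localization controls the placement only on average, so some sampled points may end far from
    their true position. Uniform control comes from the refinement, which never places a point of
    its own sample; hence two disjoint samples and a final alignment. The good event must serve an
    uncountable family of representations, so it may refer to one of them only. The least distance
    to $\Pi_n$ over all representations need not be attained: [x0], [p0] reach it within [log_rate],
    which keeps [dinf x0 p0] below [dist_PiSet x + log_rate] for every representation [x]. A
    bi-Lipschitz function decreases with the distance only up to [eps], so the concave potential
    behind the rearrangement is built from a running infimum and not from the signal itself. The
    five terms $1/n^2$ are the localization noise, the refinement noise of each sample and the
    uneven spread of each sample. *)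

Section CircleGeometry.
Variable R : realType.
Implicit Types (x y z : circle R) (s t u : R) (Q : Defs.orthogonal R).

Definition cx x : R := Defs.cpoint x 0 0.
Definition cy x : R := Defs.cpoint x 1 0.
Definition dot x y : R := cx x * cx y + cy x * cy y.

Lemma cx_cis t : cx (cis t) = cos t.
Proof. by rewrite /cx mxE. Qed.

Lemma cy_cis t : cy (cis t) = sin t.
Proof. by rewrite /cy mxE. Qed.

Lemma circle_ext x y : cx x = cx y -> cy x = cy y -> x = y.
Proof.
move=> hx hy; apply/val_inj/matrixP => i j; rewrite ord1.
case: i => [[|[|//]] Hi].
  by move: hx; rewrite /cx (_ : Ordinal Hi = 0) //; exact/val_inj.
by move: hy; rewrite /cy (_ : Ordinal Hi = 1) //; exact/val_inj.
Qed.

Lemma cx2cy2 x : cx x ^+ 2 + cy x ^+ 2 = 1.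
Proof.
have /eqP/matrixP/(_ 0 0) := cpointP x.
rewrite !mxE big_ord_recl big_ord1 !mxE /= !mulr1n -!expr2 => <-.
by congr (_ + Defs.cpoint x _ _ ^+ 2); exact/val_inj.
Qed.

Lemma cisP x : exists t, x = cis t.
Proof. by exists (arg x); rewrite (argP x).2. Qed.

Lemma dot_cis s t : dot (cis s) (cis t) = cos (s - t).
Proof. by rewrite /dot !cx_cis !cy_cis cosB. Qed.

Lemma gdist_bounds x y : 0 <= gdist x y <= pi.
Proof.
have [/andP[h1 h2] _] := argP x; have [/andP[h3 h4] _] := argP y.
have h : `|arg x - arg y| <= 2 * pi by rewrite ler_norml; lra.
rewrite /gdist /Num.min; have := normr_ge0 (arg x - arg y).
by case: ltP => h5 h6; lra.
Qed.

Lemma gdist_ge0 x y : 0 <= gdist x y.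
Proof. by case/andP: (gdist_bounds x y). Qed.

Lemma gdist_le_pi x y : gdist x y <= pi.
Proof. by case/andP: (gdist_bounds x y). Qed.

Lemma gdist_le4 x y : gdist x y <= 4.
Proof. by have := gdist_le_pi x y; have := pihalf_lt2 R; lra. Qed.

Lemma cos_gdist x y : cos (gdist x y) = dot x y.
Proof.
rewrite -(argP x).2 -(argP y).2 dot_cis (argP x).2 (argP y).2.
rewrite /gdist /Num.min; case: ltP => _; first by rewrite cos_norm.
by rewrite mulr_natl addrC cosD2pi cosN cos_norm.
Qed.

(** As [gdist] lies in $[0,\pi]$, its cosine determines it. The piecewise definition through
    arguments becomes a function of the scalar product, from which symmetry and orthogonal
    invariance are immediate. *)
Lemma gdist_acos x y : gdist x y = acos (dot x y).
Proof. by rewrite -cos_gdist cosK // in_itv /= gdist_bounds. Qed.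

Lemma gdistC x y : gdist x y = gdist y x.
Proof. by rewrite !gdist_acos; congr acos; rewrite /dot; ring. Qed.

Lemma gdistxx x : gdist x x = 0.
Proof. by rewrite gdist_acos /dot -!expr2 cx2cy2 acos1. Qed.

Lemma gdist_cis_eq s t : `|s - t| <= pi -> gdist (cis s) (cis t) = `|s - t|.
Proof.
by move=> h; rewrite gdist_acos dot_cis -cos_norm cosK // in_itv /= normr_ge0.
Qed.

Lemma gdist_cis_le s t : gdist (cis s) (cis t) <= `|s - t|.
Proof.
have [h|h] := leP `|s - t| pi; first by rewrite gdist_cis_eq.
exact: le_trans (gdist_le_pi _ _) (ltW h).
Qed.

(** Choosing the lift of [x] nearest to [t] turns the geodesic distance into an absolute value; two
    successive lifts reduce the triangle inequality to that of the real line. *)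
Lemma cis_lift x t : exists2 s, x = cis s & gdist x (cis t) = `|s - t|.
Proof.
have [a ->] := cisP x; set th := gdist _ _.
have th0 : 0 <= th by exact: gdist_ge0.
have hc : cos th = cos (a - t) by rewrite cos_gdist dot_cis.
have : a = t + (a - t) by ring.
move: (a - t) hc => b hc ab.
have /orP[/eqP hs|/eqP hs] : (sin b == sin th) || (sin b == - sin th).
- by rewrite -eqf_sqr !sin2cos2 hc.
- exists (t + th); last by rewrite addrAC subrr add0r ger0_norm.
  by rewrite ab; apply: circle_ext; rewrite ?cx_cis ?cy_cis ?cosD ?sinD hc hs.
exists (t - th); last by rewrite addrAC subrr add0r normrN ger0_norm.
by rewrite ab; apply: circle_ext; rewrite ?cx_cis ?cy_cis ?cosD ?sinD hs -hc cosN sinN.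
Qed.

Lemma gdist_triangle y x z : gdist x z <= gdist x y + gdist y z.
Proof.
have [t ->] := cisP z; have [s -> ->] := cis_lift y t.
have [u -> ->] := cis_lift x s.
apply: le_trans (gdist_cis_le _ _) _.
exact: ler_distD.
Qed.

Lemma gdist_subl x y z : `|gdist x z - gdist y z| <= gdist x y.
Proof.
have := gdist_triangle y x z; have := gdist_triangle x y z.
by rewrite (gdistC y x) ler_norml; lra.
Qed.

Lemma cx_oact Q x : cx (oact Q x) = omx Q 0 0 * cx x + omx Q 0 1 * cy x.
Proof.
rewrite /cx /cy /= mxE big_ord_recl big_ord1; congr (_ + omx Q _ _ * Defs.cpoint x _ _);
exact/val_inj.
Qed.

Lemma cy_oact Q x : cy (oact Q x) = omx Q 1 0 * cx x + omx Q 1 1 * cy x.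
Proof.
rewrite /cx /cy /= mxE big_ord_recl big_ord1; congr (_ + omx Q _ _ * Defs.cpoint x _ _);
exact/val_inj.
Qed.

Lemma omx_cols Q :
  [/\ omx Q 0 0 ^+ 2 + omx Q 1 0 ^+ 2 = 1,
      omx Q 0 1 ^+ 2 + omx Q 1 1 ^+ 2 = 1 &
      omx Q 0 0 * omx Q 0 1 + omx Q 1 0 * omx Q 1 1 = 0].
Proof.
have /eqP/matrixP H := omxP Q.
have e : lift ord0 ord0 = 1 :> 'I_2 by exact/val_inj.
split.
- by have := H 0 0; rewrite !mxE big_ord_recl big_ord1 !mxE e.
- by have := H 1 1; rewrite !mxE big_ord_recl big_ord1 !mxE e.
- by have := H 0 1; rewrite !mxE big_ord_recl big_ord1 !mxE e.
Qed.

Lemma dot_oact Q x y : dot (oact Q x) (oact Q y) = dot x y.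
Proof.
have [h1 h2 h3] := omx_cols Q.
rewrite /dot !cx_oact !cy_oact.
set a := omx Q 0 0 in h1 h3 *; set b := omx Q 0 1 in h2 h3 *.
set c := omx Q 1 0 in h1 h3 *; set d := omx Q 1 1 in h2 h3 *.
transitivity ((a ^+ 2 + c ^+ 2) * (cx x * cx y) + (b ^+ 2 + d ^+ 2) * (cy x * cy y)
  + (a * b + c * d) * (cx x * cy y + cy x * cx y)); first by ring.
by rewrite h1 h2 h3; ring.
Qed.

Lemma gdist_oact Q x y : gdist (oact Q x) (oact Q y) = gdist x y.
Proof. by rewrite !gdist_acos dot_oact. Qed.

Lemma omul_subproof Q Q' : (omx Q *m omx Q')^T *m (omx Q *m omx Q') == 1%:M.
Proof.
rewrite trmx_mul mulmxA -(mulmxA (omx Q')^T) (eqP (omxP Q)) mulmx1.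
exact: omxP.
Qed.

Definition omul Q Q' : Defs.orthogonal R := Orthogonal (omul_subproof Q Q').

Lemma oact_mul Q Q' x : oact (omul Q Q') x = oact Q (oact Q' x).
Proof. by apply/val_inj; rewrite /= mulmxA. Qed.

Lemma ortho_inv_subproof Q : ((omx Q)^T)^T *m (omx Q)^T == 1%:M.
Proof. by rewrite trmxK; apply/eqP/mulmx1C/eqP/omxP. Qed.

Definition ortho_inv Q : Defs.orthogonal R := Orthogonal (ortho_inv_subproof Q).

Lemma oid_subproof : (1%:M : 'M[R]_2)^T *m 1%:M == 1%:M.
Proof. by rewrite trmx1 mulmx1. Qed.

Definition oid : Defs.orthogonal R := Orthogonal oid_subproof.

Lemma orthogonal_rows (a b c d : R) :
  a ^+ 2 + c ^+ 2 = 1 -> b ^+ 2 + d ^+ 2 = 1 -> a * b + c * d = 0 ->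
  exists Q, [/\ omx Q 0 0 = a, omx Q 0 1 = b, omx Q 1 0 = c & omx Q 1 1 = d].
Proof.
move=> h1 h2 h3.
pose M : 'M[R]_2 := \matrix_(i, j)
  (if i == 0 then (if j == 0 then a else b) else (if j == 0 then c else d)).
have hM : M^T *m M == 1%:M.
  apply/eqP/matrixP => i j; rewrite !mxE big_ord_recl big_ord1 !mxE /=.
  case: i => [[|[|//]] Hi]; case: j => [[|[|//]] Hj] /=;
    rewrite -?expr2 ?h1 ?h2 ?h3 //.
  by rewrite [b * a]mulrC [d * c]mulrC h3.
by exists (Orthogonal hM); rewrite /= !mxE.
Qed.

Lemma sin_mvt t : 0 < t ->
  exists2 c, c \in `]0, t[ & sin t - sin 0 = cos c * (t - 0).
Proof.
move=> t0; apply: MVT => //.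
by apply: continuous_subspaceT => u; exact: continuous_sin.
Qed.

Lemma sin_le_id t : 0 <= t -> sin t <= t.
Proof.
rewrite le_eqVlt => /predU1P[<-|t0]; first by rewrite sin0.
have [c _] := sin_mvt t0.
rewrite sin0 !subr0 => ->.
by rewrite -[leRHS]mul1r ler_wpM2r ?cos_le1 // ltW.
Qed.

Lemma sin_ge_id_cos t : 0 <= t <= pi -> t * cos t <= sin t.
Proof.
case/andP; rewrite le_eqVlt => /predU1P[<-|t0] tp; first by rewrite sin0 mul0r.
have [c] := sin_mvt t0.
rewrite in_itv /= => /andP[c0 ct].
rewrite sin0 !subr0 => ->; rewrite mulrC ler_wpM2r ?(ltW t0) //.
by rewrite ltW // ltr_cos // in_itv /=; apply/andP; split; lra.
Qed.

Lemma cos_double t : cos t = 1 - 2 * sin (t / 2) ^+ 2.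
Proof.
have -> : cos t = cos ((t / 2) *+ 2) by congr cos; rewrite -mulr_natr; field.
by rewrite cos_mulr2n cos2sin2 -mulr_natr; ring.
Qed.

Definition chord2 x y : R := (cx x - cx y) ^+ 2 + (cy x - cy y) ^+ 2.

Lemma chord2E x y : chord2 x y = 2 - 2 * dot x y.
Proof.
have := cx2cy2 x; have := cx2cy2 y => h1 h2.
transitivity ((cx x ^+ 2 + cy x ^+ 2) + (cx y ^+ 2 + cy y ^+ 2) - 2 * dot x y).
  by rewrite /chord2 /dot; ring.
by rewrite h1 h2; ring.
Qed.

Lemma chord2_sin x y : chord2 x y = (2 * sin (gdist x y / 2)) ^+ 2.
Proof. by rewrite chord2E -cos_gdist cos_double; ring. Qed.

Lemma chord2_le x y : chord2 x y <= gdist x y ^+ 2.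
Proof.
rewrite chord2_sin ler_pXn2r ?nnegrE ?gdist_ge0 //.
  have := @sin_le_id (gdist x y / 2); rewrite divr_ge0 ?gdist_ge0 //.
  by move/(_ isT) => h; lra.
have h := gdist_bounds x y.
by rewrite mulr_ge0 // sin_ge0_pi //; have := pi_ge0 R; lra.
Qed.

(** Amounts to $\sin(\theta/2)\ge\theta/4$ on $[0,\pi]$, from the double-angle formula, $t\cos
    t\le\sin t$ and $\cos^2(\theta/4)\ge1/2$. With [chord2_le], distances and chords are
    interchangeable up to a factor 2, so linear algebra applies. *)
Lemma gdist_le_chord2 x y : gdist x y ^+ 2 <= 4 * chord2 x y.
Proof.
rewrite chord2_sin; set th := gdist x y.
have [h0 hpi] := andP (gdist_bounds x y); rewrite -/th in h0 hpi.
have hp := pi_gt0 R.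
have hs : th / 4 <= sin (th / 2).
  have -> : th / 2 = th / 4 + th / 4 by field.
  rewrite sinD.
  have c4 : 0 <= cos (th / 4) by apply: cos_ge0_pihalf; lra.
  have h1 : th / 4 * cos (th / 4) <= sin (th / 4).
    by apply: sin_ge_id_cos; lra.
  have h2 : 1 / 2 <= cos (th / 4) ^+ 2.
    have : 0 <= cos (th / 4 *+ 2).
      by apply: cos_ge0_pihalf; rewrite -mulr_natr; lra.
    by rewrite cos_mulr2n -mulr_natr; lra.
  have h3 : cos (th / 4) * (th / 4 * cos (th / 4)) <= cos (th / 4) * sin (th / 4).
    exact: ler_wpM2l.
  have h4 : th / 4 * (1 / 2) <= th / 4 * cos (th / 4) ^+ 2.
    by rewrite ler_wpM2l // divr_ge0.
  move: h3 h4; rewrite expr2; move: (cos _) (sin _) => c s; lra.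
have -> : 4 * (2 * sin (th / 2)) ^+ 2 = (4 * sin (th / 2)) ^+ 2 by ring.
by rewrite ler_pXn2r ?nnegrE //; lra.
Qed.

Lemma cx_norm_le1 x : `|cx x| <= 1.
Proof. by have [t ->] := cisP x; rewrite cx_cis cos_max. Qed.

Lemma cy_norm_le1 x : `|cy x| <= 1.
Proof. by have [t ->] := cisP x; rewrite cy_cis sin_max. Qed.

Lemma dot_norm_le1 x y : `|dot x y| <= 1.
Proof. by rewrite -cos_gdist cos_max. Qed.

Lemma cx_dist x y : `|cx x - cx y| <= gdist x y.
Proof.
rewrite -(@ler_pXn2r _ 2) ?nnegrE ?gdist_ge0 // real_normK ?num_real //.
apply: le_trans (chord2_le x y); rewrite /chord2; have := sqr_ge0 (cy x - cy y); lra.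
Qed.

Lemma cy_dist x y : `|cy x - cy y| <= gdist x y.
Proof.
rewrite -(@ler_pXn2r _ 2) ?nnegrE ?gdist_ge0 // real_normK ?num_real //.
apply: le_trans (chord2_le x y); rewrite /chord2; have := sqr_ge0 (cx x - cx y); lra.
Qed.

Lemma gdist_le_coords x y : gdist x y <= 2 * (`|cx x - cx y| + `|cy x - cy y|).
Proof.
rewrite -(@ler_pXn2r _ 2) ?nnegrE ?gdist_ge0 ?mulr_ge0 ?addr_ge0 //.
apply: le_trans (gdist_le_chord2 x y) _; rewrite /chord2.
rewrite -(real_normK (num_real (cx x - cx y))) -(real_normK (num_real (cy x - cy y))).
have := normr_ge0 (cx x - cx y); have := normr_ge0 (cy x - cy y); nra.
Qed.

Lemma cos_lipschitz s t : `|cos s - cos t| <= `|s - t|.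
Proof.
have := cx_dist (cis s) (cis t); rewrite !cx_cis => /le_trans; apply.
exact: gdist_cis_le.
Qed.

Lemma dot_gdist x y x' y' : `|dot x y - dot x' y'| <= `|gdist x y - gdist x' y'|.
Proof. by rewrite -!cos_gdist cos_lipschitz. Qed.

End CircleGeometry.

(** * Regular grids *)

Section Grid.
Variable R : realType.
Implicit Types (x y z : circle R) (n m : nat).

Lemma circle_rootDm m j : (0 < m)%N -> circle_root R m (j + m) = circle_root R m j.
Proof.
move=> m0; have m1 : m%:R != 0 :> R by rewrite pnatr_eq0 -lt0n.
have e : 2 * pi * (j + m)%:R / m%:R = 2 * pi * j%:R / m%:R + pi *+ 2 :> R.
  by rewrite -mulr_natl natrD; field.
by apply: circle_ext; rewrite !(cx_cis, cy_cis) e ?cosD2pi ?sinD2pi.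
Qed.

(** Periodicity of the roots. It also reconciles two conventions: labels run from 1 to [m] in
    [PiSet], from 0 to [m - 1] in [grid]. *)
Lemma sum_roots_shift m (h : circle R -> R) j :
  \sum_(k < m) h (circle_root R m (k + j)) = \sum_(k < m) h (circle_root R m k).
Proof.
elim: j => [|j IH]; first by apply: eq_bigr => k _; rewrite addn0.
rewrite -IH; case: m {IH} => [|m]; first by rewrite !big_ord0.
rewrite big_ord_recr [in RHS]big_ord_recl /= addrC; congr (_ + _).
  by rewrite add0n addnS -addSn addnC circle_rootDm.
by apply: eq_bigr => k _; rewrite /bump /= add1n addnS addSn.
Qed.

Lemma PiSet_sum m (I : finType) (w : I -> circle R) (h : circle R -> R) :
  PiSet m w -> \sum_i h (w i) = \sum_(k < m) h (circle_root R m k).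
Proof.
case=> s bs ws; rewrite -(sum_roots_shift m h 1) (reindex s) /=; last first.
  exact: onW_bij.
by apply: eq_bigr => i _; rewrite ws addn1.
Qed.

Lemma PiSet_grid m (I : finType) (w : I -> circle R) (i : I) :
  PiSet m w -> grid m (w i).
Proof.
case=> s _ ws; rewrite ws; have := ltn_ord (s i).
rewrite leq_eqVlt => /predU1P[e|h]; last by exists (s i).+1.
exists 0%N; first exact: leq_ltn_trans (ltn_ord (s i)).
by rewrite -(@circle_rootDm m 0) ?add0n ?e // -e.
Qed.

Lemma PiSet_card m (I : finType) (w : I -> circle R) : PiSet m w -> #|I| = m.
Proof. by case=> s bs _; rewrite (bij_eq_card bs) card_ord. Qed.

Lemma gdist_root_shift m j k l :
  gdist (circle_root R m (j + l)) (circle_root R m (k + l)) =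
  gdist (circle_root R m j) (circle_root R m k).
Proof.
rewrite !gdist_acos !dot_cis; congr (acos (cos _)).
by rewrite !natrD; ring.
Qed.

Lemma sum_gdist_grid m z (g : R -> R) : grid m z ->
  \sum_(k < m) g (gdist z (circle_root R m k)) =
  \sum_(k < m) g (gdist (circle_root R m 0) (circle_root R m k)).
Proof.
case=> j _ <-; rewrite -(sum_roots_shift m (fun x => g (gdist _ x)) j).
by apply: eq_bigr => k _; rewrite -{1}[j]add0n gdist_root_shift.
Qed.

(** The invariance behind the rearrangement: by rotation, every grid point sees the same multiset of
    distances, under any labelling. *)
Lemma PiSet_sum_gdist m (I : finType) (w w' : I -> circle R) z z' (g : R -> R) :
  PiSet m w -> PiSet m w' -> grid m z -> grid m z' ->
  \sum_i g (gdist z (w i)) = \sum_i g (gdist z' (w' i)).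
Proof.
move=> hw hw' hz hz'.
rewrite (PiSet_sum (fun x => g (gdist z x)) hw).
rewrite (PiSet_sum (fun x => g (gdist z' x)) hw').
by rewrite !sum_gdist_grid.
Qed.

(** Distances live on an integer scale, which lets the concave potential be defined by summation
    instead of integration. *)
Lemma grid_gdist_level m z z' : (0 < m)%N -> grid m z -> grid m z' ->
  exists l : nat, gdist z z' = 2 * pi / m%:R * l%:R.
Proof.
move=> m0 [j /= jm <-] [k /= km <-].
have m1 : m%:R != 0 :> R by rewrite pnatr_eq0 -lt0n.
have mp : 0 < m%:R :> R by rewrite ltr0n.
have pp := pi_gt0 R.
wlog kj : j k jm km / (k <= j)%N.
  move=> H; have [kj|/ltnW jk] := leqP k j; first exact: H.
  by rewrite gdistC; exact: H.
have [h|h] := leqP (2 * (j - k)) m.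
  have e : 2 * pi * j%:R / m%:R - 2 * pi * k%:R / m%:R =
           2 * pi / m%:R * (j - k)%:R :> R.
    by rewrite natrB //; field.
  exists (j - k)%N; rewrite gdist_cis_eq e ger0_norm ?mulr_ge0 ?invr_ge0 ?pi_ge0 //.
  rewrite [2 * pi]mulrC -!mulrA -[leRHS]mulr1 ler_wpM2l ?pi_ge0 //.
  by rewrite mulrCA mulrC ler_pdivrMr // mul1r -natrM ler_nat.
(* The shorter arc goes the other way round: adding [m] to the smaller index keeps the point and
   brings the difference of angles below $\pi$. *)
exists (m - (j - k))%N.
have jk : (j - k <= m)%N by rewrite leq_subLR (leq_trans (ltnW jm)) // leq_addl.
have e : 2 * pi * (k + m)%:R / m%:R - 2 * pi * j%:R / m%:R =
         2 * pi / m%:R * (m - (j - k))%:R :> R.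
  by rewrite !natrB // natrD; field.
rewrite gdistC -(circle_rootDm k m0) gdist_cis_eq e ger0_norm ?mulr_ge0 ?invr_ge0 ?pi_ge0 //.
rewrite [2 * pi]mulrC -!mulrA -[leRHS]mulr1 ler_wpM2l ?pi_ge0 //.
rewrite mulrCA mulrC ler_pdivrMr // mul1r -natrM ler_nat.
by rewrite mulnBr leq_subLR mul2n -addnn leq_add2r ltnW.
Qed.

Lemma grid_near m x : (0 < m)%N -> exists2 z, grid m z & gdist x z <= 8 / m%:R.
Proof.
move=> m0.
have mp : 0 < m%:R :> R by rewrite ltr0n.
have [/andP[h0 h1] ex] := argP x.
have pp := pi_gt0 R; have p2 := pihalf_lt2 R.
pose k := Num.truncn (arg x * m%:R / (2 * pi)).
have a0 : 0 <= arg x * m%:R / (2 * pi) by rewrite divr_ge0 ?mulr_ge0 // ltW.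
have /andP[k1 k2] := truncn_itv a0; rewrite -/k in k1 k2.
have dp : 0 < 2 * pi :> R by rewrite mulr_gt0.
rewrite ler_pdivlMr // in k1; rewrite ltr_pdivrMr // in k2.
exists (circle_root R m k).
  exists k => //=; rewrite -(ltr_nat R); nra.
rewrite -{1}ex; apply: le_trans (gdist_cis_le _ _) _.
rewrite ger0_norm; last by rewrite subr_ge0 ler_pdivrMr //; lra.
rewrite ler_pdivlMr // mulrBl mulfVK ?gt_eqF //.
by move: k2; rewrite -natr1; lra.
Qed.

(** * Second moments of the grid *)

Section Isotropy.
Variables (m : nat) (m3 : (2 < m)%N).

Let alpha : R := 2 * pi / m%:R.

Let root_succ k :
  cx (circle_root R m (k + 1)) =
    cx (circle_root R m k) * cos alpha - cy (circle_root R m k) * sin alpha /\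
  cy (circle_root R m (k + 1)) =
    cy (circle_root R m k) * cos alpha + cx (circle_root R m k) * sin alpha.
Proof.
have e : 2 * pi * (k + 1)%:R / m%:R = 2 * pi * k%:R / m%:R + alpha.
  by rewrite natrD /alpha; ring.
rewrite /circle_root e !(cx_cis, cy_cis) cosD sinD; split=> //; ring.
Qed.

(* The two second-harmonic sums are invariant under the rotation by
   [2 alpha], which has no nonzero fixed vector. *)
Lemma roots_second_harmonic :
  \sum_(k < m) (cx (circle_root R m k) ^+ 2 - cy (circle_root R m k) ^+ 2) = 0 /\
  \sum_(k < m) (cx (circle_root R m k) * cy (circle_root R m k)) = 0.
Proof.
set C := \sum_(k < m) _; set S := \sum_(k < m) _.
have s0 : 0 < sin alpha.
  have mp : 0 < m%:R :> R by rewrite ltr0n; case: m m3.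
  apply: sin_gt0_pi; rewrite divr_gt0 ?mulr_gt0 ?pi_gt0 //=.
  rewrite ltr_pdivrMr // mulrC ltr_pM2l ?pi_gt0 //.
  by rewrite (ltr_nat R 2).
have cs := cos2Dsin2 alpha.
set c := cos alpha in cs; set s := sin alpha in s0 cs.
have eC : C = (c ^+ 2 - s ^+ 2) * C - 4 * c * s * S.
  rewrite {1}/C -(sum_roots_shift m (fun x => cx x ^+ 2 - cy x ^+ 2) 1).
  rewrite mulr_sumr [in RHS]mulr_sumr -sumrB; apply: eq_bigr => k _.
  by have [-> ->] := root_succ k; rewrite -/c -/s; ring.
have eS : S = (c ^+ 2 - s ^+ 2) * S + c * s * C.
  rewrite {1}/S -(sum_roots_shift m (fun x => cx x * cy x) 1).
  rewrite mulr_sumr [in RHS]mulr_sumr -big_split; apply: eq_bigr => k _ /=.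
  by have [-> ->] := root_succ k; rewrite -/c -/s; ring.
have h1 : 2 * s * (s * C + 2 * c * S) = 0.
  transitivity ((c ^+ 2 + s ^+ 2) * C - ((c ^+ 2 - s ^+ 2) * C - 4 * c * s * S)); first ring.
  by rewrite cs mul1r -eC subrr.
have h2 : s * (2 * s * S - c * C) = 0.
  transitivity ((c ^+ 2 + s ^+ 2) * S - ((c ^+ 2 - s ^+ 2) * S + c * s * C)); first ring.
  by rewrite cs mul1r -eS subrr.
have s1 : s != 0 by rewrite gt_eqF.
have g1 : s * C + 2 * c * S = 0.
  by move/eqP: h1; rewrite mulf_eq0 (negbTE (mulf_neq0 _ s1)) ?pnatr_eq0 //= => /eqP.
have g2 : 2 * s * S - c * C = 0.
  by move/eqP: h2; rewrite mulf_eq0 (negbTE s1) /= => /eqP.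
have C0 : C = 0.
  transitivity (s * (s * C + 2 * c * S) - c * (2 * s * S - c * C) + (1 - (c ^+ 2 + s ^+ 2)) * C).
    by ring.
  by rewrite g1 g2 cs; ring.
split=> //.
have : 2 * S = c * (s * C + 2 * c * S) + s * (2 * s * S - c * C) + 2 * (1 - (c ^+ 2 + s ^+ 2)) * S.
  by ring.
by rewrite g1 g2 cs; lra.
Qed.

Variables (I : finType) (w : I -> circle R) (hw : PiSet m w).

(** The second harmonics vanish and the points have norm 1, so the second-moment matrix is $(m/2)I$.
    This turns information on scalar products with the grid points into information on vectors: in
    the refinement, in the alignment and on the complement of the samples. *)
Lemma isotropy (a b a' b' : R) :
  \sum_i (a * cx (w i) + b * cy (w i)) * (a' * cx (w i) + b' * cy (w i)) =
  m%:R / 2 * (a * a' + b * b').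
Proof.
have [h1 h2] := roots_second_harmonic.
rewrite (PiSet_sum (fun x => (a * cx x + b * cy x) * (a' * cx x + b' * cy x)) hw) /=.
transitivity (\sum_(k < m) ((a * a' - b * b') / 2 *
      (cx (circle_root R m k) ^+ 2 - cy (circle_root R m k) ^+ 2) +
    (a * b' + b * a') * (cx (circle_root R m k) * cy (circle_root R m k)) +
    (a * a' + b * b') / 2)).
  apply: eq_bigr => k _; set x := circle_root _ _ _.
  transitivity ((a * a' - b * b') / 2 * (cx x ^+ 2 - cy x ^+ 2) +
    (a * b' + b * a') * (cx x * cy x) + (a * a' + b * b') / 2 * (cx x ^+ 2 + cy x ^+ 2)).
    by field.
  by rewrite cx2cy2 mulr1.
rewrite !big_split /= -!mulr_sumr h1 h2 !mulr0 !add0r sumr_const card_ord -[2^-1 *+ m]mulr_natl.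
by field.
Qed.

End Isotropy.
End Grid.

(** * Rearrangement inequality *)

Section Rearrangement.
Variable R : realType.

(* The tangent inequality for the concave function with antitone increments [phi]. *)
Lemma antitone_sum_tangent (phi : nat -> R) (a b : nat) :
  (forall i j, (i <= j)%N -> phi j <= phi i) ->
  \sum_(s < b) phi s - \sum_(s < a) phi s <= phi a * (b%:R - a%:R).
Proof.
move=> anti; have [ab|/ltnW ba] := leqP a b.
  rewrite -(subnKC ab); elim: (b - a)%N => [|k IH].
    by rewrite addn0 !subrr mulr0.
  rewrite addnS big_ord_recr /= -natr1.
  by have := anti a (a + k)%N (leq_addr _ _); move: IH; lra.
rewrite -(subnKC ba); elim: (a - b)%N => [|k IH].
  by rewrite addn0 !subrr mulr0.
rewrite addnS big_ord_recr /= -natr1 natrD.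
move: IH; rewrite natrD.
have h := anti (b + k)%N (b + k).+1 (leqnSn _).
have : phi (b + k).+1 * (k%:R + 1) <= phi (b + k)%N * (k%:R + 1).
  by rewrite ler_wpM2r // addr_ge0.
by lra.
Qed.

Variables (n : nat) (cl cL ce : R).
Local Notation eps := (ce * log_rate R n).
Variables (f : circle R -> circle R -> R) (bf : biLip n cl cL ce f).

(* Up to [eps], [f z y + cl * d(z, y)] is an antitone function of [d(z, y)];
   this infimum is such a function. *)
Definition residual_inf (z : circle R) (u : R) : R :=
  inf [set f z y + cl * gdist z y | y in [set y | gdist z y <= u]].

Lemma residual_inf_anti z u v : 0 <= cl -> 0 <= u -> u <= v ->
  residual_inf z v <= residual_inf z u.
Proof.
move=> cl0 u0 uv; have [_ f01 _ _] := bf.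
apply: lb_le_inf.
  by exists (f z z + cl * gdist z z), z => //=; rewrite gdistxx.
move=> _ [y /= yu <-]; apply: ge_inf.
  exists 0 => _ [y' _ <-].
  by rewrite addr_ge0 ?mulr_ge0 ?gdist_ge0 //; case/andP: (f01 z y').
by exists y => //=; exact: le_trans yu uv.
Qed.

Lemma residual_inf_bounds z y : 0 <= cl ->
  residual_inf z (gdist z y) <= f z y + cl * gdist z y <=
  residual_inf z (gdist z y) + eps.
Proof.
move=> cl0; have [_ f01 _ fd] := bf; apply/andP; split.
  apply: ge_inf; last by exists y => //=.
  exists 0 => _ [y' _ <-].
  by rewrite addr_ge0 ?mulr_ge0 ?gdist_ge0 //; case/andP: (f01 z y').
rewrite -lerBlDr; apply: lb_le_inf.
  by exists (f z y + cl * gdist z y), y => /=.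
move=> _ [y' /= yy <-]; have := fd z y y' yy; lra.
Qed.

(** Summing [residual_inf] over the levels gives a concave potential [Phi] whose total over a
    labelling is invariant; by the tangent inequality, the antitone part of the signal contributes
    nonnegatively. The part $-c_l d$ yields the square, because the total of $d^2$ is invariant too.
    Replacing the residual by its antitone version costs the $\ell^1$ term. *)
Lemma row_inequality (m : nat) (I : finType) (w w' : I -> circle R) (z z' : circle R) :
  0 <= cl -> PiSet m w -> PiSet m w' -> grid m z -> grid m z' ->
  cl / 2 * \sum_j (gdist z' (w' j) - gdist z (w j)) ^+ 2
    - eps * \sum_j `|gdist z' (w' j) - gdist z (w j)|
  <= \sum_j f z (w j) * (gdist z' (w' j) - gdist z (w j)).
Proof.
move=> cl0 hw hw' hz hz'.
have m0 : (0 < m)%N by case: hz => j /= /(leq_ltn_trans (leq0n j)).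
pose h : R := 2 * pi / m%:R.
have h0 : 0 < h by rewrite divr_gt0 ?mulr_gt0 ?pi_gt0 ?ltr0n.
pose phi l := residual_inf z (h * l%:R).
have phi_anti i j : (i <= j)%N -> phi j <= phi i.
  move=> ij; apply: residual_inf_anti => //; first by rewrite mulr_ge0 // ltW.
  by rewrite ler_wpM2l ?ler_nat // ltW.
pose Phi (u : R) := h * \sum_(s < Num.truncn (u / h)) phi s.
have lev l : Num.truncn (h * l%:R / h) = l.
  by rewrite mulrAC divff ?gt_eqF // mul1r natrK.
have tang j : Phi (gdist z' (w' j)) - Phi (gdist z (w j)) <=
    residual_inf z (gdist z (w j)) * (gdist z' (w' j) - gdist z (w j)).
  have [a ea] := grid_gdist_level m0 hz (PiSet_grid j hw).
  have [b eb] := grid_gdist_level m0 hz' (PiSet_grid j hw').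
  rewrite ea eb -/h /Phi !lev -!mulrBr mulrCA.
  apply: ler_wpM2l; first exact: ltW.
  exact: (antitone_sum_tangent a b phi_anti).
have sumPhi : 0 <= \sum_j residual_inf z (gdist z (w j)) * (gdist z' (w' j) - gdist z (w j)).
  apply: le_trans (ler_sum _ (fun j _ => tang j)).
  by rewrite sumrB (PiSet_sum_gdist Phi hw hw' hz hz') subrr.
have sumsq : \sum_j gdist z' (w' j) ^+ 2 = \sum_j gdist z (w j) ^+ 2.
  by rewrite (PiSet_sum_gdist (fun u => u ^+ 2) hw hw' hz hz').
have -> : \sum_j (gdist z' (w' j) - gdist z (w j)) ^+ 2 =
    - 2 * \sum_j gdist z (w j) * (gdist z' (w' j) - gdist z (w j)).
  rewrite mulr_sumr; apply/eqP; rewrite -subr_eq0 -sumrB; apply/eqP.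
  transitivity (\sum_j (gdist z' (w' j) ^+ 2 - gdist z (w j) ^+ 2)).
    by apply: eq_bigr => j _; ring.
  by rewrite sumrB sumsq subrr.
rewrite mulrA [X in X - _]mulr_sumr [X in _ - X]mulr_sumr -sumrB -subr_ge0 -sumrB.
apply: le_trans sumPhi _; apply: ler_sum => j _.
have /andP[l1 l2] := residual_inf_bounds z (w j) cl0.
set a := gdist z (w j) in l1 l2 *; set b := gdist z' _.
have e0 : 0 <= eps by lra.
set N := `|b - a|.
move: (residual_inf z a) l1 l2 => p l1 l2.
have [ba|ba] := leP 0 (b - a).
  have -> : N = b - a by rewrite /N ger0_norm.
  nra.
have -> : N = - (b - a) by rewrite /N ltr0_norm.
nra.
Qed.

End Rearrangement.

(** * Localization and refinement errors *)

Section Localization.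
Variable R : realType.

Lemma sqr_sum_le (I : finType) (a : I -> R) :
  (\sum_i a i) ^+ 2 <= #|I|%:R * \sum_i a i ^+ 2.
Proof.
have : 0 <= \sum_i \sum_j (a i - a j) ^+ 2.
  by apply: sumr_ge0 => i _; apply: sumr_ge0 => j _; exact: sqr_ge0.
have -> : \sum_i \sum_j (a i - a j) ^+ 2 =
    2 * (#|I|%:R * \sum_i a i ^+ 2) - 2 * (\sum_i a i) ^+ 2; last by lra.
transitivity (\sum_i (#|I|%:R * a i ^+ 2 + \sum_j a j ^+ 2 - 2 * a i * \sum_j a j)).
  apply: eq_bigr => i _.
  rewrite mulr_sumr -sumr_const mulr_suml -big_split /= -sumrB.
  by apply: eq_bigr => j _; ring.
rewrite sumrB big_split /= -mulr_sumr sumr_const -[X in _ + X - _]mulr_natl.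
by rewrite -mulr_suml -mulr_sumr; ring.
Qed.

Variables (n : nat) (cl cL ce : R).
Hypotheses (cl0 : 0 < cl) (cL0 : 0 <= cL) (ce0 : 0 <= ce).
Local Notation eps := (ce * log_rate R n).

Lemma eps_ge0 : 0 <= eps.
Proof. by rewrite mulr_ge0 // sqrtr_ge0. Qed.

Lemma biLip_lipschitz2 f x y x' y' : biLip n cl cL ce f ->
  `|f x y - f x' y'| <= cL * (gdist x x' + gdist y y') + 2 * eps.
Proof.
case=> fs _ fl _; have := fl x y y'; have := fl y' x x'.
rewrite !(fs y') => h1 h2; apply: le_trans (ler_distD (f x y') _ _) _; lra.
Qed.

Variables (f : circle R -> circle R -> R) (bf : biLip n cl cL ce f).
Variables (m : nat) (I : finType).

(** With $s^2$ the sum of squared differences, the rows of [row_inequality], the optimality of [y]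
    and the noise bound give $\frac{c_l}{2}s^2\le Ams$, since the $\ell^1$ norm is at most $ms$ by
    Cauchy-Schwarz; the same inequality converts the bound on $s$ back. In [3 * eps], one comes from
    the rearrangement and two from moving both arguments of [f] between [p] and [x]. *)
Lemma localize_L1 (x p y : I -> circle R) (M N : I -> I -> R) (dl tau : R) :
  PiSet m p -> PiSet m y -> 0 <= tau -> 0 <= dl ->
  (forall i, gdist (x i) (p i) <= dl) ->
  (forall i j, i != j -> M i j = f (x i) (x j) + N i j) ->
  \sum_i \sum_j M i j * gdist (y i) (y j) <= \sum_i \sum_j M i j * gdist (p i) (p j) ->
  \sum_i \sum_j N i j * (gdist (p i) (p j) - gdist (y i) (y j)) <=
    tau * m%:R * Num.sqrt (\sum_i \sum_j (gdist (y i) (y j) - gdist (p i) (p j)) ^+ 2) ->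
  \sum_i \sum_j `|gdist (y i) (y j) - gdist (p i) (p j)|
    <= m%:R ^+ 2 * (2 / cl * (2 * cL * dl + 3 * eps + tau)).
Proof.
move=> hp hy tau0 dl0 xp MN hmin hN.
pose D i j := gdist (y i) (y j) - gdist (p i) (p j).
have D0 i : D i i = 0 by rewrite /D !gdistxx subrr.
set L1 := \sum_i \sum_j `|_|; set L2 := \sum_i \sum_j _ ^+ 2 in hN.
have L20 : 0 <= L2.
  by apply: sumr_ge0 => i _; apply: sumr_ge0 => j _; exact: sqr_ge0.
have cardI := PiSet_card hp.
have cs : L1 <= m%:R * Num.sqrt L2.
  have L10 : 0 <= L1 by apply: sumr_ge0 => i _; exact: sumr_ge0.
  rewrite -(@ler_pXn2r _ 2) ?nnegrE ?mulr_ge0 ?sqrtr_ge0 // exprMn sqr_sqrtr //.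
  have := sqr_sum_le (fun ij : I * I => `|D ij.1 ij.2|).
  rewrite card_prod cardI natrM -expr2.
  rewrite -(pair_bigA _ (fun i j => `|D i j|)) /= -/L1.
  rewrite -(pair_bigA _ (fun i j => `|D i j| ^+ 2)) /=.
  congr (_ <= _ * _); apply: eq_bigr => i _; apply: eq_bigr => j _.
  by rewrite real_normK ?num_real.
have rows : cl / 2 * L2 - eps * L1 <= \sum_i \sum_j f (p i) (p j) * D i j.
  rewrite /L1 /L2 [X in X - _]mulr_sumr [X in _ - X]mulr_sumr -sumrB.
  apply: ler_sum => i _.
  exact: (row_inequality bf (ltW cl0) hp hy (PiSet_grid i hp) (PiSet_grid i hy)).
have shift : \sum_i \sum_j f (p i) (p j) * D i j <=
    \sum_i \sum_j f (x i) (x j) * D i j + (2 * cL * dl + 2 * eps) * L1.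
  rewrite /L1 mulr_sumr -big_split; apply: ler_sum => i _ /=.
  rewrite mulr_sumr -big_split; apply: ler_sum => j _ /=.
  rewrite -lerBlDl -mulrBl; apply: le_trans (ler_norm _) _; rewrite normrM.
  apply: ler_wpM2r => //; apply: le_trans (biLip_lipschitz2 _ _ _ _ bf) _.
  rewrite lerD2r [2 * cL]mulrC -mulrA ler_wpM2l //.
  by have := xp i; have := xp j; rewrite !(gdistC (p _)); lra.
have fMN : \sum_i \sum_j f (x i) (x j) * D i j =
    \sum_i \sum_j M i j * D i j - \sum_i \sum_j N i j * D i j.
  rewrite -sumrB; apply: eq_bigr => i _; rewrite -sumrB; apply: eq_bigr => j _.
  have [->|ij] := eqVneq i j; first by rewrite D0 !mulr0 subrr.
  by rewrite MN //; ring.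
have MD : \sum_i \sum_j M i j * D i j <= 0.
  rewrite -subr_le0 in hmin; apply: le_trans hmin; rewrite -sumrB.
  by apply: ler_sum => i _; rewrite -sumrB; apply: ler_sum => j _; rewrite -mulrBr.
have ND : - \sum_i \sum_j N i j * D i j <= tau * m%:R * Num.sqrt L2.
  apply: le_trans hN; rewrite -sumrN; apply: ler_sum => i _; rewrite -sumrN.
  by apply: ler_sum => j _; rewrite -mulrN /D opprB.
have e0 := eps_ge0.
set s := Num.sqrt L2 in cs ND.
have s0 : 0 <= s by exact: sqrtr_ge0.
have L2s : L2 = s ^+ 2 by rewrite sqr_sqrtr.
set A := 2 * cL * dl + 3 * eps + tau.
have A0 : 0 <= A by have := mulr_ge0 cL0 dl0; rewrite /A; lra.
have key : cl / 2 * s ^+ 2 <= A * m%:R * s.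
  have : (2 * cL * dl + 3 * eps) * L1 <= (2 * cL * dl + 3 * eps) * (m%:R * s).
    by rewrite ler_wpM2l //; have := mulr_ge0 cL0 dl0; lra.
  by rewrite /A; move: rows shift ND MD; rewrite fMN L2s; lra.
have : s <= 2 / cl * A * m%:R.
  move: s0; rewrite le_eqVlt => /predU1P[<-|s0].
    by rewrite !mulr_ge0 // invr_ge0 ltW.
  have : cl / 2 * s <= A * m%:R by rewrite -(ler_pM2r s0) -[leLHS]mulrA -(expr2 s).
  rewrite -(@ler_pM2l _ (2 / cl)) ?divr_gt0 //.
  have -> : 2 / cl * (cl / 2 * s) = s by field; rewrite gt_eqF.
  by rewrite mulrA.
move=> h; apply: le_trans cs _; rewrite expr2 -mulrA ler_wpM2l //.
by rewrite mulrC.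
Qed.

(** As the cosine is 1-Lipschitz, isotropy gives $\sum_j D_j^2\ge\frac m2\,\mathrm{chord}^2\ge\frac
    m8d^2$ for the distance $d$ between the two candidates, while every error term is at most linear
    in $md$; hence the factor $16/c_l$. *)
Lemma refine_error (w : I -> circle R) (z z0 : circle R) (a N : I -> R) (eta tau : R) :
  (2 < m)%N -> PiSet m w -> grid m z -> grid m z0 -> 0 <= tau ->
  \sum_j `|a j - N j - f z0 (w j)| <= m%:R * eta ->
  \sum_j a j * gdist z (w j) <= \sum_j a j * gdist z0 (w j) ->
  \sum_j N j * (gdist z0 (w j) - gdist z (w j)) <= tau * m%:R * gdist z z0 ->
  gdist z z0 <= 16 / cl * (eta + tau + eps).
Proof.
move=> m3 hw hz hz0 tau0 heta hmin hN.
have mp : 0 < m%:R :> R by rewrite ltr0n; case: m m3.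
pose D j := gdist z (w j) - gdist z0 (w j).
have DD j : `|D j| <= gdist z z0 by exact: gdist_subl.
set d := gdist z z0 in DD hN *.
have d0 : 0 <= d by exact: gdist_ge0.
have e0 := eps_ge0.
have eta0 : 0 <= eta.
  by rewrite -(pmulr_rge0 _ mp); apply: le_trans heta; exact: sumr_ge0.
have := row_inequality bf (ltW cl0) hw hw hz0 hz; rewrite -/(D _) => row.
have L1 : \sum_j `|D j| <= m%:R * d.
  rewrite -(PiSet_card hw) mulr_natl -sumr_const; exact: ler_sum.
have L2 : m%:R / 8 * d ^+ 2 <= \sum_j D j ^+ 2.
  have : \sum_j (dot z (w j) - dot z0 (w j)) ^+ 2 = m%:R / 2 * chord2 z z0.
    rewrite /chord2 !expr2 -(isotropy m3 hw); apply: eq_bigr => j _.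
    by rewrite /dot; ring.
  have : \sum_j (dot z (w j) - dot z0 (w j)) ^+ 2 <= \sum_j D j ^+ 2.
    apply: ler_sum => j _.
    rewrite -(real_normK (num_real (dot z (w j) - dot z0 (w j)))).
    rewrite -(real_normK (num_real (D j))) ler_pXn2r ?nnegrE //.
    exact: dot_gdist.
  have := gdist_le_chord2 z z0; rewrite -/d => h1 h2 h3.
  have : m%:R / 8 * d ^+ 2 <= m%:R / 8 * (4 * chord2 z z0).
    by rewrite ler_wpM2l // divr_ge0 // ltW.
  by lra.
have up : \sum_j f z0 (w j) * D j <= tau * m%:R * d + m%:R * eta * d.
  have : \sum_j f z0 (w j) * D j <= \sum_j a j * D j - \sum_j N j * D j
      + (\sum_j `|a j - N j - f z0 (w j)|) * d.
    rewrite mulr_suml -sumrB -big_split; apply: ler_sum => j _ /=.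
    have -> : f z0 (w j) * D j = a j * D j - N j * D j - (a j - N j - f z0 (w j)) * D j by ring.
    rewrite lerD2l; apply: le_trans (ler_norm _) _; rewrite normrN normrM.
    by rewrite ler_wpM2l.
  have : \sum_j a j * D j <= 0.
    rewrite -subr_le0 in hmin; apply: le_trans hmin; rewrite -sumrB.
    by apply: ler_sum => j _; rewrite -mulrBr.
  have : - \sum_j N j * D j <= tau * m%:R * d.
    apply: le_trans hN; rewrite -sumrN; apply: ler_sum => j _.
    by rewrite -mulrN /D opprB.
  have : (\sum_j `|a j - N j - f z0 (w j)|) * d <= m%:R * eta * d by rewrite ler_wpM2r.
  by lra.
have key : cl / 16 * d * (m%:R * d) <= (eta + tau + eps) * (m%:R * d).
  have h1 : cl / 2 * (m%:R / 8 * d ^+ 2) <= cl / 2 * \sum_j D j ^+ 2.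
    by rewrite ler_wpM2l // divr_ge0 // ltW.
  have h2 : eps * \sum_j `|D j| <= eps * (m%:R * d) by rewrite ler_wpM2l.
  by move: h1 h2 row up; rewrite /D expr2; lra.
move: d0; rewrite le_eqVlt => /predU1P[<-|dp].
  by rewrite mulr_ge0 ?divr_ge0 ?addr_ge0 // ltW.
move: key; rewrite ler_pM2r ?mulr_gt0 // => key.
have -> : d = 16 / cl * (cl / 16 * d) by field; rewrite gt_eqF.
by rewrite ler_wpM2l // divr_ge0 // ltW.
Qed.

End Localization.

(** * Alignment modulo orthogonal maps *)

Section Alignment.
Variable R : realType.
Implicit Types (Q : Defs.orthogonal R).

Lemma round_unit (t k : R) : 0 <= t -> `|t ^+ 2 - 1| <= k -> `|t - 1| <= k.
Proof.
move=> t0 h; apply: le_trans h.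
have -> : t ^+ 2 - 1 = (t - 1) * (t + 1) by ring.
rewrite normrM -[leLHS]mulr1 ler_wpM2l // ger0_norm ?addr_ge0 //.
by rewrite lerDr.
Qed.

(* Gram-Schmidt on the rows. *)
Lemma round_orthogonal (a b c d k : R) : k <= 4^-1 ->
  `|a ^+ 2 + b ^+ 2 - 1| <= k -> `|c ^+ 2 + d ^+ 2 - 1| <= k ->
  `|a * c + b * d| <= k ->
  exists Q, [/\ `|omx Q 0 0 - a| <= 4 * k, `|omx Q 0 1 - b| <= 4 * k,
                `|omx Q 1 0 - c| <= 4 * k & `|omx Q 1 1 - d| <= 4 * k].
Proof.
move=> k4 hab hcd hac.
have k0 : 0 <= k by exact: le_trans hab.
pose N := Num.sqrt (a ^+ 2 + b ^+ 2).
have N2 : N ^+ 2 = a ^+ 2 + b ^+ 2 by rewrite sqr_sqrtr // addr_ge0 ?sqr_ge0.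
have N0 : 0 <= N by exact: sqrtr_ge0.
have N1 : `|N - 1| <= k by apply: round_unit => //; rewrite N2.
have Nh : 2^-1 <= N by move: N1; rewrite ler_norml; lra.
have Np : 0 < N by lra.
pose u := a / N; pose v := b / N.
have ea : a = N * u by rewrite /u mulrC mulfVK // gt_eqF.
have eb : b = N * v by rewrite /v mulrC mulfVK // gt_eqF.
have uv : u ^+ 2 + v ^+ 2 = 1.
  have : N ^+ 2 * (u ^+ 2 + v ^+ 2) = N ^+ 2 * 1.
    transitivity ((N * u) ^+ 2 + (N * v) ^+ 2); first ring.
    by rewrite -ea -eb -N2 mulr1.
  by move/mulfI; apply; rewrite expf_neq0 // gt_eqF.
clearbody u v.
have u1 : `|u| <= 1.
  by rewrite -(@ler_pXn2r _ 2) ?nnegrE // real_normK ?num_real // expr1n -uv lerDl sqr_ge0.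
have v1 : `|v| <= 1.
  by rewrite -(@ler_pXn2r _ 2) ?nnegrE // real_normK ?num_real // expr1n -uv lerDr sqr_ge0.
pose al := c * u + d * v; pose be := d * u - c * v.
have ec : c = al * u - be * v.
  by rewrite -[LHS]mulr1 -uv /al /be; ring.
have ed : d = al * v + be * u.
  by rewrite -[LHS]mulr1 -uv /al /be; ring.
have al2 : `|al| <= 2 * k.
  have : N * `|al| <= k.
    rewrite -{1}(ger0_norm N0) -normrM; apply: le_trans hac.
    by rewrite ea eb /al le_eqVlt; apply/orP; left; apply/eqP; congr `|_|; ring.
  have : 2^-1 * `|al| <= N * `|al| by rewrite ler_wpM2r.
  by lra.
have be2 : `|be ^+ 2 - 1| <= 2 * k.
  have e : be ^+ 2 - 1 = (c ^+ 2 + d ^+ 2 - 1) - al ^+ 2.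
    transitivity ((c ^+ 2 + d ^+ 2) * (u ^+ 2 + v ^+ 2) - 1 - al ^+ 2).
      by rewrite /be /al; ring.
    by rewrite uv; ring.
  have : al ^+ 2 <= k.
    rewrite -(real_normK (num_real al)) expr2.
    have : `|al| * `|al| <= 2 * k * (2 * k) by apply: ler_pM.
    by nra.
  have := sqr_ge0 al; move: hcd; rewrite e !ler_norml; lra.
(* [be] is only known to be near 1 or -1; keeping its sign allows [Q] to be a reflection. *)
have [s s2 sb] : exists2 s : R, s ^+ 2 = 1 & `|s - be| <= 2 * k.
  have [b0|b0] := leP 0 be.
    by exists 1; [rewrite expr1n | rewrite distrC round_unit].
  exists (-1); first by rewrite sqrrN expr1n.
  rewrite -normrN opprB opprK -[be]opprK addrC distrC.
  rewrite -opprB normrN distrC -[X in X - _]opprK opprK.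
  by apply: round_unit; rewrite ?sqrrN // oppr_ge0 ltW.
have [Q [q1 q2 q3 q4]] : exists Q,
    [/\ omx Q 0 0 = u, omx Q 0 1 = v, omx Q 1 0 = - (s * v) & omx Q 1 1 = s * u].
  apply: orthogonal_rows.
  - by rewrite sqrrN exprMn s2 mul1r.
  - by rewrite exprMn s2 mul1r addrC.
  - transitivity (u * v * (1 - s ^+ 2)); first ring.
    by rewrite s2 subrr mulr0.
exists Q; rewrite q1 q2 q3 q4.
have prod_le (x y M : R) : `|x| <= M -> `|y| <= 1 -> `|x * y| <= M.
  by move=> xM y1; rewrite normrM -[leRHS]mulr1 ler_pM.
split.
- have -> : u - a = (1 - N) * u by rewrite ea; ring.
  by apply: (le_trans (prod_le _ _ k _ u1)); [rewrite distrC | lra].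
- have -> : v - b = (1 - N) * v by rewrite eb; ring.
  by apply: (le_trans (prod_le _ _ k _ v1)); [rewrite distrC | lra].
- have -> : - (s * v) - c = - (al * u) - (s - be) * v by rewrite ec; ring.
  have := prod_le _ _ _ al2 u1; have := prod_le _ _ _ sb v1.
  by rewrite !ler_norml; lra.
have -> : s * u - d = (s - be) * u - al * v by rewrite ed; ring.
have := prod_le _ _ _ al2 v1; have := prod_le _ _ _ sb u1.
by rewrite !ler_norml; lra.
Qed.

Lemma ler_dist_prod (u v a b r : R) : `|u - a| <= r -> `|v - b| <= r ->
  `|a| <= 1 -> `|b| <= 1 -> r <= 4 -> `|u * v - a * b| <= 6 * r.
Proof.
move=> ua vb a1 b1 r4.
have -> : u * v - a * b = (u - a) * b + (u - a) * (v - b) + a * (v - b) by ring.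
have r0 : 0 <= r by exact: le_trans ua.
have h1 : `|(u - a) * b| <= r by rewrite normrM -[leRHS]mulr1 ler_pM.
have h2 : `|(u - a) * (v - b)| <= r * 4 by rewrite normrM ler_pM //; lra.
have h3 : `|a * (v - b)| <= r by rewrite normrM -[leRHS]mul1r ler_pM.
by move: h1 h2 h3; rewrite !ler_norml; lra.
Qed.

Variables (m : nat) (m3 : (2 < m)%N) (I : finType).
Variables (x y : I -> circle R) (hx : PiSet m x) (hy : PiSet m y).

(* [T = (2/m) sum_k y_k x_k^T] maps each [x_i] near [y_i]: by isotropy, it would
   map it to [y_i] exactly if the two Gram matrices were equal. *)
Lemma align_L1 (eta : R) :
  \sum_i \sum_j `|gdist (y i) (y j) - gdist (x i) (x j)| <= m%:R ^+ 2 * eta ->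
  exists Q, \sum_i gdist (oact Q (x i)) (y i) <= 776 * m%:R * eta.
Proof.
move=> heta.
have mp : 0 < m%:R :> R by rewrite ltr0n; case: m m3.
have m0 : m%:R != 0 :> R by rewrite gt_eqF.
(* For large [eta] the bound exceeds the diameter and the identity serves. The threshold makes
   [24 * eta] at most 1/4, as [round_orthogonal] requires. *)
have [heta1|heta1] := leP eta 96^-1; last first.
  exists (oid R); apply: (@le_trans _ _ (\sum_(i : I) 4)).
    by apply: ler_sum => i _; exact: gdist_le4.
  rewrite sumr_const (PiSet_card hx) -[X in X <= _]mulr_natl.
  have -> : 776 * m%:R * eta = m%:R * (776 * eta) by ring.
  by apply: ler_wpM2l; [exact: ltW | lra].
pose K : R := 2 / m%:R.
have K0 : 0 <= K by rewrite divr_ge0 // ltW.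
(* [rho i] will bound the error of [T] at [x i]; its crude bound by 4 keeps products of two errors
   linear in [rho i]. *)
pose rho i := K * \sum_k `|dot (x k) (x i) - dot (y k) (y i)|.
have rho0 i : 0 <= rho i by rewrite mulr_ge0 // sumr_ge0.
have rho4 i : rho i <= 4.
  have : \sum_k `|dot (x k) (x i) - dot (y k) (y i)| <= \sum_(k : I) 2.
    apply: ler_sum => k _; apply: le_trans (ler_normB _ _) _.
    by have := dot_norm_le1 (x k) (x i); have := dot_norm_le1 (y k) (y i); lra.
  rewrite sumr_const (PiSet_card hx) -[X in _ <= X]mulr_natl => /(ler_wpM2l K0).
  by rewrite -/(rho i) /K; have -> : 2 / m%:R * (m%:R * 2) = 4 :> R by field.
have srho : \sum_i rho i <= 2 * m%:R * eta.
  rewrite /rho -mulr_sumr.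
  have -> : 2 * m%:R * eta = K * (m%:R ^+ 2 * eta) by rewrite /K; field.
  apply: ler_wpM2l => //; apply: le_trans heta; rewrite exchange_big /=.
  apply: ler_sum => i _; apply: ler_sum => j _.
  by rewrite distrC; exact: dot_gdist.
have near_T (q : circle R -> R) (al be : R) : (forall z, q z = al * cx z + be * cy z) ->
    (forall z, `|q z| <= 1) ->
    exists a b : R, forall i, `|a * cx (x i) + b * cy (x i) - q (y i)| <= rho i.
  move=> hq q1.
  exists (K * \sum_k q (y k) * cx (x k)), (K * \sum_k q (y k) * cy (x k)) => i.
  have -> : q (y i) = K * \sum_k q (y k) * dot (y k) (y i).
    transitivity (K * \sum_k (al * cx (y k) + be * cy (y k)) *
        (cx (y i) * cx (y k) + cy (y i) * cy (y k))).
      by rewrite (isotropy m3 hy) hq /K; field.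
    by congr (_ * _); apply: eq_bigr => k _; rewrite hq /dot; ring.
  have -> : K * (\sum_k q (y k) * cx (x k)) * cx (x i) +
      K * (\sum_k q (y k) * cy (x k)) * cy (x i) -
      K * \sum_k q (y k) * dot (y k) (y i) =
      K * \sum_k q (y k) * (dot (x k) (x i) - dot (y k) (y i)).
    transitivity (K * ((\sum_k q (y k) * cx (x k)) * cx (x i) +
      (\sum_k q (y k) * cy (x k)) * cy (x i) - \sum_k q (y k) * dot (y k) (y i))).
      by ring.
    congr (_ * _); rewrite !mulr_suml -big_split -sumrB /=.
    by apply: eq_bigr => k _; rewrite /dot; ring.
  rewrite normrM (ger0_norm K0); apply: ler_wpM2l => //.
  apply: le_trans (ler_norm_sum _ _ _) _; apply: ler_sum => k _.
  by rewrite normrM -[leRHS]mul1r ler_wpM2r.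
have [a [b hX]] : exists a b : R, forall i, `|a * cx (x i) + b * cy (x i) - cx (y i)| <= rho i.
  by apply: (near_T _ 1 0) => z; [ring | exact: cx_norm_le1].
have [c [d hY]] : exists a b : R, forall i, `|a * cx (x i) + b * cy (x i) - cy (y i)| <= rho i.
  by apply: (near_T _ 0 1) => z; [ring | exact: cy_norm_le1].
(* By isotropy of [x], the scalar product of two rows of [T] is an average of products of its
   coordinates at the [x i]. These are near the coordinates of the [y i], whose averages are exact
   by isotropy of [y]. *)
have entry (a1 b1 a2 b2 : R) (q1 q2 : I -> R) (v : R) :
    (forall i, `|a1 * cx (x i) + b1 * cy (x i) - q1 i| <= rho i) ->
    (forall i, `|a2 * cx (x i) + b2 * cy (x i) - q2 i| <= rho i) ->
    (forall i, `|q1 i| <= 1) -> (forall i, `|q2 i| <= 1) ->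
    \sum_i q1 i * q2 i = m%:R / 2 * v ->
    `|a1 * a2 + b1 * b2 - v| <= 24 * eta.
  move=> h1 h2 n1 n2 hv.
  have -> : a1 * a2 + b1 * b2 - v = K * \sum_i ((a1 * cx (x i) + b1 * cy (x i)) *
       (a2 * cx (x i) + b2 * cy (x i)) - q1 i * q2 i).
    by rewrite sumrB (isotropy m3 hx) hv /K; field.
  rewrite normrM (ger0_norm K0).
  have -> : 24 * eta = K * (6 * (2 * m%:R * eta)) by rewrite /K; field.
  apply: ler_wpM2l => //; apply: le_trans (ler_norm_sum _ _ _) _.
  apply: (@le_trans _ _ (6 * \sum_i rho i)); last by lra.
  rewrite mulr_sumr; apply: ler_sum => i _.
  exact: ler_dist_prod.
have iso (a1 b1 a2 b2 : R) := isotropy m3 hy a1 b1 a2 b2.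
have e11 : `|a ^+ 2 + b ^+ 2 - 1| <= 24 * eta.
  rewrite !expr2; apply: (entry _ _ _ _ (cx (R:=R) \o y) (cx (R:=R) \o y)) => //= [i|i|];
    rewrite ?cx_norm_le1 //.
  have := iso 1 0 1 0; rewrite mulr1 mulr0 addr0 => <-.
  by apply: eq_bigr => i _; ring.
have e22 : `|c ^+ 2 + d ^+ 2 - 1| <= 24 * eta.
  rewrite !expr2; apply: (entry _ _ _ _ (cy (R:=R) \o y) (cy (R:=R) \o y)) => //= [i|i|];
    rewrite ?cy_norm_le1 //.
  have := iso 0 1 0 1; rewrite mulr1 mulr0 add0r => <-.
  by apply: eq_bigr => i _; ring.
have e12 : `|a * c + b * d| <= 24 * eta.
  rewrite -[X in `|X|]subr0; apply: (entry _ _ _ _ (cx (R:=R) \o y) (cy (R:=R) \o y)) => //= [i|i|];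
    rewrite ?cx_norm_le1 ?cy_norm_le1 //.
  transitivity (m%:R / 2 * (1 * 0 + 0 * 1) : R); last by congr (_ * _); ring.
  rewrite -iso.
  by apply: eq_bigr => i _; ring.
have k4 : 24 * eta <= 4^-1 by lra.
have [Q [q1 q2 q3 q4]] := round_orthogonal k4 e11 e22 e12.
exists Q.
have coord (p q a1 b1 t : R) z : `|p - a1| <= 4 * (24 * eta) -> `|q - b1| <= 4 * (24 * eta) ->
    `|p * cx z + q * cy z - t| <= 8 * (24 * eta) + `|a1 * cx z + b1 * cy z - t|.
  move=> h1 h2.
  have -> : p * cx z + q * cy z - t = (p - a1) * cx z + (q - b1) * cy z +
      (a1 * cx z + b1 * cy z - t) by ring.
  apply: le_trans (ler_normD _ _) _; rewrite lerD2r.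
  apply: le_trans (ler_normD _ _) _; rewrite !normrM.
  have : `|p - a1| * `|cx z| <= 4 * (24 * eta) * 1 by rewrite ler_pM ?cx_norm_le1.
  have : `|q - b1| * `|cy z| <= 4 * (24 * eta) * 1 by rewrite ler_pM ?cy_norm_le1.
  by lra.
(* 768 is 2 from [gdist_le_coords], times two coordinates, times $8\cdot24$ from the rounding of
   [T]; the sum of the [4 * rho i] adds 8. *)
apply: (@le_trans _ _ (\sum_(i : I) (768 * eta + 4 * rho i))).
  apply: ler_sum => i _; apply: le_trans (gdist_le_coords _ _) _.
  rewrite cx_oact cy_oact.
  have := coord _ _ _ _ (cx (y i)) (x i) q1 q2.
  have := coord _ _ _ _ (cy (y i)) (x i) q3 q4.
  by have := hX i; have := hY i; lra.
rewrite big_split /= sumr_const (PiSet_card hx) -[X in X + _]mulr_natl.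
have -> : \sum_i 4 * rho i = 4 * \sum_i rho i by rewrite mulr_sumr.
by lra.
Qed.

End Alignment.

(** * The procedure on given data *)

Section Deterministic.
Variable R : realType.
Implicit Types (Q : Defs.orthogonal R).

(* [385 rho] bounds the distance from the sampled points to a grid labelling, the
   noise contributes [32 rho] to the localization and [8 rho] to the refinement,
   and 776 is the constant of [align_L1]. *)
Definition stage_const (cl cL ce : R) : R :=
  32 + 16 / cl * (4 * (1 + 8 * cL) + 3 * ce + 385 * cL
    + 776 * cL * (2 / cl * (770 * cL + 3 * ce + 32)) + 8).

Lemma biLip_oact n cl cL ce (f : circle R -> circle R -> R) Q :
  biLip n cl cL ce f -> biLip n cl cL ce (fun x y => f (oact Q x) (oact Q y)).
Proof.
case=> h1 h2 h3 h4; split=> // [x y y'|x y y'].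
  by apply: le_trans (h3 _ _ _) _; rewrite gdist_oact.
by have := h4 (oact Q x) (oact Q y) (oact Q y'); rewrite !gdist_oact.
Qed.

Lemma oactK Q : cancel (oact (ortho_inv Q)) (oact Q).
Proof.
move=> x; apply/val_inj; rewrite /= mulmxA.
by have := eqP (ortho_inv_subproof Q); rewrite trmxK => ->; rewrite mul1mx.
Qed.

Variables (n : nat) (cl cL ce : R).
Local Notation eps := (ce * log_rate R n).
Hypotheses (cl0 : 0 < cl) (cL0 : 0 <= cL) (ce0 : 0 <= ce).

Lemma stage_const_gt0 : 0 < stage_const cl cL ce.
Proof.
have c1 : 0 < cl^-1 by rewrite invr_gt0.
have h1 : 0 <= 770 * cL + 3 * ce + 32 by have := cL0; have := ce0; lra.
have c2 : 0 <= 2 / cl by rewrite mulr_ge0 // ltW.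
have c16 : 0 <= 16 / cl by rewrite mulr_ge0 // ltW.
rewrite /stage_const; move: h1; set E1 := 770 * cL + 3 * ce + 32 => h1.
have := mulr_ge0 cL0 (mulr_ge0 c2 h1); set E2 := cL * _ => h2.
have h3 : 0 <= 4 * (1 + 8 * cL) + 3 * ce + 385 * cL + 776 * cL * (2 / cl * E1) + 8.
  by have := cL0; have := ce0; move: h2; rewrite /E2; lra.
by have := mulr_ge0 c16 h3; lra.
Qed.

(** * Error of one localization and refinement stage *)

Section Stage.
Variables (f : circle R -> circle R -> R) (bf : biLip n cl cL ce f).
Variables (m : nat) (m3 : (2 < m)%N) (I : finType).

(** [Q] comes from the localization alone and precedes [x'], so that one [Q] serves all refined
    points. A row may differ from signal plus noise by 1 in total: when the noiseless procedure is
    run on all the points, each row contains its diagonal entry, which carries no signal. Hence the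
    term $1/m$ of the bound. *)
Lemma stage_error_gen (dl t1 t2 : R) (x p y : I -> circle R) (M N : I -> I -> R) :
  0 <= dl -> 0 <= t1 -> 0 <= t2 ->
  PiSet m p -> PiSet m y -> (forall i, gdist (x i) (p i) <= dl) ->
  (forall i j, i != j -> M i j = f (x i) (x j) + N i j) ->
  \sum_i \sum_j M i j * gdist (y i) (y j) <= \sum_i \sum_j M i j * gdist (p i) (p j) ->
  \sum_i \sum_j N i j * (gdist (p i) (p j) - gdist (y i) (y j)) <=
    t1 * m%:R * Num.sqrt (\sum_i \sum_j (gdist (y i) (y j) - gdist (p i) (p j)) ^+ 2) ->
  exists Q, forall (x' z : circle R) (a N' : I -> R), grid m z ->
    (forall z0, grid m z0 -> \sum_j a j * gdist z (y j) <= \sum_j a j * gdist z0 (y j)) ->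
    \sum_j `|a j - N' j - f x' (x j)| <= 1 ->
    (forall z0, grid m z0 -> \sum_j N' j * (gdist z0 (y j) - gdist z (y j)) <=
       t2 * m%:R * gdist z z0) ->
    gdist z (oact Q x') <= 8 / m%:R + 16 / cl * (m%:R^-1 + cL * (8 / m%:R + dl +
      776 * (2 / cl * (2 * cL * dl + 3 * eps + t1))) + 2 * eps + t2 + eps).
Proof.
move=> dl0 t10 t20 hp hy xp MN hmin hN.
have mp : 0 < m%:R :> R by rewrite ltr0n; case: m m3.
have L1 := localize_L1 cl0 cL0 ce0 bf hp hy t10 dl0 xp MN hmin hN.
have [Q hQ] := align_L1 m3 hp hy L1; exists Q => x' z a N' hz hargmin ha hN'.
have [z0 hz0 xz0] := grid_near (oact Q x') (ltnW (ltnW m3)).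
(* Conjugating [f] by [Q] keeps it bi-Lipschitz and lets the grid tuple [y], close to the image of
   [p] on average, serve as the exact reference of [refine_error]. *)
have bQ := biLip_oact (ortho_inv Q) bf.
move: hQ; move: (776 : R) (2 / cl * _) => A eta hQ.
pose eta2 := m%:R^-1 + cL * (8 / m%:R + dl + A * eta) + 2 * eps.
have close : \sum_j `|a j - N' j - f (oact (ortho_inv Q) z0) (oact (ortho_inv Q) (y j))| <= m%:R * eta2.
  have : \sum_j `|a j - N' j - f (oact (ortho_inv Q) z0) (oact (ortho_inv Q) (y j))| <=
      \sum_j (`|a j - N' j - f x' (x j)| +
        (cL * gdist (oact Q (p j)) (y j) + (cL * (8 / m%:R + dl) + 2 * eps))).
    apply: ler_sum => j _.
    apply: le_trans (ler_distD (f x' (x j)) _ _) _; rewrite lerD2l.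
    apply: le_trans (biLip_lipschitz2 _ _ _ _ bf) _.
    rewrite addrA -mulrDr [_ + (8 / _ + _)]addrC lerD2r; apply: ler_wpM2l => //.
    rewrite -(gdist_oact Q x') -(gdist_oact Q (x j)) !oactK -addrA; apply: lerD => //.
    apply: le_trans (gdist_triangle (oact Q (p j)) _ _) _; rewrite lerD2r.
    by rewrite gdist_oact.
  move=> /le_trans; apply.
  rewrite big_split big_split /= -mulr_sumr sumr_const (PiSet_card hy).
  rewrite -[X in _ + (_ + X)]mulr_natl.
  have : cL * \sum_i gdist (oact Q (p i)) (y i) <= cL * (A * m%:R * eta).
    by apply: ler_wpM2l.
  have -> : m%:R * eta2 = 1 + (cL * (A * m%:R * eta) + m%:R * (cL * (8 / m%:R + dl) + 2 * eps)).
    by rewrite /eta2; field; rewrite gt_eqF.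
  by move=> h; apply: lerD => //; rewrite lerD2r.
have hzz : gdist z z0 <= 16 / cl * (eta2 + t2 + eps).
  by apply: (refine_error cl0 ce0 bQ m3 hy hz hz0 t20 close (hargmin z0 hz0) (hN' z0 hz0)).
apply: le_trans (gdist_triangle z0 _ _) _; rewrite addrC; apply: lerD => //.
by rewrite gdistC.
Qed.

Variables (rho : R) (hrho : log_rate R n <= rho) (mrho : m%:R^-1 <= 4 * rho).

Lemma stage_bound_le :
  8 / m%:R + 16 / cl * (m%:R^-1 + cL * (8 / m%:R + 385 * rho +
      776 * (2 / cl * (2 * cL * (385 * rho) + 3 * eps + 32 * rho))) + 2 * eps + 8 * rho + eps)
  <= stage_const cl cL ce * rho.
Proof.
have er : eps <= ce * rho by apply: ler_wpM2l.
have c1 : 0 < cl^-1 by rewrite invr_gt0.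
have c2 : 0 <= 2 / cl by rewrite mulr_ge0 // ltW.
have c16 : 0 <= 16 / cl by rewrite mulr_ge0 // ltW.
have h1 : 2 * cL * (385 * rho) + 3 * eps + 32 * rho <= (770 * cL + 3 * ce + 32) * rho by lra.
have h2 := ler_wpM2l cL0 (ler_wpM2l c2 h1).
have h3 := ler_wpM2l cL0 mrho.
rewrite /stage_const; move: h2.
set E := 2 / cl * (770 * cL + _ + _); rewrite [2 / cl * (_ * rho)]mulrA -/E.
set E' := 2 / cl * _ => h2.
have h4 : m%:R^-1 + cL * (8 / m%:R + 385 * rho + 776 * E') + 2 * eps + 8 * rho + eps <=
   (4 * (1 + 8 * cL) + 3 * ce + 385 * cL + 776 * cL * E + 8) * rho by have := mrho; lra.
by have := ler_wpM2l c16 h4; have := mrho; lra.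
Qed.

Lemma stage_error (x p y : I -> circle R) (M N : I -> I -> R) :
  PiSet m p -> PiSet m y ->
  (forall i, gdist (x i) (p i) <= 385 * rho) ->
  (forall i j, i != j -> M i j = f (x i) (x j) + N i j) ->
  \sum_i \sum_j M i j * gdist (y i) (y j) <= \sum_i \sum_j M i j * gdist (p i) (p j) ->
  \sum_i \sum_j N i j * (gdist (p i) (p j) - gdist (y i) (y j)) <=
    32 * rho * m%:R * Num.sqrt (\sum_i \sum_j (gdist (y i) (y j) - gdist (p i) (p j)) ^+ 2) ->
  exists Q, forall (x' z : circle R) (a N' : I -> R), grid m z ->
    (forall z0, grid m z0 -> \sum_j a j * gdist z (y j) <= \sum_j a j * gdist z0 (y j)) ->
    \sum_j `|a j - N' j - f x' (x j)| <= 1 ->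
    (forall z0, grid m z0 -> \sum_j N' j * (gdist z0 (y j) - gdist z (y j)) <=
       8 * rho * m%:R * gdist z z0) ->
    gdist z (oact Q x') <= stage_const cl cL ce * rho.
Proof.
move=> hp hy xp MN hmin hN.
have rho0 : 0 <= rho by apply: le_trans hrho; exact: sqrtr_ge0.
have d0 : 0 <= 385 * rho by lra.
have t10 : 0 <= 32 * rho by lra.
have t20 : 0 <= 8 * rho by lra.
have [Q hQ] := stage_error_gen d0 t10 t20 hp hy xp MN hmin hN.
exists Q => x' z a N' hz h1 h2 h3; apply: le_trans stage_bound_le.
exact: (hQ x' z a N' hz h1 h2 h3).
Qed.

End Stage.

Lemma grid_argmin m (g : circle R -> R) : (0 < m)%N ->
  exists2 z, grid m z & forall z0, grid m z0 -> g z <= g z0.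
Proof.
move=> m0; pose i0 := Ordinal m0.
case: (@Order.TotalTheory.arg_minP _ _ 'I_m i0 xpredT (fun i => g (circle_root R m i))) => //.
move=> i _ hi; exists (circle_root R m i); first by exists (i : nat); first exact: ltn_ord.
by move=> _ [j jm <-]; exact: (hi (Ordinal jm)).
Qed.

Lemma represents_sym (F : 'M[R]_n) (x : 'I_n -> circle R) f :
  F^T = F -> representations F cl cL ce (x, f) ->
  forall i j, i != j -> F i j = f (x i) (x j).
Proof.
move=> Fs [/= [fs _ _ _] hF] i j; rewrite neq_ltn => /orP[|] ij; first exact: hF.
by rewrite -Fs mxE fs; exact: hF.
Qed.

(* The noiseless procedure run on all the points recovers every representation
   up to an orthogonal map, so any two representations are comparable. *)
Lemma representation_unique (F : 'M[R]_n) (x1 x2 p1 p2 : 'I_n -> circle R) f1 f2 rho :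
  (2 < n)%N -> F^T = F ->
  representations F cl cL ce (x1, f1) -> representations F cl cL ce (x2, f2) ->
  PiSet n p1 -> PiSet n p2 ->
  log_rate R n <= rho -> n%:R^-1 <= 4 * rho ->
  (forall i, gdist (x1 i) (p1 i) <= 385 * rho) ->
  (forall i, gdist (x2 i) (p2 i) <= 385 * rho) ->
  exists Q, forall i, gdist (x1 i) (oact Q (x2 i)) <= 2 * stage_const cl cL ce * rho.
Proof.
move=> n3 Fs h1 h2 hp1 hp2 hrho nrho xp1 xp2.
pose G i j := if i == j then 0 else F i j.
pose obj (y : 'I_n -> circle R) := \sum_i \sum_j G i j * gdist (y i) (y j).
(* Optimality of [y] is only compared with [p1] and [p2], so the better of the two plays the
   minimizer. *)
have [y [hy y1 y2]] : exists y, [/\ PiSet n y, obj y <= obj p1 & obj y <= obj p2].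
  have [h|/ltW h] := leP (obj p1) (obj p2); first by exists p1; split.
  by exists p2; split.
have zP i : exists2 z, grid n z & forall z0, grid n z0 ->
    \sum_j G i j * gdist z (y j) <= \sum_j G i j * gdist z0 (y j).
  by apply: (grid_argmin (fun z => \sum_j G i j * gdist z (y j))); case: n n3.
have rho0 : 0 <= rho by apply: le_trans hrho; exact: sqrtr_ge0.
have stage x f p : representations F cl cL ce (x, f) -> PiSet n p ->
    (forall i, gdist (x i) (p i) <= 385 * rho) -> obj y <= obj p ->
    exists Q, forall i z, grid n z -> (forall z0, grid n z0 ->
    \sum_j G i j * gdist z (y j) <= \sum_j G i j * gdist z0 (y j)) ->
    gdist z (oact Q (x i)) <= stage_const cl cL ce * rho.
  move=> hx hp xp hobj; have [/= bf hF] := hx; have [_ f01 _ _] := bf.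
  have GF i j : i != j -> G i j = f (x i) (x j).
    by move=> ij; rewrite /G (negbTE ij) (represents_sym Fs hx ij).
  have [||Q hQ] := stage_error bf n3 hrho nrho hp hy xp _ hobj (N := fun _ _ => 0).
  - by move=> i j ij; rewrite GF // addr0.
  - rewrite big1 => [|i _]; last by rewrite big1 // => j _; rewrite mul0r.
    by apply: mulr_ge0; [apply: mulr_ge0; [lra | exact: ler0n] | exact: sqrtr_ge0].
  exists Q => i z hz hz0.
  apply: (hQ (x i) z (G i) (fun=> 0) hz hz0).
  - rewrite (bigD1 i) //= big1 => [|j ji].
      rewrite addr0 subr0 /G eqxx sub0r normrN.
      by have /andP[fx0 fx1] := f01 (x i) (x i); rewrite ger0_norm.
    by rewrite GF 1?eq_sym // subr0 subrr normr0.
  - move=> z0 _; rewrite big1 => [|j _]; last by rewrite mul0r.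
    by apply: mulr_ge0; [apply: mulr_ge0; [lra | exact: ler0n] | exact: gdist_ge0].
have [Q1 hQ1] := stage _ _ _ h1 hp1 xp1 y1.
have [Q2 hQ2] := stage _ _ _ h2 hp2 xp2 y2.
exists (omul (ortho_inv Q1) Q2) => i.
have [z hz hmin] := zP i.
rewrite oact_mul -(gdist_oact Q1) oactK.
apply: le_trans (gdist_triangle z _ _) _; rewrite (gdistC _ z).
by have := hQ1 i z hz hmin; have := hQ2 i z hz hmin; lra.
Qed.

(* [x2] and [x2'] are the two refined tuples; [S] and [S'] being themselves
   spread evenly over the circle, so is the complement of their union, on which
   the two alignments are compared. *)
Section Combine.
Variables (m : nat) (m3 : (2 < m)%N) (S S' : {set 'I_n}).
Hypotheses (nm : n = (4 * m)%N) (SS' : forall i, i \in S -> i \notin S').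
Variables (p : 'I_n -> circle R) (pS : idx S -> circle R) (pS' : idx S' -> circle R).
Variable (rho : R).
Hypotheses (hp : PiSet n p) (hpS : PiSet m pS) (hpS' : PiSet m pS').
Hypotheses (ppS : forall i, gdist (p (val i)) (pS i) <= 384 * rho)
  (ppS' : forall i, gdist (p (val i)) (pS' i) <= 384 * rho).
Hypothesis (rho_small : 384 * rho <= 8^-1).

Let sqf (a b : R) (z : circle R) := (a * cx z + b * cy z) ^+ 2.

Lemma sqf_dist (a b : R) (z z' : circle R) :
  sqf a b z <= sqf a b z' + 2 * gdist z z' * (a ^+ 2 + b ^+ 2).
Proof.
have cs (s t : R) : (a * s + b * t) ^+ 2 <= (a ^+ 2 + b ^+ 2) * (s ^+ 2 + t ^+ 2).
  rewrite -subr_ge0; have -> : (a ^+ 2 + b ^+ 2) * (s ^+ 2 + t ^+ 2) - (a * s + b * t) ^+ 2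
    = (a * t - b * s) ^+ 2 by ring.
  exact: sqr_ge0.
set d := gdist z z'; set V := a ^+ 2 + b ^+ 2.
have V0 : 0 <= V by rewrite addr_ge0 ?sqr_ge0.
have d0 : 0 <= d := gdist_ge0 z z'.
set A := a * cx z + b * cy z; set B := a * cx z' + b * cy z'.
have hA : A ^+ 2 <= V by have := cs (cx z) (cy z); rewrite cx2cy2 mulr1.
have hB : B ^+ 2 <= V by have := cs (cx z') (cy z'); rewrite cx2cy2 mulr1.
have hAB : (A - B) ^+ 2 <= V * d ^+ 2.
  have -> : A - B = a * (cx z - cx z') + b * (cy z - cy z') by rewrite /A /B; ring.
  by apply: le_trans (cs _ _) _; rewrite ler_wpM2l //; exact: chord2_le.
have -> : sqf a b z' = B ^+ 2 by [].
have -> : sqf a b z = A ^+ 2 by [].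
rewrite -lerBlDl; have -> : A ^+ 2 - B ^+ 2 = (A - B) * (A + B) by ring.
have V2 : (A + B) ^+ 2 <= 4 * V by have := sqr_ge0 (A - B); lra.
apply: le_trans (ler_norm _) _.
rewrite -(@ler_pXn2r _ 2) ?nnegrE ?mulr_ge0 // real_normK ?num_real // exprMn.
have -> : (2 * d * V) ^+ 2 = (V * d ^+ 2) * (4 * V) by ring.
by rewrite ler_pM ?sqr_ge0.
Qed.

Lemma sum_idx (U : {set 'I_n}) (g : 'I_n -> R) :
  \sum_(i in U) g i = \sum_(i : idx U) g (val i).
Proof. by rewrite big_sub. Qed.

(** By isotropy of [p] the quadratic form has total $2mV$. Each sample is within 1/8 of a grid and
    takes at most $(\frac12+\frac14)mV$. At least $\frac12mV$ is left for the $2m$ remaining points,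
    each contributing at most $\xi^2$. *)
Lemma spread_complement (a b xi : R) :
  (forall i, i \notin S -> i \notin S' -> `|a * cx (p i) + b * cy (p i)| <= xi) ->
  a ^+ 2 + b ^+ 2 <= 4 * xi ^+ 2.
Proof.
move=> hxi; set V := a ^+ 2 + b ^+ 2.
have mp : 0 < m%:R :> R by rewrite ltr0n; case: m m3.
have n3 : (2 < n)%N by rewrite nm (leq_trans m3) // leq_pmull.
have V0 : 0 <= V by rewrite addr_ge0 ?sqr_ge0.
have part (U : {set 'I_n}) (q : idx U -> circle R) : PiSet m q ->
    (forall i, gdist (p (val i)) (q i) <= 384 * rho) ->
    \sum_(i in U) sqf a b (p i) <= m%:R * (3 / 4) * V.
  move=> hq pq; rewrite (sum_idx U (fun i => sqf a b (p i))).
  apply: (@le_trans _ _ (\sum_(i : idx U) (sqf a b (q i) + 2 * 8^-1 * V))).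
    apply: ler_sum => i _; apply: le_trans (sqf_dist _ _ _ (q i)) _.
    rewrite lerD2l -/V ler_wpM2r // ler_wpM2l //.
    exact: le_trans (pq i) rho_small.
  rewrite big_split /= sumr_const (PiSet_card hq) -[X in _ + X]mulr_natl.
  have -> : \sum_i sqf a b (q i) = m%:R / 2 * V.
    by rewrite /V !expr2 -(isotropy m3 hq); apply: eq_bigr => i _; rewrite /sqf expr2.
  by lra.
have tot : \sum_i sqf a b (p i) = n%:R / 2 * V.
  by rewrite /V !expr2 -(isotropy n3 hp); apply: eq_bigr => i _; rewrite /sqf expr2.
have nR : n%:R = 4 * m%:R :> R by rewrite nm natrM.
have split3 (g : 'I_n -> R) : \sum_i g i = \sum_(i in S) g i + (\sum_(i in S') g i
    + \sum_(i | (i \notin S) && (i \notin S')) g i).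
  rewrite (bigID (mem S)) /=; congr (_ + _).
  rewrite (bigID (mem S')) /=; congr (_ + _); apply: eq_bigl => i.
  by have := @SS' i; case: (i \in S); case: (i \in S') => // /(_ isT).
have cardU : \sum_(i | (i \notin S) && (i \notin S')) (1 : R) = (2 * m)%:R.
  have := split3 (fun=> 1); rewrite !sum_idx !sumr_const card_ord.
  rewrite (PiSet_card hpS) (PiSet_card hpS') nR natrM; lra.
have compl : \sum_(i | (i \notin S) && (i \notin S')) sqf a b (p i) <= (2 * m)%:R * xi ^+ 2.
  rewrite -cardU mulr_suml; apply: ler_sum => i /andP[iS iS'].
  have := hxi i iS iS'; rewrite /sqf -(real_normK (num_real (a * cx (p i) + _))).
  by move=> h; rewrite mul1r ler_pXn2r ?nnegrE // (le_trans _ h).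
have := split3 (fun i => sqf a b (p i)).
have := part _ _ hpS ppS; have := part _ _ hpS' ppS'; rewrite tot nR.
move: compl; rewrite natrM => c1 c2 c3 c4.
have : m%:R * V <= m%:R * (4 * xi ^+ 2) by lra.
by rewrite ler_pM2l.
Qed.

Variables (x x2 x2' : 'I_n -> circle R) (K : R) (Q1 Q2 Qh : Defs.orthogonal R).
Hypotheses (K0 : 0 <= K) (xp : forall i, gdist (x i) (p i) <= rho)
  (hx2 : forall i, i \notin S -> gdist (x2 i) (oact Q1 (x i)) <= K * rho)
  (hx2' : forall i, i \notin S' -> gdist (x2' i) (oact Q2 (x i)) <= K * rho).
Hypothesis hQh :
  let U := (~: S :&: ~: S')%SET in
  is_argmin [set: Defs.orthogonal R]
    (fun Q => dinf (fun i : idx U => x2 (val i)) (oact Q \o (fun i : idx U => x2' (val i)))) Qh.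

(** [Qh] does at least as well as $Q_1Q_2^{-1}$, so the tuples it aligns agree within $2K\rho$ off
    both samples, and there $Q_1$ and $H=\hat QQ_2$ agree within [xi]. Applied to the rows of their
    difference, [spread_complement] extends this to the whole circle with a factor 8; the bound is
    $8\xi+K\rho$. *)
Lemma combine_error j :
  gdist (if j \in S then oact Qh (x2' j) else x2 j) (oact Q1 (x j)) <= (16 + 33 * K) * rho.
Proof.
have n3 : (2 < n)%N by rewrite nm (leq_trans m3) // leq_pmull.
have rho0 : 0 <= rho by apply: le_trans (xp (Ordinal (ltnW (ltnW n3)))); exact: gdist_ge0.
have Kr : 0 <= K * rho by rewrite mulr_ge0.
case: ifPn => jS; last by apply: le_trans (hx2 jS) _; lra.
pose U := (~: S :&: ~: S')%SET.
have hU (i : 'I_n) (iS : i \notin S) (iS' : i \notin S') :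
    gdist (x2 i) (oact Qh (x2' i)) <= 2 * (K * rho).
  have iU : i \in U by rewrite !inE iS.
  have [_ /(_ (omul Q1 (ortho_inv Q2)) I)] := hQh; rewrite -/U /=.
  set d1 := dinf _ (oact Qh \o _); set d2 := dinf _ _ => d12.
  apply: (@le_trans _ _ d1).
    exact: (le_bigmax _ (fun k : idx U => gdist (x2 (val k)) (oact Qh (x2' (val k))))
      (Sub i iU : idx U)).
  apply: le_trans d12 _; apply: bigmax_le; first by lra.
  move=> k _ /=; have := valP k; rewrite !inE => /andP[kS kS'].
  apply: le_trans (gdist_triangle (oact Q1 (x (val k))) _ _) _.
  have h1 := hx2 kS; have := hx2' kS'.
  rewrite oact_mul gdist_oact -(gdist_oact Q2 (x _)) oactK gdistC => h2.
  lra.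
set H := omul Qh Q2.
pose xi := (2 + 4 * K) * rho.
have xi0 : 0 <= xi by rewrite mulr_ge0 // addr_ge0 // mulr_ge0.
have onU i : i \notin S -> i \notin S' -> gdist (oact Q1 (p i)) (oact H (p i)) <= xi.
  move=> iS iS'; have h1 := hx2 iS; have h2 := hx2' iS'; have h3 := hU i iS iS'.
  have h4 := xp i.
  have e1 : gdist (oact Q1 (p i)) (oact Q1 (x i)) = gdist (x i) (p i).
    by rewrite gdist_oact gdistC.
  have e2 : gdist (oact Q1 (x i)) (x2 i) = gdist (x2 i) (oact Q1 (x i)) by rewrite gdistC.
  have e3 : gdist (oact Qh (x2' i)) (oact H (x i)) = gdist (x2' i) (oact Q2 (x i)).
    by rewrite oact_mul gdist_oact.
  have e4 : gdist (oact H (x i)) (oact H (p i)) = gdist (x i) (p i) by rewrite gdist_oact.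
  have := gdist_triangle (oact Q1 (x i)) (oact Q1 (p i)) (oact H (p i)).
  have := gdist_triangle (x2 i) (oact Q1 (x i)) (oact H (p i)).
  have := gdist_triangle (oact Qh (x2' i)) (x2 i) (oact H (p i)).
  have := gdist_triangle (oact H (x i)) (oact Qh (x2' i)) (oact H (p i)).
  by rewrite e1 e2 e3 e4 /xi; lra.
have rows (q q' : circle R -> R) (a b a' b' : R) :
    (forall z, q z = a * cx z + b * cy z) -> (forall z, q' z = a' * cx z + b' * cy z) ->
    (forall i, i \notin S -> i \notin S' -> `|q (p i) - q' (p i)| <= xi) ->
    forall z, `|q z - q' z| <= 2 * xi.
  move=> hq hq' hqq z.
  have e z' : q z' - q' z' = (a - a') * cx z' + (b - b') * cy z' by rewrite hq hq'; ring.
  have hV : (a - a') ^+ 2 + (b - b') ^+ 2 <= 4 * xi ^+ 2.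
    by apply: spread_complement => i iS iS'; rewrite -e; exact: hqq.
  have xi20 : 0 <= 2 * xi by lra.
  rewrite -(@ler_pXn2r _ 2) ?nnegrE // real_normK ?num_real // e exprMn.
  apply: le_trans (_ : _ <= (a - a') ^+ 2 + (b - b') ^+ 2) _; last by move: hV; lra.
  have := sqr_ge0 ((a - a') * cy z - (b - b') * cx z); have := cx2cy2 z.
  move: (a - a') (b - b') (cx z) (cy z) => s t u v uv h.
  have -> : s ^+ 2 + t ^+ 2 = (s ^+ 2 + t ^+ 2) * (u ^+ 2 + v ^+ 2) by rewrite uv mulr1.
  by lra.
have QH u : gdist (oact Q1 u) (oact H u) <= 8 * xi.
  apply: le_trans (gdist_le_coords _ _) _.
  have : `|cx (oact Q1 u) - cx (oact H u)| <= 2 * xi.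
    apply: (rows _ _ _ _ _ _ (cx_oact Q1) (cx_oact H)) => i iS iS'.
    exact: le_trans (cx_dist _ _) (onU i iS iS').
  have : `|cy (oact Q1 u) - cy (oact H u)| <= 2 * xi.
    apply: (rows _ _ _ _ _ _ (cy_oact Q1) (cy_oact H)) => i iS iS'.
    exact: le_trans (cy_dist _ _) (onU i iS iS').
  by lra.
have jS' : j \notin S' by exact: SS'.
apply: le_trans (gdist_triangle (oact H (x j)) _ _) _.
have h2 := hx2' jS'; have := QH (x j); rewrite (gdistC (oact Q1 _)).
by rewrite oact_mul gdist_oact /xi; lra.
Qed.

End Combine.
End Deterministic.

(** * Random subsets are evenly spread *)

Section EvenSubsets.
Variable R : realType.

(** Up to $4^{-n}$ these are the binomial weights of parameter 1/4. The ratio of consecutive ones,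
    $(n-i)/(3(i+1))$, is at least 1 exactly for [i < m]. *)
Lemma mul_bin3_mode n m k : n = (4 * m)%N -> (k <= n)%N ->
  ('C(n, k) * 3 ^ (n - k) <= 'C(n, m) * 3 ^ (n - m))%N.
Proof.
move=> nm kn; pose T k := ('C(n, k) * 3 ^ (n - k))%N.
have up i : (i < m)%N -> (T i <= T i.+1)%N.
  move=> im; have i_n : (i < n)%N by rewrite nm; lia.
  rewrite /T -(subnSK i_n) expnS mulnA leq_mul2r; apply/orP; right; rewrite ?subnSK //.
  rewrite -(@leq_pmul2l i.+1) // mul_bin_left.
  have -> : (i.+1 * ('C(n, i) * 3) = (3 * i.+1) * 'C(n, i))%N by lia.
  by rewrite leq_mul2r; apply/orP; right; rewrite nm; lia.
have down i : (m <= i)%N -> (i < n)%N -> (T i.+1 <= T i)%N.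
  move=> mi i_n.
  rewrite /T -(subnSK i_n) expnS mulnA leq_mul2r; apply/orP; right; rewrite ?subnSK //.
  rewrite -(@leq_pmul2l i.+1) // mul_bin_left.
  have -> : (i.+1 * ('C(n, i) * 3) = (3 * i.+1) * 'C(n, i))%N by lia.
  by rewrite leq_mul2r; apply/orP; right; rewrite nm; lia.
have [km|/ltnW mk] := leqP k m.
  rewrite -/(T k) -/(T m) -(subKn km); move: (m - k)%N (leq_subr k m).
  elim=> [|d IH] dm; first by rewrite subn0.
  by apply: leq_trans (IH (ltnW dm)); rewrite -(subnSK dm) up // subnSK // leq_subr.
rewrite -/(T k) -/(T m) -(subnKC mk); move: (k - m)%N (subnKC mk) kn => d <-.
elim: d => [|d IH]; rewrite ?addn0 // addnS => dn.
by apply: leq_trans (IH (ltnW dn)); rewrite down // leq_addr.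
Qed.

(** The $n+1$ weights sum to $4^n$, and the largest is at least their average. *)
Lemma pow4_le_mode n m : n = (4 * m)%N ->
  (4 ^ n <= n.+1 * ('C(n, m) * 3 ^ (n - m)))%N.
Proof.
move=> nm; have -> : (4 ^ n = (3 + 1) ^ n)%N by [].
rewrite expnDn -[n.+1 in leqRHS]card_ord -sum_nat_const.
apply: leq_sum => i _; rewrite exp1n muln1.
by apply: mul_bin3_mode => //; rewrite -ltnS ltn_ord.
Qed.

(** Exponential moment of a Bernoulli(1/4) variable. For small [l], $(1-l)e^l\le1$ gives
    $e^l\le1+l+2l^2$. *)
Lemma expR_quadratic (l : R) : `|l| <= 2^-1 -> 3 + expR l <= 4 * expR (l / 4 + l ^+ 2 / 2).
Proof.
move=> l2; have [h1 h2] : - 2^-1 <= l /\ l <= 2^-1 by move: l2; rewrite ler_norml => /andP.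
have e1 : expR l <= 1 + l + 2 * l ^+ 2.
  have := expR_ge1Dx (- l); rewrite expRN => h.
  have p := expR_gt0 l.
  have : (1 - l) * expR l <= 1.
    by rewrite -[leRHS](mulVf (lt0r_neq0 p)) ler_pM2r.
  have : 1 <= (1 - l) * (1 + l + 2 * l ^+ 2) by rewrite !expr2; nra.
  have : 0 < 1 - l by lra.
  move: (expR l) => X a b c.
  have : (1 - l) * X <= (1 - l) * (1 + l + 2 * l ^+ 2) by lra.
  by rewrite ler_pM2l.
have := expR_ge1Dx (l / 4 + l ^+ 2 / 2); lra.
Qed.

Variables (n m : nat) (nm : n = (4 * m)%N).

(* A uniform [m]-subset is a Bernoulli(1/4) subset conditioned on its size being the
   mode, an event of probability at least [1 / (n + 1)]. *)
Lemma subset_mgf (T : pred 'I_n) (l : R) : `|l| <= 2^-1 ->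
  \sum_(s : {set 'I_n} | #|s| == m) expR (l * (\sum_(j in s) (T j)%:R - #|T|%:R / 4)) <=
  'C(n, m)%:R * n.+1%:R * expR (n%:R * l ^+ 2 / 2).
Proof.
move=> l2.
pose G := (3 : R) ^+ (n - m).
have G0 : 0 < G by rewrite exprn_gt0.
(* The exponential moment of an unconditioned Bernoulli subset, with unnormalized weights 1 and 3,
   expanded over all subsets. *)
have distr : \sum_(s : {set 'I_n}) \prod_(j < n) (if j \in s then expR (l * (T j)%:R) else 3)
    = \prod_(j < n) (expR (l * (T j)%:R) + 3).
  by rewrite bigA_distr.
have fixed (s : {set 'I_n}) : #|s| = m ->
    \prod_(j < n) (if j \in s then expR (l * (T j)%:R) else 3) =
    G * expR (l * \sum_(j in s) (T j)%:R).
  move=> sm; rewrite (bigID (mem s)) /= mulrC; congr (_ * _).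
    rewrite (eq_bigr (fun _ => 3)); last by move=> j /negbTE ->.
    rewrite prodr_const /G; congr (_ ^+ _).
    have := cardC (mem s); rewrite card_ord sm.
    rewrite (eq_card (_ : predC (mem s) =i (fun i => i \notin s))) //.
    by move: #|_| => k kn; lia.
  by rewrite mulr_sumr expR_sum; apply: eq_bigr => j ->.
have h1 : G * \sum_(s : {set 'I_n} | #|s| == m) expR (l * \sum_(j in s) (T j)%:R) <=
    \prod_(j < n) (expR (l * (T j)%:R) + 3).
  rewrite -distr mulr_sumr [leRHS](bigID (fun s : {set 'I_n} => #|s| == m)) /=.
  rewrite -[leLHS]addr0 lerD //.
    by apply: ler_sum => s /eqP sm; rewrite fixed.
  apply: sumr_ge0 => s _; apply: prodr_ge0 => j _.
  by case: ifP => _; rewrite ?expR_ge0.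
have h2 : \prod_(j < n) (expR (l * (T j)%:R) + 3) <=
    4 ^+ n * expR ((l / 4 + l ^+ 2 / 2) * #|T|%:R).
  have -> : 4 ^+ n * expR ((l / 4 + l ^+ 2 / 2) * #|T|%:R) =
      \prod_(j < n) (4 * expR ((l / 4 + l ^+ 2 / 2) * (T j)%:R)).
    rewrite big_split /= prodr_const card_ord; congr (_ * _).
    rewrite -expR_sum -mulr_sumr; congr (expR (_ * _)).
    rewrite -natr_sum -sum1_card big_mkcond /=; congr (_%:R);
    by apply: eq_bigr => j _; rewrite unfold_in; case: (T j).
  apply: ler_prod => j _; rewrite addr_ge0 ?expR_ge0 //=.
  case: (T j); rewrite ?mulr1 ?mulr0 ?expR0; last by lra.
  by rewrite addrC; exact: expR_quadratic.
have h3 : (4 : R) ^+ n <= n.+1%:R * ('C(n, m)%:R * G).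
  by rewrite /G -!natrX -!natrM ler_nat pow4_le_mode.
rewrite -(ler_pM2l G0).
have -> : \sum_(s : {set 'I_n} | #|s| == m) expR (l * (\sum_(j in s) (T j)%:R - #|T|%:R / 4)) =
    expR (- (l / 4 * #|T|%:R)) * \sum_(s : {set 'I_n} | #|s| == m) expR (l * \sum_(j in s) (T j)%:R).
  rewrite mulr_sumr; apply: eq_bigr => s _; rewrite -expRD; congr expR; ring.
rewrite mulrCA; apply: le_trans (ler_wpM2l (expR_ge0 _) (le_trans h1 h2)) _.
rewrite mulrCA -expRD.
have -> : - (l / 4 * #|T|%:R) + (l / 4 + l ^+ 2 / 2) * #|T|%:R = #|T|%:R * l ^+ 2 / 2.
  by rewrite mulrDl addrA addNr add0r; ring.
have -> : G * ('C(n, m)%:R * n.+1%:R * expR (n%:R * l ^+ 2 / 2)) =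
   (n.+1%:R * ('C(n, m)%:R * G)) * expR (n%:R * l ^+ 2 / 2) by ring.
apply: ler_pM; rewrite ?exprn_ge0 ?expR_ge0 // ler_expR -[leLHS]mulrA -[leRHS]mulrA.
apply: ler_wpM2r; first by rewrite divr_ge0 // sqr_ge0.
by rewrite ler_nat -[n in leqRHS]card_ord max_card.
Qed.

Variables (sigma : 'I_n -> 'I_n) (sbij : bijective sigma).

Definition cnt (s : {set 'I_n}) (t : nat) : nat := \sum_(j in s) (sigma j < t)%N.

(** Discrepancy over initial segments of labels, which controls the rank of a point in the sample.
    The factor 12 produces the exponent $6\log n$ of the tail bound. *)
Definition uneven (s : {set 'I_n}) : bool :=
  [exists t : 'I_n.+1, 12 * n%:R * log_rate R n < `|(cnt s t)%:R - t%:R / 4|].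

Lemma log_rate2 : (0 < n)%N -> n%:R * log_rate R n ^+ 2 = ln n%:R.
Proof.
move=> n0; rewrite sqr_sqrtr; last by rewrite divr_ge0 // ln_ge0 // ler1n.
by rewrite mulrCA divff ?mulr1 // pnatr_eq0 -lt0n.
Qed.

Lemma log_rate_le1 : (0 < n)%N -> log_rate R n <= 1.
Proof.
move=> n0; rewrite -(@ler_pXn2r _ 2) ?nnegrE ?sqrtr_ge0 // expr1n.
have np : 0 < n%:R :> R by rewrite ltr0n.
by rewrite -(ler_pM2l np) log_rate2 // mulr1 ltW // ln_sublinear.
Qed.

Lemma card_label_lt (t : nat) : (t <= n)%N -> #|[pred j | (sigma j < t)%N]| = t.
Proof.
move=> tn; have [g sK gK] := sbij.
rewrite -sum1_card (reindex g) /=; last by apply: onW_bij; exists sigma.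
rewrite (eq_bigl (fun i : 'I_n => (i < t)%N)) => [|i]; last by rewrite inE gK.
by rewrite (big_ord_narrow tn) sum1_card card_ord.
Qed.

(** Chernoff bound at $|l|=r/2$: the gain $e^{6\log n}$ against a moment $e^{\log n/8}\le n$ leaves
    $(n+1)/n^5$ for each segment and sign. There are $2(n+1)$ of these, and $2(n+1)^2\le n^3$ from 4
    on. *)
Lemma card_uneven : (3 < n)%N ->
  (#|[pred s : {set 'I_n} | (#|s| == m) && uneven s]|)%:R <= 'C(n, m)%:R / n%:R ^+ 2 :> R.
Proof.
move=> n4.
have n0 : (0 < n)%N by exact: ltn_trans n4.
have np : 0 < n%:R :> R by rewrite ltr0n.
set r := log_rate R n; set c := 'C(n, m)%:R.
have r0 : 0 <= r by exact: sqrtr_ge0.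
have nr2 : n%:R * r ^+ 2 = ln n%:R by exact: log_rate2.
have ln0 : 0 <= ln (n%:R : R) by rewrite ln_ge0 // ler1n.
have tail (t : 'I_n.+1) (l : R) : `|l| = r / 2 ->
    \sum_(s : {set 'I_n} | (#|s| == m) && (6 * ln n%:R <= l * ((cnt s t)%:R - t%:R / 4))) 1
     <= c * n.+1%:R / n%:R ^+ 5.
  move=> hl; have l2 : `|l| <= 2^-1.
    by rewrite hl; have := log_rate_le1 n0; rewrite -/r; lra.
  have ct : #|[pred j | (sigma j < t)%N]| = t by apply: card_label_lt; rewrite -ltnS ltn_ord.
  have := @subset_mgf [pred j | (sigma j < t)%N] l l2; rewrite ct -/c.
  have -> : expR (n%:R * l ^+ 2 / 2) = expR (ln n%:R / 8).
    by congr expR; rewrite -nr2 -(real_normK (num_real l)) hl; field.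
  have : expR (ln n%:R / 8) <= n%:R :> R.
    by rewrite -[leRHS]lnK ?posrE // ler_expR; lra.
  move=> e1 e2.
  rewrite -(@ler_pM2r _ (n%:R ^+ 6)) ?exprn_gt0 //.
  have -> : c * n.+1%:R / n%:R ^+ 5 * n%:R ^+ 6 = c * n.+1%:R * n%:R.
    by field; rewrite gt_eqF.
  apply: le_trans (_ : _ <= c * n.+1%:R * expR (ln n%:R / 8)) _; last first.
    by rewrite ler_wpM2l // mulr_ge0.
  apply: le_trans e2; rewrite mulr_suml big_mkcondr /=; apply: ler_sum => s sm.
  case h : (6 * _ <= _); last exact: expR_ge0.
  rewrite mul1r -[n%:R in leLHS]lnK ?posrE // -expRM_natl ler_expR.
  by apply: le_trans h _; rewrite /cnt natr_sum.
pose B : R := c * n.+1%:R / n%:R ^+ 5.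
have B0 : 0 <= B by rewrite /B; apply: mulr_ge0; rewrite ?invr_ge0 ?exprn_ge0 // mulr_ge0.
apply: (@le_trans _ _ (\sum_(t < n.+1) (B + B))).
  rewrite -sum1_card natr_sum big_mkcond /=.
  apply: (@le_trans _ _ (\sum_(t < n.+1) (
    \sum_(s : {set 'I_n} | (#|s| == m) && (6 * ln n%:R <= r / 2 * ((cnt s t)%:R - t%:R / 4))) 1 +
    \sum_(s : {set 'I_n} | (#|s| == m) && (6 * ln n%:R <= - (r / 2) * ((cnt s t)%:R - t%:R / 4))) 1))); last first.
    apply: ler_sum => t _; apply: lerD; apply: tail; rewrite ?normrN ger0_norm // divr_ge0 //.
  under [leRHS]eq_bigr do rewrite big_mkcond [X in _ + X]big_mkcond -big_split.
  rewrite exchange_big /=; apply: ler_sum => s _.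
  have nn (b1 b2 : bool) : 0 <= (if b1 then 1 else 0) + (if b2 then 1 else 0) :> R.
    by case: b1; case: b2; rewrite ?addr0 ?addr_ge0.
  rewrite inE; case: ifP => [/andP[sm /existsP[t ht]]|_]; last by apply: sumr_ge0 => u _; exact: nn.
  rewrite (bigD1 t) //= sm /=.
  apply: ler_wpDr; first by apply: sumr_ge0 => u _; exact: nn.
  have key u : 12 * n%:R * r < u -> 6 * ln n%:R <= r / 2 * u.
    move=> hu; have : r / 2 * (12 * n%:R * r) <= r / 2 * u.
      by apply: ler_wpM2l; [rewrite divr_ge0 | exact: ltW].
    by move: nr2; rewrite expr2; lra.
  move: ht; rewrite -/r ltr_normr => /orP[|] /key h.
    by rewrite h lerDl; case: ifP.
  by rewrite mulNr -mulrN h lerDr; case: ifP.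
rewrite sumr_const card_ord -[leLHS]mulr_natl /B.
rewrite -(@ler_pM2r _ (n%:R ^+ 5)) ?exprn_gt0 //.
have -> : n.+1%:R * (c * n.+1%:R / n%:R ^+ 5 + c * n.+1%:R / n%:R ^+ 5) * n%:R ^+ 5 =
   c * (2 * n.+1 * n.+1)%:R by rewrite !natrM; field; rewrite gt_eqF.
have -> : c / n%:R ^+ 2 * n%:R ^+ 5 = c * (n ^ 3)%:R by rewrite natrX; field; rewrite gt_eqF.
apply: ler_wpM2l => //; rewrite ler_nat.
by rewrite !expnS expn0; nia.
Qed.

Hypothesis n4 : (3 < n)%N.

(** A sampled point goes to the grid point of its rank in the sample. Evenness puts the rank within
    $12nr$ of a quarter of the label; in angles, with $n=4m$, this is $96\pi r\le384r$. *)
Lemma even_subset_PiSet (s : {set 'I_n}) : #|s| = m -> ~~ uneven s ->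
  exists2 q : idx s -> circle R, PiSet m q &
    forall i : idx s, gdist (circle_root R n (sigma (val i)).+1) (q i) <= 384 * log_rate R n.
Proof.
move=> sm /existsPn even.
(* Counting up to the next label includes the point itself, which matches the shift by one in
   [PiSet]. *)
have cntS (i : idx s) : cnt s (sigma (val i)).+1 = (cnt s (sigma (val i))).+1.
  rewrite /cnt (bigD1 (val i)) ?(valP i) //= [in RHS](bigD1 (val i)) ?(valP i) //=.
  rewrite ltnn ltnSn add0n add1n; congr _.+1; apply: eq_bigr => j /andP[_ ji].
  rewrite ltnS leq_eqVlt [_ == _](_ : _ = false) //.
  by apply: contraNF ji => /eqP/val_inj/(bij_inj sbij) ->.
have cnt_mono a b : (a <= b)%N -> (cnt s a <= cnt s b)%N.
  move=> ab; apply: leq_sum => j _.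
  by case: ltnP => //= ja; rewrite (leq_trans ja ab).
have cnt_le a : (cnt s a <= m)%N.
  by rewrite -sm -sum1_card; apply: leq_sum => j _; case: (_ < _)%N.
have rk_lt (i : idx s) : (cnt s (sigma (val i)) < m)%N by rewrite -cntS.
pose rk i := Ordinal (rk_lt i).
have rk_inj : injective rk.
  move=> i k /(congr1 val) /= e; apply/val_inj/(bij_inj sbij)/val_inj/eqP.
  rewrite eqn_leq; apply/andP; split; rewrite leqNgt; apply/negP => /cnt_mono;
  by rewrite cntS e ltnn.
exists (fun i => circle_root R m (rk i).+1).
  exists rk => //; apply: inj_card_bij => //.
  by rewrite card_ord card_sig -sm.
move=> i; apply: le_trans (gdist_cis_le _ _) _.
have n0 : (0 < n)%N by exact: leq_trans n4.
have m0 : (0 < m)%N by move: n0; rewrite nm muln_gt0.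
have mp : 0 < m%:R :> R by rewrite ltr0n.
have nmR : n%:R = 4 * m%:R :> R by rewrite nm natrM.
have hlt : ((sigma (val i)).+1 < n.+1)%N by rewrite ltnS.
have := even (Ordinal hlt); rewrite -leNgt /= cntS => h.
rewrite nmR.
have -> : 2 * pi * (sigma (val i)).+1%:R / (4 * m%:R) - 2 * pi * (cnt s (sigma (val i))).+1%:R / m%:R =
   - (2 * pi / m%:R * ((cnt s (sigma (val i))).+1%:R - (sigma (val i)).+1%:R / 4)) :> R.
  by field; rewrite gt_eqF.
rewrite normrN normrM ger0_norm ?divr_ge0 ?mulr_ge0 ?pi_ge0 ?(ltW mp) //.
apply: le_trans (ler_wpM2l _ h) _; first by rewrite divr_ge0 ?mulr_ge0 ?pi_ge0 // ltW.
have r0 : 0 <= log_rate R n := sqrtr_ge0 _.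
rewrite nmR.
have -> : 2 * pi / m%:R * (12 * (4 * m%:R) * log_rate R n) = 96 * pi * log_rate R n.
  by field; rewrite gt_eqF.
apply: ler_wpM2r => //; have := pihalf_lt2 R; lra.
Qed.

End EvenSubsets.

(** * Independence *)

Section Independence.
Variables (d : measure_display) (T : measurableType d) (R : realType).
Variable P : probability T R.

Lemma bigsetU_le (I : Type) (r : seq I) (A : I -> set T) :
  (forall i, measurable (A i)) ->
  (P (\big[setU/set0]_(i <- r) A i) <= \sum_(i <- r) P (A i))%E.
Proof.
move=> mA; elim: r => [|i r IH]; first by rewrite !big_nil measure0.
rewrite !big_cons; apply: le_trans (measureU2 _ _ _) _ => //.
  exact: bigsetU_measurable.
exact: leeD.
Qed.

Lemma fin_bigcup_le (I : finType) (A : I -> set T) (b : I -> R) :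
  (forall i, measurable (A i)) -> (forall i, (P (A i) <= (b i)%:E)%E) ->
  measurable (\bigcup_i A i) /\ (P (\bigcup_i A i) <= (\sum_i b i)%:E)%E.
Proof.
move=> mA bA; have mU : measurable (\bigcup_i A i).
  by apply: fin_bigcup_measurable => //; exact: finite_finset.
split=> //; rewrite -sumEFin.
apply: le_trans (lee_sum _ (fun i _ => bA i)).
apply: le_trans (bigsetU_le _ mA).
apply: le_measure; rewrite ?inE //; first exact: bigsetU_measurable.
by move=> w [i _ Aiw]; rewrite (bigD1 i) //=; left.
Qed.

Lemma fin_disjoint_sum_le1 (I : finType) (A : I -> set T) :
  (forall i, measurable (A i)) -> trivIset [set: I] A -> (\sum_i P (A i) <= 1)%E.
Proof.
move=> mA tA; rewrite big_enum_val /=.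
rewrite -(@measure_bigsetU_ord _ _ _ P _ xpredT (A \o @enum_val I _)) //; last first.
  by move=> i j _ _ /= /(tA _ _ Logic.I Logic.I); exact: enum_val_inj.
  by move=> i; exact: mA.
by apply: probability_le1; apply: bigsetU_measurable => i _; exact: mA.
Qed.

Definition indep (g h : set T) : Prop := P (g `&` h) = (P g * P h)%E.

Lemma indep_bigcup (F : (set T)^nat) (h : set T) :
  measurable h -> (forall n, measurable (F n)) -> trivIset [set: nat] F ->
  (forall n, indep (F n) h) -> indep (\bigcup_n F n) h.
Proof.
move=> mh mF tF hF; rewrite /indep setI_bigcupl.
rewrite measure_bigcup //; [|by move=> i _; exact: measurableI|exact: trivIset_setIr].
rewrite measure_bigcup // [RHS]muleC -(fineK (fin_num_measure P h mh)) -nneseriesZl //.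
by apply: eq_eseriesr => i _; rewrite fineK ?fin_num_measure // [LHS]hF muleC.
Qed.

(** Dynkin's lemma in one of the two events, the other staying fixed. *)
Lemma indep_gen (G : set (set T)) (h : set T) :
  setI_closed G -> G `<=` measurable -> measurable h ->
  (forall g, G g -> indep g h) -> forall g, <<s G >> g -> indep g h.
Proof.
move=> GI Gm mh Gh.
have sm : <<s G >> `<=` (measurable : set (set T)).
  by apply: smallest_sub => //; exact: sigma_algebra_measurable.
apply: (@dynkin_induction _ (g_sigma_algebraType G) G (fun g => indep g h)) => //.
- by rewrite /indep setTI probability_setT mul1e.
- move=> S /sm mS; rewrite /indep => hS.
  rewrite probability_setC // setIC -setDE.
  have : P h = (P (h `\` S) + P (h `&` S))%E := measureDI P mh mS.
  rewrite (setIC h S) hS.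
  rewrite -(fineK (fin_num_measure P h mh)) -(fineK (fin_num_measure P S mS)).
  have mD : measurable (h `\` S) by exact: measurableD.
  rewrite -(fineK (fin_num_measure P _ mD)) -EFinM -EFinD => -[e].
  by rewrite -EFinB -EFinM; congr (_%:E); rewrite mulrBl mul1r {1}e addrK.
- by move=> F mF tF hF; apply: indep_bigcup => // n; exact: (sm _ (mF n)).
Qed.

Variables (K : finType) (D : pred K) (X : K -> T -> R).
Hypotheses (indX : mutually_indep P D X).
Hypotheses (mX : forall k, D k -> measurable_fun [set: T] (X k)).

Definition sig (D1 : pred K) : set (set T) :=
  <<s [set G | exists k, D1 k /\ exists2 B : set R, measurable B & G = X k @^-1` B] >>.

(** A pi-system generating [sig]: with one constraint per index, intersections are boxes again,
    unlike the events on a single variable. *)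
Definition boxes (D1 : pred K) : set (set T) :=
  [set G | exists2 B : K -> set R, (forall k, measurable (B k)) &
    G = [set w | forall k, D1 k -> B k (X k w)]].

Lemma boxes_setI (D1 : pred K) : setI_closed (boxes D1).
Proof.
move=> _ _ [B mB ->] [B' mB' ->]; exists (fun k => B k `&` B' k).
  by move=> k; exact: measurableI.
apply/seteqP; split=> w /=; first by move=> [h1 h2] k Dk; split; [exact: h1|exact: h2].
by move=> h; split=> k Dk; have [] := h k Dk.
Qed.

Lemma sig_boxes (D1 : pred K) : sig D1 `<=` <<s boxes D1 >>.
Proof.
apply: smallest_sub; first exact: smallest_sigma_algebra.
move=> _ [k [Dk [B mB ->]]]; apply: sub_gen_smallest.
exists (fun k' => if k' == k then B else setT) => [k'|].
  by case: ifP => _; [exact: mB | exact: measurableT].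
apply/seteqP; split=> w /= h; last by have := h k Dk; rewrite eqxx.
by move=> k' _; case: eqP => // ->.
Qed.

Lemma boxE (D1 : pred K) (B : K -> set R) : [set w | forall k, D1 k -> B k (X k w)] =
  \bigcap_(k in [set` finset D1]) (X k @^-1` B k).
Proof.
apply/seteqP; split=> w /= h k; first by rewrite /= inE => /h.
by move=> Dk; apply: h; rewrite /= inE.
Qed.

Lemma sig_measurable (D1 : pred K) : {subset D1 <= D} -> sig D1 `<=` measurable.
Proof.
move=> D1D; apply: smallest_sub; first exact: sigma_algebra_measurable.
move=> _ [k [Dk [B mB ->]]]; rewrite -[_ @^-1` _]setTI.
by apply: mX => //; exact: D1D.
Qed.

Lemma boxes_measurable (D1 : pred K) : {subset D1 <= D} -> boxes D1 `<=` measurable.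
Proof.
move=> D1D _ [B mB ->]; rewrite boxE.
apply: fin_bigcap_measurable; first exact: finite_finset.
move=> k /=; rewrite inE => Dk; rewrite -[_ @^-1` _]setTI.
by apply: mX => //; exact: D1D.
Qed.

(** Boxes over disjoint index sets merge into one box, where the product formula applies;
    [indep_gen] then extends one argument at a time. *)
Lemma indep_sig (D1 D2 : pred K) g h : {subset D1 <= D} -> {subset D2 <= D} ->
  (forall k, D1 k -> ~~ D2 k) -> sig D1 g -> sig D2 h -> indep g h.
Proof.
move=> D1D D2D D12 sg sh.
have base g' h' : boxes D1 g' -> boxes D2 h' -> indep g' h'.
  move=> [B mB ->] [B' mB' ->].
  pose B2 k := if D1 k then B k else B' k.
  have mB2 k : measurable (B2 k) by rewrite /B2; case: ifP.
  rewrite /indep [X in P X = _](_ : _ = [set w | forall k, (D1 k || D2 k) -> B2 k (X k w)]); last first.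
    apply/seteqP; split=> w /=.
      move=> [h1 h2] k; rewrite /B2; case: ifP => [/h1 //|_] /= /h2 //.
    move=> hh; split=> k Dk; have := hh k; rewrite /B2 Dk ?orbT.
      by apply.
    by case: ifP => [/D12|_]; [rewrite Dk | exact].
  have box D3 (B3 : K -> set R) : {subset D3 <= D} -> (forall k, measurable (B3 k)) ->
      P [set w | forall k, D3 k -> B3 k (X k w)] = (\prod_(k | D3 k) P (X k @^-1` B3 k))%E.
    move=> D3D mB3; rewrite boxE (indX _ mB3); last by move=> k; rewrite inE => /D3D.
    by apply: eq_bigl => k; rewrite inE.
  rewrite (box (fun k => D1 k || D2 k) B2) //; last first.
    by move=> k /orP[/D1D|/D2D].
  rewrite (box D1 B) // (box D2 B') // (bigID D1) /=; congr (_ * _)%E.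
    by apply: eq_big => k; [case: (D1 k); rewrite ?andbT ?andbF | move=> /andP[_ h1]; rewrite /B2 h1].
  apply: eq_big => k; last by move=> /andP[_ /negbTE h1]; rewrite /B2 h1.
  by have := D12 k; case: (D1 k); case: (D2 k) => //= /(_ isT).
have m2 := boxes_measurable D2D; have m1 := boxes_measurable D1D.
have step1 h' : boxes D2 h' -> indep g h'.
  move=> bh; apply: (indep_gen (@boxes_setI D1) m1 (m2 _ bh) _ (sig_boxes sg)).
  by move=> g' bg; exact: base.
rewrite /indep setIC muleC.
apply: (indep_gen (@boxes_setI D2) m2 (sig_measurable D1D sg) _ (sig_boxes sh)).
by move=> h' bh; rewrite /indep setIC muleC; exact: step1.
Qed.

End Independence.

(** * Noise events *)

Section Noise.
Variables (R : realType) (n : nat).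

Lemma sym_sum (g : 'I_n -> 'I_n -> R) :
  (forall i j, g i j = g j i) -> (forall i, g i i = 0) ->
  \sum_i \sum_j g i j = 2 * \sum_(i < n) \sum_(j < n | (i < j)%N) g i j.
Proof.
move=> gs g0.
transitivity (\sum_(i < n) \sum_(j < n | (i < j)%N) g i j +
              \sum_(i < n) \sum_(j < n | (j < i)%N) g i j).
  rewrite -big_split; apply: eq_bigr => i _ /=.
  rewrite (bigID (fun j : 'I_n => (i < j)%N)) /=; congr (_ + _).
  rewrite (bigD1 i) /= ?ltnn // g0 add0r; apply: eq_bigl => j.
  by rewrite -leqNgt ltn_neqAle andbC.
rewrite mulr_natl mulr2n; congr (_ + _).
rewrite (exchange_big_dep xpredT) //=; apply: eq_bigr => i _.
by apply: eq_bigr => j _.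
Qed.

(** Symmetric matrix carrying [g] on row and column [i]: a functional of one row of the noise
    becomes one of its upper triangle, to which the subgaussian condition applies. *)
Definition star (i : 'I_n) (g : 'I_n -> R) (a b : 'I_n) : R :=
  if a == i then g b else if b == i then g a else 0.

Lemma star_sum (i : 'I_n) (g : 'I_n -> R) (F : 'I_n -> 'I_n -> R) :
  (forall a b, F a b = F b a) -> g i = 0 ->
  \sum_(a < n) \sum_(b < n | (a < b)%N) star i g a b * F a b = \sum_b g b * F i b.
Proof.
move=> Fs gi; have two : 2 != 0 :> R by rewrite pnatr_eq0.
apply: (mulfI two); rewrite -sym_sum; first last.
- move=> a; rewrite /star; case: eqP => [->|_]; last by rewrite mul0r.
  by rewrite gi mul0r.
- move=> a b; rewrite Fs /star; congr (_ * _).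
  by have [->|_] := eqVneq a i; have [bi|_] := eqVneq b i; rewrite ?bi.
rewrite (bigD1 i) //= mulr_natl mulr2n; congr (_ + _).
  by apply: eq_bigr => b _; rewrite /star eqxx.
rewrite [RHS](bigD1 i) //= gi mul0r add0r; apply: eq_bigr => a /negbTE ai.
rewrite (bigD1 i) //= /star ai eqxx Fs big1 ?addr0 // => b /negbTE bi.
by rewrite bi mul0r.
Qed.

Definition sum2 (B E : 'I_n -> 'I_n -> R) : R :=
  \sum_(i < n) \sum_(j < n | (i < j)%N) B i j * E i j.

Definition symE (E : 'I_n -> 'I_n -> R) (i j : 'I_n) : R :=
  if (i < j)%N then E i j else if (j < i)%N then E j i else 0.

Lemma symEC E i j : symE E i j = symE E j i.
Proof. by rewrite /symE; case: ltngtP. Qed.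

Lemma sum2_symE B E : sum2 B E = sum2 B (symE E).
Proof.
by apply: eq_bigr => i _; apply: eq_bigr => j ij; rewrite /symE ij.
Qed.

End Noise.

(** * Uniform noise bound for the localization *)

Section NoiseEvents.
Variables (R : realType) (n : nat).
Variables (d : measure_display) (T : measurableType d).

Definition deviation (E : 'I_n -> 'I_n -> T -> R) (B : 'M[R]_n) (t : R) : set T :=
  [set w | t * Num.sqrt (\sum_(i < n) \sum_(j < n | (i < j)%N) B i j ^+ 2)
     < \sum_(i < n) \sum_(j < n | (i < j)%N) B i j * E i j w].

(** Measurability is asked only where the coefficient is nonzero, so that the lemma also applies to
    the sigma-algebra generated by part of the noise. *)
Lemma deviation_measurable (E : 'I_n -> 'I_n -> T -> R) (B : 'M[R]_n) (t : R) :
  (forall i j : 'I_n, (i < j)%N -> B i j = 0 \/ measurable_fun [set: T] (E i j)) ->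
  measurable (deviation E B t).
Proof.
move=> mE; rewrite /deviation; set c := t * _.
set f := fun w => \sum_(i < n) \sum_(j < n | (i < j)%N) B i j * E i j w.
have mf : measurable_fun [set: T] f.
  have -> : f = fun w => \sum_(i < n) \sum_(j < n) (if (i < j)%N then B i j * E i j w else 0).
    by apply/funext => w; apply: eq_bigr => i _; rewrite big_mkcond.
  apply: measurable_sum => i; apply: measurable_sum => j.
  have [ij|_] := ltnP i j; last exact: measurable_cst.
  case: (mE i j ij) => [->|mEij].
    rewrite (_ : (fun _ => _) = cst 0); first exact: measurable_cst.
    by apply/funext => w; rewrite mul0r.
  by apply: measurable_realfun.measurable_funM => //; exact: measurable_cst.
have -> : [set w | c < f w] = [set: T] `&` f @^-1` `]c, +oo[%classic.
  by rewrite setTI; apply/seteqP; split=> w /=; rewrite in_itv /= andbT.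
by apply: mf => //; exact: measurable_itv.
Qed.

Variable P : probability T R.
Variable E : 'I_n -> 'I_n -> {RV P >-> R}.
Hypothesis hE : subGaussian1 P (fun i j => E i j).

Lemma RV_measurable i j : measurable_fun [set: T] (E i j).
Proof. exact: measurable_funP. Qed.

Lemma deviation_le B t : 0 <= t ->
  measurable (deviation (fun i j => E i j) B t) /\
  (P (deviation (fun i j => E i j) B t) <= (expR (- (t ^+ 2) / 2))%:E)%E.
Proof.
move=> t0; split; last exact: hE.
by apply: deviation_measurable => i j _; right; exact: RV_measurable.
Qed.

Variables (m : nat) (nm : n = (4 * m)%N) (n4 : (3 < n)%N).
Local Notation r := (log_rate R n).

Lemma log_rate_ge0 : 0 <= r. Proof. exact: sqrtr_ge0. Qed.

Lemma nr2 : n%:R * r ^+ 2 = ln n%:R.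
Proof. by apply: log_rate2; exact: leq_trans n4. Qed.

Lemma ln_n_ge0 : 0 <= ln n%:R :> R.
Proof. by rewrite ln_ge0 // ler1n; exact: leq_trans n4. Qed.

Lemma expR_ln_pow k : expR (- (k%:R * ln n%:R)) = (n%:R ^+ k)^-1 :> R.
Proof. by rewrite expRN expRM_natl lnK // posrE ltr0n; exact: leq_trans n4. Qed.

(** Labellings are extended to maps of ['I_n] to itself, so that one finite type covers all
    samples. *)
Definition pair_matrix (k : {set 'I_n} * {ffun 'I_n -> 'I_n} * {ffun 'I_n -> 'I_n}) : 'M[R]_n :=
  \matrix_(i, j) if (i \in k.1.1) && (j \in k.1.1) then
     gdist (circle_root R m (k.1.2 i).+1) (circle_root R m (k.1.2 j).+1)
     - gdist (circle_root R m (k.2 i).+1) (circle_root R m (k.2 j).+1) else 0.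

Lemma PiSet_labels (s : {set 'I_n}) (p : idx s -> circle R) : PiSet m p ->
  exists u : {ffun 'I_n -> 'I_n}, forall i, p i = circle_root R m (u (val i)).+1.
Proof.
have mn : (m <= n)%N by rewrite nm leq_pmull.
case=> u _ pu.
exists [ffun i : 'I_n => if insub i is Some k then widen_ord mn (u k) else i] => i.
by rewrite ffunE valK pu.
Qed.

(* The union over all the subsets and labellings costs [exp(O(n log n))], which the
   deviation level absorbs: here no independence of the draws is needed. *)
Definition localize_bad : set T :=
  \bigcup_k deviation (fun i j => E i j) (pair_matrix k) (Num.sqrt (10 * n%:R * ln n%:R)).

Lemma localize_bad_prob :
  measurable localize_bad /\ (P localize_bad <= ((n%:R ^+ 2)^-1)%:E)%E.
Proof.
have n0 : (0 < n)%N by exact: leq_trans n4.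
rewrite /localize_bad; set t := Num.sqrt (10 * n%:R * ln n%:R).
have t2 : t ^+ 2 = 10 * n%:R * ln n%:R.
  by rewrite sqr_sqrtr // mulr_ge0 ?ln_n_ge0 // mulr_ge0.
have t0 : 0 <= t by exact: sqrtr_ge0.
have [] := @fin_bigcup_le _ _ _ P _ (fun k => deviation (fun i j => E i j) (pair_matrix k) t)
  (fun=> expR (- (t ^+ 2) / 2)).
- by move=> k; have [] := deviation_le (pair_matrix k) t0.
- by move=> k; have [] := deviation_le (pair_matrix k) t0.
move=> mB hB; split=> //; apply: le_trans hB _; rewrite lee_fin sumr_const.
(* Each matrix costs $n^{-5n}$, and there are $2^nn^{2n}\le n^{3n}$ of them. *)
rewrite !card_prod !card_ffun card_ord -cardsT -powersetT card_powerset cardsT card_ord.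
rewrite t2; have -> : - (10 * n%:R * ln n%:R) / 2 = - ((5 * n)%:R * ln n%:R) :> R.
  by rewrite natrM; field.
rewrite expR_ln_pow -[leLHS]mulr_natr.
have np (k : nat) : 0 < n%:R ^+ k :> R by rewrite exprn_gt0 // ltr0n.
rewrite [leLHS]mulrC ler_pdivrMr // mulrC ler_pdivlMr // -!natrX -natrM ler_nat.
apply: (@leq_trans (n ^ n * n ^ n * n ^ n * n ^ (2 * n))).
  rewrite leq_mul // ?leq_mul ?leq_exp2r //; first by exact: ltnW (ltnW n4).
  by rewrite leq_pexp2l // leq_pmulr.
by rewrite -!expnD leq_pexp2l //; lia.
Qed.

(** Sums over ordered pairs are twice those over the upper triangle, and $\sqrt{10n\log
    n}=\sqrt{10}\,nr\le16mr$; doubling gives 32. *)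
Lemma localize_noise w : ~ localize_bad w -> forall (s : {set 'I_n}) (p y : idx s -> circle R),
  PiSet m p -> PiSet m y ->
  \sum_i \sum_j symE (fun i j => E i j w) (val i) (val j) *
     (gdist (p i) (p j) - gdist (y i) (y j)) <=
  32 * r * m%:R * Num.sqrt (\sum_i \sum_j (gdist (y i) (y j) - gdist (p i) (p j)) ^+ 2).
Proof.
move=> good s p y hp hy.
have [u pu] := PiSet_labels hp; have [v yv] := PiSet_labels hy.
set B := pair_matrix (s, u, v).
have Bs i j : B i j = B j i by rewrite !mxE /= andbC !(gdistC (circle_root _ _ (_ i).+1)).
have B0 i : B i i = 0 by rewrite !mxE /= !gdistxx subrr; case: ifP.
have BE (i j : idx s) : B (val i) (val j) = gdist (p i) (p j) - gdist (y i) (y j).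
  by rewrite !mxE /= !(valP i) (valP j) /= -!pu -!yv.
have Bout i j : ~~ ((i \in s) && (j \in s)) -> B i j = 0.
  by move=> /negbTE h; rewrite !mxE /= h.
have sub (g : 'I_n -> 'I_n -> R) : (forall i j, B i j = 0 -> g i j = 0) ->
    \sum_(i : idx s) \sum_(j : idx s) g (val i) (val j) = \sum_i \sum_j g i j.
  move=> g0; rewrite [RHS](bigID (mem s)) /= [X in _ + X]big1 ?addr0; last first.
    move=> i /negbTE iS; apply: big1 => j _; apply: g0; apply: Bout; rewrite iS //.
  rewrite sum_idx; apply: eq_bigr => i _.
  rewrite [RHS](bigID (mem s)) /= [X in _ + X]big1 ?addr0; last first.
    move=> j /negbTE jS; apply: g0; apply: Bout; rewrite jS andbF //.
  by rewrite sum_idx.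
have e1 : \sum_i \sum_j symE (fun i j => E i j w) (val i) (val j) *
     (gdist (p i) (p j) - gdist (y i) (y j)) =
   2 * \sum_(i < n) \sum_(j < n | (i < j)%N) B i j * E i j w.
  rewrite [X in 2 * X](sum2_symE B (fun i j => E i j w)) /sum2 -sym_sum; first last.
  - by move=> i; rewrite B0 mul0r.
  - by move=> i j; rewrite Bs symEC.
  rewrite -(sub (fun i j => B i j * symE (fun i j => E i j w) i j)); last first.
    by move=> i j ->; rewrite mul0r.
  by apply: eq_bigr => i _; apply: eq_bigr => j _; rewrite BE mulrC.
have e2 : \sum_i \sum_j (gdist (y i) (y j) - gdist (p i) (p j)) ^+ 2 =
   2 * \sum_(i < n) \sum_(j < n | (i < j)%N) B i j ^+ 2.
  rewrite -sym_sum; first last.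
  - by move=> i; rewrite B0 expr0n.
  - by move=> i j; rewrite Bs.
  rewrite -(sub (fun i j => B i j ^+ 2)); last by move=> i j ->; rewrite expr0n.
  by apply: eq_bigr => i _; apply: eq_bigr => j _; rewrite BE -sqrrN opprB.
have : \sum_(i < n) \sum_(j < n | (i < j)%N) B i j * E i j w <=
    Num.sqrt (10 * n%:R * ln n%:R) * Num.sqrt (\sum_(i < n) \sum_(j < n | (i < j)%N) B i j ^+ 2).
  rewrite leNgt; apply/negP => h; apply: good; exists (s, u, v) => //.
rewrite e1 e2; set X := \sum_(i < n) _; set Y := \sum_(i < n) _ => h.
have Y0 : 0 <= Y by apply: sumr_ge0 => i _; apply: sumr_ge0 => j _; exact: sqr_ge0.
have s1 : Num.sqrt Y <= Num.sqrt (2 * Y) by rewrite ler_wsqrtr //; lra.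
have r0 := log_rate_ge0.
have mr : Num.sqrt (10 * n%:R * ln n%:R) <= 16 * (r * m%:R).
  rewrite -(@ler_pXn2r _ 2) ?nnegrE ?sqrtr_ge0 //; last by rewrite mulr_ge0 // mulr_ge0.
  rewrite sqr_sqrtr; last by rewrite mulr_ge0 ?ln_n_ge0 // mulr_ge0.
  have nR : n%:R = 4 * m%:R :> R by rewrite nm natrM.
  by rewrite -nr2 nR; have := sqr_ge0 (m%:R * r); lra.
have : Num.sqrt (10 * n%:R * ln n%:R) * Num.sqrt Y <= 16 * (r * m%:R) * Num.sqrt (2 * Y).
  by apply: ler_pM => //; exact: sqrtr_ge0.
lra.
Qed.

End NoiseEvents.

Section SigmaAlgebras.
Variables (T : Type) (R : realType).

Lemma gen_sigma_preimage (S : set (set T)) (U K : Type) (Y : K -> U -> R) (phi : T -> U) :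
  sigma_algebra setT S ->
  (forall k (B : set R), measurable B -> S (phi @^-1` (Y k @^-1` B))) ->
  forall G, gen_sigma Y G -> S (phi @^-1` G).
Proof.
move=> [S0 SD SU] hS; apply: smallest_sub; last first.
  by move=> _ [k [B mB ->]]; exact: hS.
split=> [|G|F hF] /=; first by rewrite preimage_set0.
  by move=> /SD; rewrite !setTD preimage_setC.
by rewrite preimage_bigcup; exact: SU.
Qed.

End SigmaAlgebras.

(** * Noise bound for the refinement of a fixed sample *)

Section RefineNoise.
Variables (R : realType) (n m : nat) (nm : n = (4 * m)%N) (n4 : (3 < n)%N).
Variables (d : measure_display) (T : measurableType d) (P : probability T R).
Variable E : 'I_n -> 'I_n -> {RV P >-> R}.
Hypothesis hE : subGaussian1 P (fun i j => E i j).
Local Notation X := (fun k : 'I_n * 'I_n => E k.1 k.2 : T -> R).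
Local Notation upper := (fun k : 'I_n * 'I_n => (k.1 < k.2)%N).
Hypothesis indE : mutually_indep P upper X.
Variables (F : 'M[R]_n) (Fsym : F^T = F) (A : T -> 'M[R]_n).
Hypotheses (hAsym : forall w, (A w)^T = A w) (hAdiag : forall w i, A w i i = 0)
  (hA : forall w (i j : 'I_n), (i < j)%N -> A w i j = F i j + E i j w).
Variable rl : stage_rule R n m.
Local Notation r := (log_rate R n).

Lemma A_symE w i j : i != j -> A w i j = F i j + symE (fun i j => E i j w) i j.
Proof.
rewrite /symE; case: ltngtP => [ij _|ji _|/val_inj ->]; last by rewrite eqxx.
  exact: hA.
by rewrite -(hAsym w) -Fsym !mxE hA.
Qed.

Lemma sig_sigma_algebra (D1 : pred ('I_n * 'I_n)) : sigma_algebra setT (sig X D1).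
Proof. exact: smallest_sigma_algebra. Qed.

Lemma sig_setT (D1 : pred ('I_n * 'I_n)) : sig X D1 setT.
Proof.
have [h0 hD _] := sig_sigma_algebra D1.
by rewrite -[setT]setD0; exact: hD.
Qed.

(** Off the diagonal an entry of [A] is a shifted noise variable, read above the diagonal; a
    diagonal entry is constant and its events are trivial. *)
Lemma sig_entry (D1 : pred ('I_n * 'I_n)) (i j : 'I_n) (B : set R) : measurable B ->
  ((i < j)%N -> D1 (i, j)) -> ((j < i)%N -> D1 (j, i)) ->
  sig X D1 [set w | B (A w i j)].
Proof.
move=> mB hij hji.
have shift (a b : 'I_n) : (a < b)%N -> D1 (a, b) -> sig X D1 [set w | B (A w a b)].
  move=> ab Dab; apply: sub_gen_smallest; exists (a, b); split=> //.
  exists ((fun x : R => F a b + x) @^-1` B).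
    rewrite -[_ @^-1` _]setTI.
    have mf : measurable_fun [set: R] (fun x : R => F a b + x).
      by apply: measurable_realfun.measurable_funD => //; exact: measurable_cst.
    exact: mf.
  by apply/seteqP; split=> w /=; rewrite hA.
have [ij|ji|/val_inj ij] := ltngtP i j.
- exact: shift (hij ij).
- rewrite (_ : [set w | _] = [set w | B (A w j i)]); first exact: shift (hji ji).
  by apply/seteqP; split=> w /=; rewrite -{1}(hAsym w) mxE.
rewrite ij; have [b0|b0] := pselect (B 0).
  rewrite (_ : [set w | _] = setT); first exact: sig_setT.
  by apply/seteqP; split=> w //= _; rewrite hAdiag.
rewrite (_ : [set w | _] = set0); first by have [] := sig_sigma_algebra D1.
by apply/seteqP; split=> w //=; rewrite hAdiag.
Qed.

Lemma deviation_sig (D1 : pred ('I_n * 'I_n)) (B : 'M[R]_n) (t : R) :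
  (forall i j : 'I_n, (i < j)%N -> B i j = 0 \/ D1 (i, j)) ->
  sig X D1 (deviation (fun i j => E i j) B t).
Proof.
move=> hB.
pose G := [set G | exists k, D1 k /\ exists2 B : set R, measurable B & G = X k @^-1` B].
apply: (@deviation_measurable R n _ (g_sigma_algebraType G) (fun i j => E i j)).
move=> i j ij; have [->|Dij] := hB i j ij; [by left | right].
move=> _ Y mY; rewrite setTI; apply: sub_gen_smallest.
by exists (i, j); split=> //; exists Y.
Qed.

Section FixedSample.
Variables (s : {set 'I_n}) (sm : #|s| = m).
Local Notation inner := (fun k : 'I_n * 'I_n => [&& (k.1 < k.2)%N, k.1 \in s & k.2 \in s]).
Local Notation outer := (fun k : 'I_n * 'I_n => (k.1 < k.2)%N && ~~ ((k.1 \in s) && (k.2 \in s))).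

Definition located (w : T) : idx s -> circle R :=
  localize rl (fun i j : idx s => A w (val i) (val j)).

Definition labelling (c : {ffun idx s -> 'I_m}) (j : idx s) : circle R :=
  circle_root R m (c j).+1.

Lemma located_sig v : sig X inner [set w | located w = v].
Proof.
have := localize_measurable rl sm v.
apply: (gen_sigma_preimage (phi := fun w (i j : idx s) => A w (val i) (val j))).
  exact: sig_sigma_algebra.
by move=> [i j] B mB; apply: sig_entry => //= h; rewrite h !(valP i) !(valP j).
Qed.

Lemma located_PiSet w : PiSet m (located w).
Proof. by have [] := localize_argmin rl sm (fun i j : idx s => A w (val i) (val j)). Qed.

Lemma circle_root_inj a b : (a < m)%N -> (b < m)%N ->
  circle_root R m a.+1 = circle_root R m b.+1 -> a = b.
Proof.
wlog ab : a b / (b <= a)%N => [H|] am bm e.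
  by have [/H|/ltnW/H] := leqP b a => [h|h]; [exact: h | apply/esym; exact: h].
apply/eqP; rewrite eqn_leq ab andbT leqNgt; apply/negP => ba.
have mp : 0 < m%:R :> R by rewrite ltr0n; exact: leq_ltn_trans am.
have : dot (circle_root R m a.+1) (circle_root R m b.+1) = 1.
  by rewrite e /dot -!expr2 cx2cy2.
rewrite dot_cis cos_double.
have -> : (2 * pi * a.+1%:R / m%:R - 2 * pi * b.+1%:R / m%:R) / 2 = pi * ((a - b)%:R / m%:R) :> R.
  by rewrite natrB ?(ltnW ba) // -!natr1; field; rewrite gt_eqF.
set th := pi * _.
have sp : 0 < sin th.
  have ab0 : 0 < (a - b)%:R :> R by rewrite ltr0n subn_gt0.
  apply: sin_gt0_pi; rewrite mulr_gt0 ?pi_gt0 ?divr_gt0 //=.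
  rewrite -[ltRHS]mulr1 ltr_pM2l ?pi_gt0 // ltr_pdivrMr // mul1r ltr_nat.
  exact: leq_ltn_trans (leq_subr _ _) am.
by have := exprn_gt0 2 sp; lra.
Qed.

Lemma labelling_inj : injective labelling.
Proof.
move=> c c' e; apply/ffunP => j; apply/val_inj.
by apply: circle_root_inj; rewrite ?ltn_ord //; have := congr1 (fun h => h j) e.
Qed.

Lemma located_labelling w : exists c, located w = labelling c.
Proof.
have [u _ hu] := located_PiSet w; exists [ffun j => u j].
by apply/funext => j; rewrite hu /labelling ffunE.
Qed.

Definition contrast (c : {ffun idx s -> 'I_m}) (k k0 : 'I_m) (b : 'I_n) : R :=
  if insub b is Some j
  then gdist (circle_root R m k0) (labelling c j) - gdist (circle_root R m k) (labelling c j)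
  else 0.

Definition contrast_matrix (c : {ffun idx s -> 'I_m}) (q : 'I_n * 'I_m * 'I_m) : 'M[R]_n :=
  \matrix_(a, b) star q.1.1 (contrast c q.1.2 q.2) a b.

Definition contrast_bad (c : {ffun idx s -> 'I_m}) : set T :=
  \bigcup_q (if q.1.1 \in s then set0
    else deviation (fun i j => E i j) (contrast_matrix c q) (Num.sqrt (10 * ln n%:R))).

Lemma contrast_out c k k0 b : b \notin s -> contrast c k k0 b = 0.
Proof. by move=> bs; rewrite /contrast insubN. Qed.

(** As the refined index lies outside [s], coefficients with both indices in [s] vanish: this noise
    is disjoint from the one determining the localized tuple. *)
Lemma contrast_bad_sig c : sig X outer (contrast_bad c).
Proof.
pose G := [set G | exists k, outer k /\ exists2 B : set R, measurable B & G = X k @^-1` B].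
apply: (@fin_bigcup_measurable _ (g_sigma_algebraType G)); first exact: finite_finset.
move=> [[i k] k0] _ /=; case: ifPn => [_|iS]; first exact: measurable0.
apply: deviation_sig => a b ab; rewrite ab /= mxE /= /star.
have [as_|as_] := boolP (a \in s); have [bs|bs] := boolP (b \in s); [left|by right..].
have /negbTE -> : a != i by apply: contraNneq iS => <-.
by have /negbTE -> : b != i by apply: contraNneq iS => <-.
Qed.

Lemma contrast_bad_prob c :
  measurable (contrast_bad c) /\ (P (contrast_bad c) <= ((n%:R ^+ 2)^-1)%:E)%E.
Proof.
have n0 : (0 < n)%N by exact: leq_trans n4.
have lnn := ln_n_ge0 R n4.
rewrite /contrast_bad; set t := Num.sqrt (10 * ln n%:R).
have t2 : t ^+ 2 = 10 * ln n%:R by rewrite sqr_sqrtr // mulr_ge0.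
have t0 : 0 <= t by exact: sqrtr_ge0.
have dev q : measurable (if q.1.1 \in s then set0
      else deviation (fun i j => E i j) (contrast_matrix c q) t) /\
   (P (if q.1.1 \in s then set0
      else deviation (fun i j => E i j) (contrast_matrix c q) t) <= (expR (- (t ^+ 2) / 2))%:E)%E.
  case: ifP => _; last exact: deviation_le.
  by rewrite measure0 lee_fin expR_ge0; split; first exact: measurable0.
have [] := @fin_bigcup_le _ _ _ P _ _ (fun=> expR (- (t ^+ 2) / 2))
  (fun q => (dev q).1) (fun q => (dev q).2).
move=> mB hB; split=> //; apply: le_trans hB _; rewrite lee_fin sumr_const.
(* Each deviation costs $n^{-5}$, and there are $nm^2\le n^3$ triples. *)
rewrite !card_prod !card_ord.
rewrite t2; have -> : - (10 * ln n%:R) / 2 = - (5%:R * ln n%:R) :> R by field.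
rewrite (expR_ln_pow R n4) -[leLHS]mulr_natr.
have np (k : nat) : 0 < n%:R ^+ k :> R by rewrite exprn_gt0 // ltr0n.
rewrite [leLHS]mulrC ler_pdivrMr // mulrC ler_pdivlMr // -!natrX -natrM ler_nat.
have mn : (m <= n)%N by rewrite nm leq_pmull.
by rewrite [(n ^ 5)%N](_ : _ = n * n * n * n ^ 2)%N ?leq_mul //; rewrite !expnS expn0; lia.
Qed.

(* At the deviation level [log n] a union over the values [c] of the localized tuple
   is too costly; the probabilities are summed instead, each event
   [located w = labelling c] being independent of [contrast_bad c]. *)
Definition refine_bad : set T :=
  \bigcup_(c : {ffun idx s -> 'I_m}) ([set w | located w = labelling c] `&` contrast_bad c).

Lemma inner_upper : {subset inner <= upper}.
Proof. by move=> k /and3P[]. Qed.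

Lemma outer_upper : {subset outer <= upper}.
Proof. by move=> k /andP[]. Qed.

Lemma X_measurable k : upper k -> measurable_fun [set: T] (X k).
Proof. by move=> _; exact: measurable_funP. Qed.

Lemma sig_sub (D1 D2 : pred ('I_n * 'I_n)) : {subset D1 <= D2} -> sig X D1 `<=` sig X D2.
Proof.
move=> D12; apply: smallest_sub; first exact: sig_sigma_algebra.
move=> G [k [Dk hk]]; apply: sub_gen_smallest; exists k; split=> //; exact: D12.
Qed.

Lemma refine_bad_sig : sig X upper refine_bad.
Proof.
pose G := [set G | exists k, upper k /\ exists2 B : set R, measurable B & G = X k @^-1` B].
apply: (@fin_bigcup_measurable _ (g_sigma_algebraType G)); first exact: finite_finset.
move=> c _; apply: (@measurableI _ (g_sigma_algebraType G)).
  exact: (sig_sub inner_upper (located_sig _)).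
exact: (sig_sub outer_upper (contrast_bad_sig _)).
Qed.

Lemma refine_bad_prob :
  measurable refine_bad /\ (P refine_bad <= ((n%:R ^+ 2)^-1)%:E)%E.
Proof.
have mL c : measurable [set w | located w = labelling c].
  by apply: (sig_measurable X_measurable inner_upper); exact: located_sig.
have mI c : measurable ([set w | located w = labelling c] `&` contrast_bad c).
  by apply: measurableI => //; have [] := contrast_bad_prob c.
set b := (n%:R ^+ 2)^-1 : R.
have b0 : 0 <= b by rewrite invr_ge0 exprn_ge0.
have hI c : (P ([set w | located w = labelling c] `&` contrast_bad c) <=
    (fine (P [set w | located w = labelling c]) * b)%:E)%E.
  have ind : indep P [set w | located w = labelling c] (contrast_bad c).
    apply: (indep_sig indE X_measurable inner_upper outer_upper) => //.
    - by move=> k /and3P[-> -> ->].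
    - exact: located_sig.
    - exact: contrast_bad_sig.
  rewrite ind EFinM fineK ?fin_num_measure //.
  by apply: lee_wpmul2l => //; have [] := contrast_bad_prob c.
have [mB hB] := fin_bigcup_le mI hI; split=> //; apply: le_trans hB _.
rewrite lee_fin -mulr_suml -[leRHS]mul1r; apply: ler_wpM2r => //.
rewrite -lee_fin -sumEFin.
rewrite (eq_bigr (fun c => P [set w | located w = labelling c])); last first.
  by move=> c _; rewrite fineK ?fin_num_measure.
apply: fin_disjoint_sum_le1 => // c c' _ _ [w [/= e e']].
by apply: labelling_inj; rewrite -e -e'.
Qed.

(** Distances being 1-Lipschitz, the $m$ coefficients are at most $d(z,z_0)$, and $\sqrt{10m\log
    n}=\sqrt{40}\,mr\le8mr$. *)
Lemma refine_noise w : ~ refine_bad w -> forall (i : 'I_n) (z z0 : circle R),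
  i \notin s -> grid m z -> grid m z0 ->
  \sum_(j : idx s) symE (fun i j => E i j w) i (val j) *
     (gdist z0 (located w j) - gdist z (located w j)) <= 8 * r * m%:R * gdist z z0.
Proof.
move=> good i z z0 iS [k /= km <-] [k0 /= k0m <-].
have [c hc] := located_labelling w.
set g := contrast c (Ordinal km) (Ordinal k0m).
have gi : g i = 0 by exact: contrast_out.
have gE (j : idx s) : g (val j) = gdist (circle_root R m k0) (located w j) -
    gdist (circle_root R m k) (located w j).
  by rewrite /g /contrast valK hc.
have sub (h : 'I_n -> R) : (forall b, g b = 0 -> h b = 0) ->
    \sum_b h b = \sum_(j : idx s) h (val j).
  move=> h0; rewrite (bigID (mem s)) /= [X in _ + X]big1 ?addr0 ?sum_idx //.
  by move=> b bs; apply: h0; exact: contrast_out.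
set e := symE _.
have dev : ~ deviation (fun i j => E i j) (contrast_matrix c (i, Ordinal km, Ordinal k0m))
    (Num.sqrt (10 * ln n%:R)) w.
  move=> h; apply: good; exists c => //; split=> //.
  by exists (i, Ordinal km, Ordinal k0m) => //=; rewrite (negbTE iS).
move/negP: dev; rewrite -leNgt.
have -> : \sum_(a < n) \sum_(b < n | (a < b)%N)
    contrast_matrix c (i, Ordinal km, Ordinal k0m) a b * E a b w =
    \sum_(j : idx s) e i (val j) * g (val j).
  transitivity (sum2 (star i g) (fun a b => E a b w)).
    by apply: eq_bigr => a _; apply: eq_bigr => b _; rewrite mxE.
  rewrite sum2_symE /sum2 star_sum //; last exact: symEC.
  rewrite (sub (fun b => g b * _ i b)); last by move=> b ->; rewrite mul0r.
  by apply: eq_bigr => j _; rewrite mulrC.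
have -> : \sum_(a < n) \sum_(b < n | (a < b)%N)
    contrast_matrix c (i, Ordinal km, Ordinal k0m) a b ^+ 2 =
    \sum_(j : idx s) g (val j) ^+ 2.
  transitivity (\sum_(a < n) \sum_(b < n | (a < b)%N) star i (fun b => g b ^+ 2) a b * 1).
    apply: eq_bigr => a _; apply: eq_bigr => b _; rewrite mxE mulr1 /star /= -/g.
    by case: ifP => // _; case: ifP => // _; rewrite expr0n.
  rewrite (@star_sum _ _ i (fun b => g b ^+ 2) (fun _ _ => 1)) //; last by rewrite gi expr0n.
  rewrite (sub (fun b => g b ^+ 2 * 1)); last by move=> b ->; rewrite expr0n mul0r.
  by apply: eq_bigr => j _; rewrite mulr1.
set Y := \sum_(j : idx s) g (val j) ^+ 2 => h.
rewrite (eq_bigr (fun j : idx s => e i (val j) * g (val j))); last by move=> j _; rewrite gE.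
apply: le_trans h _.
set D := gdist _ _.
have D0 : 0 <= D by exact: gdist_ge0.
have YD : Y <= m%:R * D ^+ 2.
  rewrite mulr_natl -(PiSet_card (located_PiSet w)) -sumr_const; apply: ler_sum => j _.
  rewrite gE -sqrrN opprB -(real_normK (num_real (_ - _))) ler_pXn2r ?nnegrE //.
  exact: gdist_subl.
have lnn := ln_n_ge0 R n4.
have nR : n%:R = 4 * m%:R :> R by rewrite nm natrM.
have r0 := log_rate_ge0 R n.
rewrite -sqrtrM; last by rewrite mulr_ge0.
rewrite -(@ler_pXn2r _ 2) ?nnegrE ?sqrtr_ge0 //; last first.
  by apply: mulr_ge0 => //; apply: mulr_ge0 => //; apply: mulr_ge0.
rewrite sqr_sqrtr; last first.
  apply: mulr_ge0; first by rewrite mulr_ge0.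
  by apply: sumr_ge0 => j _; exact: sqr_ge0.
have : 10 * ln n%:R * Y <= 10 * ln n%:R * (m%:R * D ^+ 2) by rewrite ler_wpM2l // mulr_ge0.
rewrite -(nr2 R n4) nR; have := sqr_ge0 (m%:R * r * D).
by lra.
Qed.

End FixedSample.
End RefineNoise.

(** * The two draws *)

Section Draws.
Variables (R : realType) (n m : nat) (nm : n = (4 * m)%N).
Variables (d : measure_display) (T : measurableType d) (P : probability T R).

Lemma card_draws_compl (s : {set 'I_n}) : #|s| = m ->
  #|(fun u : {set 'I_n} => (u \subset ~: s)%SET && (#|u| == m))| = 'C(3 * m, m).
Proof.
move=> sm; have -> : (3 * m = #|(~: s)%SET|)%N.
  by have := cardsC s; rewrite card_ord sm; lia.
by rewrite -cards_draws; apply: eq_card => u; rewrite !inE.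
Qed.

Lemma card_draws_ord : #|(fun s : {set 'I_n} => #|s| == m)| = 'C(n, m).
Proof. by rewrite -[n in RHS]card_ord -card_draws; apply: eq_card => u; rewrite !inE. Qed.

Section OneDraw.
Variable V : T -> {set 'I_n}.
Hypothesis mV : forall s, measurable (V @^-1` [set s]).

Lemma draw_bound (H : {set 'I_n} -> set T) (b : R) : 0 <= b ->
  (forall s, measurable (H s)) ->
  (forall s, (P (H s `&` V @^-1` [set s]) <= P (V @^-1` [set s]) * b%:E)%E) ->
  measurable [set w | H (V w) w] /\ (P [set w | H (V w) w] <= b%:E)%E.
Proof.
move=> b0 mH hH.
have -> : [set w | H (V w) w] = \bigcup_s (H s `&` V @^-1` [set s]).
  by apply/seteqP; split=> w /= => [h|[s _ [h ->]] //]; exists (V w).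
have mI s : measurable (H s `&` V @^-1` [set s]) by exact: measurableI.
have hb s : (P (H s `&` V @^-1` [set s]) <= (fine (P (V @^-1` [set s])) * b)%:E)%E.
  by rewrite EFinM fineK ?fin_num_measure.
have [mB hB] := fin_bigcup_le mI hb; split=> //; apply: le_trans hB _.
rewrite lee_fin -mulr_suml -[leRHS]mul1r; apply: ler_wpM2r => //.
rewrite -lee_fin -sumEFin.
rewrite (eq_bigr (fun s => P (V @^-1` [set s]))); last first.
  by move=> s _; rewrite fineK ?fin_num_measure.
by apply: fin_disjoint_sum_le1 => // s s' _ _ [w [/= <- <-]].
Qed.

Lemma draw_pred_bound (D : pred {set 'I_n}) :
  (forall s, (P (V @^-1` [set s]) <= (uniform_mass R (fun s : {set 'I_n} => #|s| == m) s)%:E)%E) ->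
  measurable [set w | D (V w)] /\
  (P [set w | D (V w)] <= (#|[pred s : {set 'I_n} | (#|s| == m) && D s]|%:R / 'C(n, m)%:R)%:E)%E.
Proof.
move=> hV.
have -> : [set w | D (V w)] = \bigcup_s (if D s then V @^-1` [set s] else set0).
  apply/seteqP; split=> w /= => [h|[s _]]; first by exists (V w) => //; rewrite h.
  by case: ifP => // hs ->.
have mI s : measurable (if D s then V @^-1` [set s] else set0).
  by case: ifP => _; [exact: mV | exact: measurable0].
have hb s : (P (if D s then V @^-1` [set s] else set0) <=
    (if (#|s| == m) && D s then 'C(n, m)%:R^-1 else 0)%:E)%E.
  case: ifP => _; last by rewrite measure0 lee_fin; case: ifP.
  by apply: le_trans (hV s) _; rewrite /uniform_mass card_draws_ord andbT.
have [mB hB] := fin_bigcup_le mI hb; split=> //; apply: le_trans hB _.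
by rewrite lee_fin -big_mkcond sumr_const -[leLHS]mulr_natl.
Qed.

End OneDraw.

Variables (S S' : T -> {set 'I_n}) (hdraws : uniform_draws P m S S').

Lemma first_draw_mass s :
  (P (S @^-1` [set s]) <= (uniform_mass R (fun s : {set 'I_n} => #|s| == m) s)%:E)%E.
Proof. by have [_ -> _] := hdraws. Qed.

Lemma draws_measurable s : measurable (S @^-1` [set s]) /\ measurable (S' @^-1` [set s]).
Proof. by have [h _ _] := hdraws. Qed.

(** [S'] is marginally uniform: a set of size [m] is disjoint from $\binom{3m}{m}$ others of that
    size, which cancels the conditional mass. *)
Lemma second_draw_mass s' :
  (P (S' @^-1` [set s']) <= (uniform_mass R (fun s : {set 'I_n} => #|s| == m) s')%:E)%E.
Proof.
have [mS hS hSS'] := hdraws.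
have -> : S' @^-1` [set s'] = \bigcup_s (S @^-1` [set s] `&` S' @^-1` [set s']).
  by apply/seteqP; split=> w /= => [h|[s _ [_]] //]; exists (S w).
have mI s : measurable (S @^-1` [set s] `&` S' @^-1` [set s']).
  by apply: measurableI; [have [] := mS s | have [] := mS s'].
pose mass s := uniform_mass R (fun s : {set 'I_n} => #|s| == m) s *
  uniform_mass R (fun u : {set 'I_n} => (u \subset ~: s)%SET && (#|u| == m)) s'.
have hb s : (P (S @^-1` [set s] `&` S' @^-1` [set s']) <= (mass s)%:E)%E.
  by rewrite hSS' hS -EFinM.
have [_ hB] := fin_bigcup_le mI hb; apply: le_trans hB _; rewrite lee_fin.
rewrite /uniform_mass card_draws_ord.
have [s'm|s'm] := ifPn; last first.
  rewrite big1 // => s _; rewrite /mass /uniform_mass (negbTE s'm) andbF mulr0 //.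
have C0 : 0 < 'C(3 * m, m)%:R :> R by rewrite ltr0n bin_gt0 leq_pmull.
apply: (@le_trans _ _ (\sum_(s : {set 'I_n} | (s \subset ~: s')%SET && (#|s| == m))
    ('C(n, m)%:R^-1 * 'C(3 * m, m)%:R^-1))).
  rewrite [leRHS]big_mkcond /=; apply: ler_sum => s _.
  rewrite /mass /uniform_mass card_draws_ord.
  have [sm|_] := boolP (#|s| == m); last by rewrite mul0r andbF.
  rewrite s'm !andbT card_draws_compl ?(eqP sm) // finset.subsetC.
  case: ifP => _; rewrite ?mulr0 //.
rewrite sumr_const card_draws_compl ?(eqP s'm) // -[leLHS]mulr_natr -mulrA mulVf ?mulr1 //.
by rewrite gt_eqF.
Qed.

Definition draws_improper : set T :=
  [set w | ~~ [&& #|S w| == m, #|S' w| == m & (S' w \subset ~: S w)%SET]].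

Lemma draws_improper_null : measurable draws_improper /\ (P draws_improper <= 0)%E.
Proof.
have [mS hS hSS'] := hdraws.
pose ok (q : {set 'I_n} * {set 'I_n}) := [&& #|q.1| == m, #|q.2| == m & (q.2 \subset ~: q.1)%SET].
have -> : draws_improper =
    \bigcup_q (if ok q then set0 else S @^-1` [set q.1] `&` S' @^-1` [set q.2]).
  apply/seteqP; split=> w /= => [h|[[s s'] _]].
    by exists (S w, S' w) => //; rewrite /ok /= (negbTE h).
  by case: ifPn => //= h [e e']; rewrite /draws_improper /= e e'.
have mI q : measurable (if ok q then set0 else S @^-1` [set q.1] `&` S' @^-1` [set q.2]).
  case: ifP => _; first exact: measurable0.
  by apply: measurableI; [have [] := mS q.1 | have [] := mS q.2].
have hb q : (P (if ok q then set0 else S @^-1` [set q.1] `&` S' @^-1` [set q.2]) <= 0%:E)%E.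
  case: ifPn => [_|nok]; first by rewrite measure0.
  rewrite hSS' hS -EFinM lee_fin /uniform_mass.
  move: nok; rewrite /ok; case: (#|q.1| == m); rewrite ?mul0r //=.
  by rewrite andbC => /negbTE ->; rewrite mulr0.
have [mB hB] := fin_bigcup_le mI hb; split=> //; apply: le_trans hB _.
by rewrite big1.
Qed.

End Draws.

(** * Conclusion *)

Section GoodEvent.
Variables (R : realType) (cl cL ce : R).
Hypotheses (cl0 : 0 < cl) (cL0 : 0 <= cL) (ce0 : 0 <= ce).
Local Notation K := (stage_const cl cL ce).

(** Amounts to $e\le4$, from $e^{-1/2}\ge1-\frac12$. *)
Lemma ln_ge1 n : (3 < n)%N -> 1 <= ln n%:R :> R.
Proof.
move=> n4; rewrite -[leLHS](expRK) ler_ln ?posrE ?expR_gt0 ?ltr0n //; last exact: leq_trans n4.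
apply: (@le_trans _ _ 4); last by rewrite (ler_nat R 4).
have h : 2^-1 <= expR (- 2^-1) :> R by have := expR_ge1Dx (- 2^-1 : R); lra.
have e : expR (1 : R) * (expR (- 2^-1) * expR (- 2^-1)) = 1.
  by rewrite -!expRD -[RHS]expR0; congr expR; field.
have p : 0 < expR (1 : R) by exact: expR_gt0.
have : expR (1 : R) * (2^-1 * 2^-1) <= expR (1 : R) * (expR (- 2^-1) * expR (- 2^-1)).
  by apply: ler_wpM2l; [exact: ltW | apply: ler_pM].
by rewrite e; lra.
Qed.

Lemma invn_le_log_rate n : (3 < n)%N -> n%:R^-1 <= log_rate R n.
Proof.
move=> n4; have np : 0 < n%:R :> R by rewrite ltr0n; exact: leq_trans n4.
have h1 := ln_ge1 n4; have h2 := nr2 R n4; have r0 := log_rate_ge0 R n.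
rewrite -(ler_pM2l np) divff ?gt_eqF //.
have n1 : 1 <= n%:R :> R by rewrite ler1n; exact: leq_trans n4.
have h3 : 1 * 1 <= n%:R * ln n%:R :> R by apply: ler_pM.
rewrite -(@ler_pXn2r _ 2) ?nnegrE //; last by rewrite mulr_ge0.
by move: h3; rewrite -h2 expr1n mulr1 => /le_trans; apply; rewrite exprMn mulrA expr2.
Qed.

Variables (n m : nat) (nm : n = (4 * m)%N) (n4 : (3 < n)%N).
Variables (d : measure_display) (T : measurableType d) (P : probability T R).
Variable E : 'I_n -> 'I_n -> {RV P >-> R}.
Variables (F : 'M[R]_n) (Fsym : F^T = F) (A : T -> 'M[R]_n).
Hypotheses (hAsym : forall w, (A w)^T = A w)
  (hA : forall w (i j : 'I_n), (i < j)%N -> A w i j = F i j + E i j w).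
Variables (x : 'I_n -> circle R) (f : circle R -> circle R -> R).
Hypothesis hx : representations F cl cL ce (x, f).
Variables (sigma : 'I_n -> 'I_n) (sbij : bijective sigma).
Local Notation p := (fun i : 'I_n => circle_root R n (sigma i).+1).
Variable rho : R.
Hypotheses (hrho : log_rate R n <= rho)
  (xp : forall i, gdist (x i) (p i) <= rho - log_rate R n).
Variable w : T.
Hypothesis good_localize : ~ localize_bad E m w.

Lemma stage_good (m3 : (2 < m)%N) (rl : stage_rule R n m) (s : {set 'I_n}) :
  #|s| = m -> ~~ uneven R sigma s -> ~ refine_bad E A rl s w ->
  exists (q : idx s -> circle R) Q,
  [/\ PiSet m q, forall i, gdist (p (val i)) (q i) <= 384 * rho &
   forall i, i \notin s -> gdist (stage rl (A w) s i) (oact Q (x i)) <= K * rho].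
Proof.
move=> sm even good.
have [q hq pq] := even_subset_PiSet nm sbij n4 sm even.
have r0 := log_rate_ge0 R n; have hrho' := hrho.
have mrho : m%:R^-1 <= 4 * rho.
  have -> : m%:R^-1 = 4 * n%:R^-1 :> R.
    have mp : 0 < m%:R :> R by rewrite ltr0n; exact: leq_trans m3.
    by rewrite nm natrM; field; rewrite gt_eqF.
  by have := invn_le_log_rate n4; have := hrho; lra.
have [/= bf hF] := hx.
have AE i j : i != j -> A w i j = f (x i) (x j) + symE (fun i j => E i j w) i j.
  by move=> ij; rewrite (A_symE Fsym hAsym hA) // (represents_sym Fsym hx ij).
pose y := located A rl (s := s) w.
have hy : PiSet m y by exact: located_PiSet.
have [hloc hmin] := localize_argmin rl sm (fun i j : idx s => A w (val i) (val j)).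
have [||||Q hQ] := @stage_error R n cl cL ce cl0 cL0 ce0 f bf m m3 (idx s) rho hrho mrho
  (fun i => x (val i)) q y (fun i j => A w (val i) (val j))
  (fun i j => symE (fun i j => E i j w) (val i) (val j)) hq hy.
- move=> i; apply: le_trans (gdist_triangle (p (val i)) _ _) _.
  by have := xp (val i); have := pq i; rewrite /=; lra.
- by move=> i j ij; apply: AE.
- exact: hmin.
- apply: le_trans (localize_noise nm n4 good_localize hq hy) _.
  apply: ler_wpM2r; first exact: sqrtr_ge0.
  by apply: ler_wpM2r => //; lra.
exists q, Q; split=> // [i|i iS].
  by have := pq i; have := hrho; rewrite /=; lra.
have [hz hzmin] := refine_argmin rl sm (fun j : idx s => A w i (val j)) iS hy.
apply: (hQ (x i) (stage rl (A w) s i) (fun j => A w i (val j))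
  (fun j => symE (fun i j => E i j w) i (val j))) => //.
  rewrite big1 // => j _.
  have ij : i != val j by apply: contraNneq iS => ->; exact: valP.
  by rewrite AE // addrK subrr normr0.
move=> z0 hz0; apply: le_trans (refine_noise nm n4 sm good iS hz hz0) _.
apply: ler_wpM2r; first exact: gdist_ge0.
by apply: ler_wpM2r => //; lra.
Qed.

Lemma procedure_error (rA rB : stage_rule R n m) (rC : align_rule R n) (s s' : {set 'I_n}) :
  384 * rho <= 8^-1 -> #|s| = m -> #|s'| = m -> (s' \subset ~: s)%SET ->
  ~~ uneven R sigma s -> ~~ uneven R sigma s' ->
  ~ refine_bad E A rA s w -> ~ refine_bad E A rB s' w ->
  exists Q, forall j, gdist (localize_and_refine rA rB rC (A w) s s' j) (oact Q (x j))
    <= (16 + 33 * K) * rho.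
Proof.
move=> small sm s'm ss' es es' gs gs'; have hrho' := hrho.
have r0 := log_rate_ge0 R n.
(* Isotropy of the [m]-grid needs three points. Otherwise $n\le8$ and the smallness of [rho] would
   give $\log n=nr^2\le1/8$. *)
have m3 : (2 < m)%N.
  rewrite ltnNge; apply/negP => m2.
  have := ln_ge1 n4; rewrite -(nr2 R n4) => h.
  have nle : n%:R <= 8 :> R by rewrite (ler_nat R _ 8) nm (leq_mul (leqnn 4) m2).
  have rs : log_rate R n <= 8^-1 by lra.
  have : n%:R * log_rate R n ^+ 2 <= 8 * (8^-1 * 8^-1).
    by apply: ler_pM; rewrite ?sqr_ge0 // expr2; apply: ler_pM.
  by lra.
have [q [Q1 [hq pq hQ1]]] := stage_good m3 sm es gs.
have [q' [Q2 [hq' pq' hQ2]]] := stage_good m3 s'm es' gs'.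
have hp : PiSet n p by exists sigma.
exists Q1 => j.
have disj i : i \in s -> i \notin s'.
  move=> iS; apply/negP => /(fintype.subsetP ss').
  by rewrite inE iS.
apply: (combine_error m3 nm disj hp hq hq' pq pq' small _ _ hQ1 hQ2) => //.
- exact: ltW (stage_const_gt0 cl0 cL0 ce0).
- by move=> i; have := xp i; rewrite /=; lra.
exact: align_argmin.
Qed.

End GoodEvent.

Theorem theorem3p2 (R : realType) (cl cL ce : R)
    (hce : 0 <= ce) (hcl : 0 < cl) (hclL : cl <= cL) :
  exists2 C : R, 0 < C &
  forall (n : nat) (hn : (0 < n)%N) (h4n : (4 %| n)%N)
    (d : measure_display) (T : measurableType d) (P : probability T R)
    (xstar : 'I_n -> circle R) (fstar : circle R -> circle R -> R)
    (hfstar : biLip n cl cL ce fstar)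
    (F : 'M[R]_n) (hFsym : F^T = F) (hF : represents F xstar fstar)
    (E : 'I_n -> 'I_n -> {RV P >-> R})
    (hEint : forall i j : 'I_n, (i < j)%N ->
       P.-integrable [set: T] (EFin \o E i j))
    (hEcentered : forall i j : 'I_n, (i < j)%N -> ('E_P[E i j] = 0)%E)
    (hEindep : mutually_indep P
       (fun p : 'I_n * 'I_n => (p.1 < p.2)%N) (fun p => E p.1 p.2))
    (hEsub : subGaussian1 P (fun i j => E i j))
    (A : T -> 'M[R]_n)
    (hAsym : forall w, (A w)^T = A w)
    (hAdiag : forall w i, A w i i = 0)
    (hA : forall w (i j : 'I_n), (i < j)%N -> A w i j = F i j + E i j w)
    (S S' : T -> {set 'I_n})
    (hdraws : uniform_draws P (n %/ 4) S S')
    (hindep : indep_draws P A S S')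
    (rA rB : stage_rule R n (n %/ 4)) (rC : align_rule R n),
  exists G : set T,
    [/\ measurable G,
        ((1 - 5 / n%:R ^+ 2)%:E <= P G)%E &
        forall w, G w ->
        forall (x : 'I_n -> circle R) (f : circle R -> circle R -> R),
          representations F cl cL ce (x, f) ->
          dist_mod_orth (localize_and_refine rA rB rC (A w) (S w) (S' w)) x
            <= C * (dist_PiSet x + log_rate R n)].
Proof.
have cL0 : 0 <= cL by exact: le_trans (ltW hcl) hclL.
set K := stage_const cl cL ce.
have K0 : 0 < K by exact: stage_const_gt0.
(* $16\cdot32\cdot48=4\cdot2\cdot8\cdot384$ carries the bound past the diameter when [rho] is not
   small. The rest is $2(16+33K)$ from the procedure, as [rho <= 2 * (del + r)], plus $4K$ from the
   change of representation. *)
exists (16 * 32 * 48 + 2 * (16 + 35 * K)); first by lra.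
move=> n n0 h4n d T P xstar fstar hfstar F Fsym hF E hEint hEcentered indE hE A
  hAsym hAdiag hA S S' hdraws hindep rA rB rC.
have nm : n = (4 * (n %/ 4))%N by rewrite mulnC divnK.
have n4 : (3 < n)%N by exact: dvdn_leq n0 h4n.
set m := (n %/ 4)%N in rA rB hdraws nm *.
have r0 := log_rate_ge0 R n.
have rp : 0 < log_rate R n.
  by apply: lt_le_trans (invn_le_log_rate R n4); rewrite invr_gt0 ltr0n.
have dinf_ge0 (I : finType) (a b : I -> circle R) : 0 <= dinf a b by exact: bigmax_ge_id.
have dinf_ge (I : finType) (a b : I -> circle R) i : gdist (a i) (b i) <= dinf a b.
  exact: (le_bigmax _ (fun i => gdist (a i) (b i)) i).
pose pid (i : 'I_n) := circle_root R n i.+1.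
have PiSet_id : PiSet n pid by exists id => //; exists id.
pose errs := [set e : R | exists x f p,
  [/\ representations F cl cL ce (x, f), PiSet n p & e = dinf x p]].
have errs_lb : lbound errs 0 by move=> _ [x [f [p [_ _ ->]]]].
have errs_inf : has_inf errs.
  split; last by exists 0.
  by exists (dinf xstar pid), xstar, fstar, pid; split.
have [_ [x0 [f0 [p0 [hx0 hp0 ->]]]] near_opt] := inf_adherent rp errs_inf.
have [sigma sbij hsigma] := hp0.
have opt x f : representations F cl cL ce (x, f) -> dinf x0 p0 <= dist_PiSet x + log_rate R n.
  move=> hx; apply: le_trans (ltW near_opt) _; rewrite lerD2r.
  apply: lb_le_inf.
    by exists (dinf x pid), pid.
  by move=> _ [p hp <-]; apply: ge_inf; [exists 0 | exists x, f, p].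
set b := (n%:R ^+ 2)^-1 : R.
have b0 : 0 <= b by rewrite invr_ge0 exprn_ge0.
(* [refine_bad] is controlled for samples of size [m]; other sizes fall under the null event
   [draws_improper]. *)
pose bad_refine (rl : stage_rule R n m) (V : T -> {set 'I_n}) :=
  [set w | (if #|V w| == m then refine_bad E A rl (V w) else set0) w].
have bad_refineP rl V : (forall s, measurable (V @^-1` [set s])) ->
    (forall s g, gen_sigma (fun (k : 'I_n * 'I_n) w => A w k.1 k.2) g ->
      P (g `&` V @^-1` [set s]) = (P g * P (V @^-1` [set s]))%E) ->
    measurable (bad_refine rl V) /\ (P (bad_refine rl V) <= b%:E)%E.
  move=> mV indV.
  apply: (draw_bound mV (H := fun s => if #|s| == m then refine_bad E A rl s else set0)) => //.
    move=> s; case: eqP => sm; last exact: measurable0.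
    by have [] := refine_bad_prob nm n4 hE indE hAsym hAdiag hA rl sm.
  move=> s; case: eqP => sm; last by rewrite set0I measure0 mule_ge0.
  rewrite indV.
    rewrite muleC; apply: lee_wpmul2l => //.
    by have [] := refine_bad_prob nm n4 hE indE hAsym hAdiag hA rl sm.
  (* Above the diagonal the noise is [A] minus a constant, so the event lies in the sigma-algebra of
     [A], of which the draws are independent. *)
  have := refine_bad_sig hAsym hAdiag hA rl sm.
  apply: smallest_sub; first exact: smallest_sigma_algebra.
  move=> _ [[i j] /= [ij [B mB ->]]]; apply: sub_gen_smallest; exists (i, j).
  exists ((fun y => y - F i j) @^-1` B).
    rewrite -[_ @^-1` _]setTI.
    have mf : measurable_fun [set: R] (fun y : R => y - F i j).
      by apply: measurable_realfun.measurable_funB => //; exact: measurable_cst.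
    exact: mf.
  by apply/seteqP; split=> w /=; rewrite hA // addrAC subrr add0r.
have indS s g : gen_sigma (fun (k : 'I_n * 'I_n) w => A w k.1 k.2) g ->
      P (g `&` S @^-1` [set s]) = (P g * P (S @^-1` [set s]))%E.
  by move=> hg; apply: hindep => //; exists [set q | q.1 = s].
have indS' s g : gen_sigma (fun (k : 'I_n * 'I_n) w => A w k.1 k.2) g ->
      P (g `&` S' @^-1` [set s]) = (P g * P (S' @^-1` [set s]))%E.
  by move=> hg; apply: hindep => //; exists [set q | q.2 = s].
have mS s := (draws_measurable hdraws s).1.
have mS' s := (draws_measurable hdraws s).2.
have [mB1 hB1] := bad_refineP rA S mS indS.
have [mB2 hB2] := bad_refineP rB S' mS' indS'.
have [mB3 hB3] := localize_bad_prob hE nm n4.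
have uneven_le : #|[pred s : {set 'I_n} | (#|s| == m) && uneven R sigma s]|%:R / 'C(n, m)%:R <= b.
  have Cp : 0 < 'C(n, m)%:R :> R by rewrite ltr0n bin_gt0 nm leq_pmull.
  by rewrite ler_pdivrMr // mulrC; exact: card_uneven.
have [mB4 hB4] := draw_pred_bound mS (uneven R sigma) (first_draw_mass hdraws).
have [mB5 hB5] := draw_pred_bound mS' (uneven R sigma) (second_draw_mass nm hdraws).
have [mB6 hB6] := draws_improper_null hdraws.
pose B (i : 'I_6) := nth set0 [:: bad_refine rA S; bad_refine rB S'; localize_bad E m;
  [set w | uneven R sigma (S w)]; [set w | uneven R sigma (S' w)]; draws_improper m S S'] i.
pose bb (i : 'I_6) : R := nth 0 [:: b; b; b; b; b; 0] i.
have [mBad hBad] : measurable (\bigcup_i B i) /\ (P (\bigcup_i B i) <= (\sum_i bb i)%:E)%E.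
  apply: fin_bigcup_le => -[[|[|[|[|[|[|//]]]]]] hi] //=.
  - by apply: le_trans hB4 _; rewrite lee_fin.
  - by apply: le_trans hB5 _; rewrite lee_fin.
have sumbb : \sum_i bb i = 5 * b by rewrite 6!big_ord_recl big_ord0 /bb /=; ring.
exists (~` (\bigcup_i B i)); split.
- exact: measurableC.
- rewrite probability_setC // EFinB; apply: leeB => //.
  by apply: le_trans hBad _; rewrite sumbb lee_fin.
move=> w good x f hx.
have notB (i : 'I_6) : ~ B i w by move=> h; apply: good; exists i.
set del := dist_PiSet x; set r := log_rate R n in r0 rp opt near_opt *.
have del0 : 0 <= del.
  apply: lb_le_inf; first by exists (dinf x pid), pid.
  by move=> _ [p _ <-].
set out := localize_and_refine _ _ _ _ _ _.
have from_bound (M : R) Q : 0 <= M -> (forall j, gdist (out j) (oact Q (x j)) <= M) ->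
    dist_mod_orth out x <= M.
  move=> M0 hM; apply: le_trans (ge_inf _ (_ : _ (dinf out (oact Q \o x)))) _.
  - by exists 0 => _ [Q' _ <-].
  - by exists Q.
  - by apply: bigmax_le => // i _; exact: hM.
pose rho := dinf x0 p0 + r.
have rho_opt : rho <= 2 * (del + r).
  by have := opt x f hx; rewrite -/del /rho; lra.
have [small|big] := leP (384 * rho) 8^-1; last first.
  apply: (@from_bound _ (oid R)); first by apply: mulr_ge0; lra.
  move=> j; apply: le_trans (gdist_le4 _ _) _.
  have : 0 <= 2 * (16 + 35 * K) * (del + r) by apply: mulr_ge0; lra.
  by move: big rho_opt; lra.
have rrho : r <= rho by rewrite /rho lerDr.
have x0p i : gdist (x0 i) (circle_root R n (sigma i).+1) <= rho - r.
  by rewrite /rho addrK -hsigma.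
have : ~ draws_improper m S S' w by have := notB (inord 5); rewrite /B inordK.
rewrite /draws_improper /= => /negP; rewrite negbK => /and3P[/eqP sm /eqP s'm ss'].
have g1 : ~ refine_bad E A rA (S w) w.
  by have := notB (inord 0); rewrite /B inordK //= /bad_refine /= sm eqxx.
have g2 : ~ refine_bad E A rB (S' w) w.
  by have := notB (inord 1); rewrite /B inordK //= /bad_refine /= s'm eqxx.
have g3 : ~ localize_bad E m w by have := notB (inord 2); rewrite /B inordK.
have g4 : ~~ uneven R sigma (S w) by apply/negP; have := notB (inord 3); rewrite /B inordK.
have g5 : ~~ uneven R sigma (S' w) by apply/negP; have := notB (inord 4); rewrite /B inordK.
have [Q1 hQ1] := procedure_error hcl cL0 hce nm n4 Fsym hAsym hA hx0 sbij rrho x0p g3 rC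
  small sm s'm ss' g4 g5 g1 g2.
have [p hp xp] : exists2 p, PiSet n p & dinf x p <= del + r.
  have hinf : has_inf [set dinf x y | y in @PiSet R n 'I_n].
    split; first by exists (dinf x pid), pid.
    by exists 0 => _ [p _ <-].
  by have [_ [p hp <-] h] := inf_adherent rp hinf; exists p => //; exact: ltW.
(* One scale bounding [r] and the distances of both [x0] and [x] to their labellings, as
   [representation_unique] asks. *)
pose rho' := 2 * (del + r).
have [Q2 hQ2] : exists Q, forall i, gdist (x0 i) (oact Q (x i)) <= 2 * K * rho'.
  apply: (representation_unique hcl cL0 hce (ltnW n4) Fsym hx0 hx hp0 hp).
  - by rewrite -/r /rho'; lra.
  - by have := invn_le_log_rate R n4; rewrite -/r /rho'; lra.
  - by move=> i; have := dinf_ge _ x0 p0 i; have := opt x f hx; rewrite -/del /rho'; lra.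
  - by move=> i; have := dinf_ge _ x p i; move: xp; rewrite /rho'; lra.
apply: (@from_bound _ (omul Q1 Q2)); first by apply: mulr_ge0; lra.
move=> j; rewrite oact_mul.
apply: le_trans (gdist_triangle (oact Q1 (x0 j)) _ _) _.
have h1 := hQ1 j; have h2 := hQ2 j; rewrite gdist_oact.
have h3 : (16 + 33 * K) * rho <= (16 + 33 * K) * (2 * (del + r)).
  by apply: ler_wpM2l => //; lra.
by move: h1 h2 h3; rewrite -/out -/K /rho'; lra.
Qed.
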